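(* Let $d\ge2$ and let $F$ be an admissible integrand. Let $\mathbf{E}:=\{f\in C^\infty(\mathbb{T}): f\ge0\}$. For every rational vector $p\in\mathbb{R}\cdot\mathbb{Z}^d$ there exists a residual subset $\mathcal{O}(p)$ of $\mathbf{E}$ such that for every $f\in\mathcal{O}(p)$ the minimizer of the cell problem for the integrand $(x,\nu)\mapsto F(x,\nu)+f(x)|\nu|$, namely $$\min\left\{\int_{\mathbb{T}}F(x,p+Dv)+\int_{\mathbb{T}}f\,d|p+Dv|\;:\;v\in BV(\mathbb{T})\right\},$$ is unique up to an additive constant.
   Context: $\mathbb{T}=\mathbb{R}^d/\mathbb{Z}^d$. An admissible integrand is a function $F:\mathbb{R}^d\times\mathbb{R}^d\to\mathbb{R}$, $F=F(x,p)$, which is $\mathbb{Z}^d$-periodic in $x$, convex and one-homogeneous in $p$, satisfies $c_0|p|\le F(x,p)\le c_0^{-1}|p|$ for some $c_0>0$, is of class $\mathcal{C}^{2,\alpha}(\mathbb{R}^d\times(\mathbb{R}^d\setminus\{0\}))$ for some $\alpha\in(0,1)$, and is elliptic: there is $C>0$ such that $p\mapsto F(x,p)-C|p|$ is convex for all $x$. For $v\in BV(\mathbb{T})$, $F(x,p+Dv)$ denotes the measure $F\big(x,\frac{p+Dv}{|p+Dv|}\big)|p+Dv|$. $C^\infty(\mathbb{T})$ carries its usual Fréchet topology and $\mathbf{E}$ the induced (completely metrizable) topology. A subset is residual if it is a countable intersection of dense open sets. $\mathbb{R}\cdot\mathbb{Z}^d=\{tq: t\in\mathbb{R},q\in\mathbb{Z}^d\}$.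 *)

(* Defs.v *)
From HB Require Import structures.
From mathcomp Require Import all_boot all_order all_algebra.
From mathcomp Require Import all_classical all_reals all_analysis.
From mathcomp Require Import ring.

Set Implicit Arguments.
Unset Strict Implicit.
Unset Printing Implicit Defensive.

Import Order.TTheory GRing.Theory Num.Theory.
Import numFieldNormedType.Exports.

Local Open Scope classical_set_scope.
Local Open Scope ring_scope.

(* The norm `|p| of the library on 'rV_d is the sup norm. *)
Definition enorm (R : rcfType) (d : nat) (p : 'rV[R]_d) : R :=
  Num.sqrt (\sum_(i < d) p 0 i ^+ 2).

Section Enorm.
Context {R : rcfType} {d : nat}.
Implicit Types x y : 'rV[R]_d.

Lemma enorm_ge0 x : 0 <= enorm x.
Proof. exact: sqrtr_ge0. Qed.

Lemma enorm_sqr x : enorm x ^+ 2 = \sum_(i < d) x 0 i ^+ 2.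
Proof. by rewrite sqr_sqrtr// sumr_ge0// => i _; exact: sqr_ge0. Qed.

Lemma enorm0 : enorm (0 : 'rV[R]_d) = 0.
Proof.
by rewrite /enorm big1 ?sqrtr0// => i _; rewrite mxE expr0n.
Qed.

Lemma enorm_eq0 x : enorm x = 0 -> x = 0.
Proof.
move=> x0; have := enorm_sqr x; rewrite x0 expr0n/= => /esym/eqP.
rewrite psumr_eq0; last by move=> i _; exact: sqr_ge0.
move=> /allP h; apply/rowP => i; rewrite mxE.
by have := h i; rewrite mem_index_enum sqrf_eq0 => /(_ isT)/eqP.
Qed.

Lemma enorm_dot x y : \sum_(i < d) x 0 i * y 0 i <= enorm x * enorm y.
Proof.
have [/enorm_eq0 -> | xn0] := eqVneq (enorm x) 0.
  by rewrite enorm0 mul0r big1// => i _; rewrite mxE mul0r.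
have [/enorm_eq0 -> | yn0] := eqVneq (enorm y) 0.
  by rewrite enorm0 mulr0 big1// => i _; rewrite mxE mulr0.
have a0 : 0 < enorm x by rewrite lt_neqAle eq_sym xn0 enorm_ge0.
have b0 : 0 < enorm y by rewrite lt_neqAle eq_sym yn0 enorm_ge0.
have ab0 := mulr_gt0 a0 b0.
rewrite -(ler_pM2l ab0) -(ler_pM2l (ltr0n R 2)) !mulr_sumr.
rewrite (_ : 2 * _ = \sum_(i < d) ((enorm y * x 0 i) ^+ 2 +
    (enorm x * y 0 i) ^+ 2)); last first.
  rewrite big_split/=; under eq_bigr do rewrite exprMn.
  under [in X in _ = _ + X]eq_bigr do rewrite exprMn.
  by rewrite -!mulr_sumr -!enorm_sqr; ring.
apply: ler_sum => i _; rewrite -subr_ge0.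
rewrite (_ : _ - _ = (enorm y * x 0 i - enorm x * y 0 i) ^+ 2); first exact: sqr_ge0.
by ring.
Qed.

Lemma enormD x y : enorm (x + y) <= enorm x + enorm y.
Proof.
rewrite -(@ler_pXn2r _ 2)// ?nnegrE ?addr_ge0 ?enorm_ge0// enorm_sqr.
under eq_bigr do rewrite mxE sqrrD.
rewrite big_split/= big_split/= -!enorm_sqr sqrrD lerD2r lerD2l.
by rewrite sumrMnl lerMn2r/= enorm_dot.
Qed.

Lemma enorm_sum (I : Type) (r : seq I) (F : I -> 'rV[R]_d) :
  enorm (\sum_(i <- r) F i) <= \sum_(i <- r) enorm (F i).
Proof.
elim/big_ind2 : _ => [|a b a' b' ab ab'|//]; first by rewrite enorm0.
by rewrite (le_trans (enormD _ _))// lerD.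
Qed.

Lemma enorm_le_sum x : enorm x <= \sum_(i < d) `|x 0 i|.
Proof.
rewrite -(@ler_pXn2r _ 2)// ?nnegrE ?enorm_ge0 ?sumr_ge0// enorm_sqr.
rewrite expr2 mulr_suml; apply: ler_sum => i _.
rewrite -[x 0 i ^+ 2]real_normK ?num_real// expr2 ler_wpM2l//.
by rewrite (bigD1 i)//= lerDl sumr_ge0.
Qed.

End Enorm.

Section VectorMeasure.
Context {dT : measure_display} {T : measurableType dT} {R : realType} {n : nat}.

(* An R^n-valued measure is given by its n components. *)
Definition vmeasure := 'I_n -> {charge set T -> \bar R}.

Implicit Types (mu : vmeasure) (A B : set T).

Definition vval mu A : 'rV[R]_n := \row_i fine (mu i A).

(* The total variation |mu| for the Euclidean norm. The disjoint families need
   not cover A: for measurable A this does not change the supremum, and it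
   gives a nonnegative value at every set. *)
Definition tvar mu A : \bar R :=
  ereal_sup [set x | exists m (P : 'I_m -> set T),
    [/\ (forall k, measurable (P k)), trivIset setT P,
        (forall k, P k `<=` A)
      & x = (\sum_(k < m) enorm (vval mu (P k)))%:E]].

Local Open Scope ereal_scope.

Lemma vvalU mu A B : measurable A -> measurable B -> A `&` B = set0 ->
  vval mu (A `|` B) = (vval mu A + vval mu B)%R.
Proof.
move=> mA mB AB; apply/rowP => i; rewrite !mxE chargeU// fineD//;
  exact: fin_num_measure.
Qed.

Lemma vval0 mu : vval mu set0 = 0%R.
Proof. by apply/rowP => i; rewrite !mxE charge0. Qed.

Lemma tvar_ge0 mu A : 0 <= tvar mu A.
Proof.
apply: ereal_sup_ubound; exists 0%N, (fun=> set0); split=> //.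
- by case.
- by case.
- by rewrite big_ord0.
Qed.

Lemma le_tvar mu A B : A `<=` B -> tvar mu A <= tvar mu B.
Proof.
move=> AB; apply: le_ereal_sup => x [m [P [mP tP PA ->]]].
by exists m, P; split=> // k; exact: subset_trans AB.
Qed.

Lemma tvar0 mu : tvar mu set0 = 0.
Proof.
apply/eqP; rewrite eq_le tvar_ge0 andbT; apply: ge_ereal_sup.
move=> x [m [P [mP tP PA ->]]].
rewrite big1// => k _; have := PA k; rewrite subset0 => ->.
by rewrite vval0 enorm0.
Qed.

Lemma enorm_le_tvar mu A B : measurable A -> A `<=` B ->
  (enorm (vval mu A))%:E <= tvar mu B.
Proof.
move=> mA AB; apply: ereal_sup_ubound; exists 1%N, (fun=> A); split=> //.
  by move=> i j; rewrite !ord1.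
by rewrite big_ord1.
Qed.

Let tvarU_le mu A B : measurable A -> measurable B -> A `&` B = set0 ->
  tvar mu (A `|` B) <= tvar mu A + tvar mu B.
Proof.
move=> mA mB AB; apply: ge_ereal_sup => x [m [P [mP tP PAB ->]]].
have tI C : trivIset setT (fun k => P k `&` C).
  move=> i j _ _ [t [[Pit _] [Pjt _]]]; apply: tP => //.
  by exists t; split.
apply: (@le_trans _ _ ((\sum_(k < m) enorm (vval mu (P k `&` A)))%:E +
   (\sum_(k < m) enorm (vval mu (P k `&` B)))%:E)).
  rewrite -EFinD lee_fin -big_split/=; apply: ler_sum => k _.
  rewrite {1}(_ : P k = (P k `&` A) `|` (P k `&` B)); last first.
    by rewrite -setIUr; apply/esym/setIidPl.
  rewrite vvalU ?enormD//; [exact: measurableI..|].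
  by rewrite setIACA AB setI0.
have PC C : measurable C ->
    (\sum_(k < m) enorm (vval mu (P k `&` C)))%:E <= tvar mu C.
  move=> mC; apply: ereal_sup_ubound; exists m, (fun k => P k `&` C).
  split=> [k|||]; [exact: measurableI|exact: tI|by []|by []].
by apply: leeD; exact: PC.
Qed.

Let tvarU_ge mu A B : A `&` B = set0 ->
  tvar mu A + tvar mu B <= tvar mu (A `|` B).
Proof.
move=> AB.
have [->|fB] := eqVneq (tvar mu (A `|` B)) +oo; first exact: leey.
have AfB : tvar mu (A `|` B) \is a fin_num.
  by rewrite ge0_fin_numE ?tvar_ge0// ltey.
have Bf : tvar mu B \is a fin_num.
  rewrite ge0_fin_numE ?tvar_ge0//; apply: (@le_lt_trans _ _ (tvar mu (A `|` B))).
    by apply: le_tvar; exact: subsetUr.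
  by rewrite ltey.
rewrite -leeBrDr//; apply: ge_ereal_sup => x [m [P [mP tP PA ->]]].
rewrite leeBrDr// addeC -leeBrDr//; apply: ge_ereal_sup => y [l [Q [mQ tQ QB ->]]].
rewrite leeBrDr// -EFinD; apply: ereal_sup_ubound.
exists (l + m)%N, (fun k => match fintype.split k with inl i => Q i | inr j => P j end).
split.
- by move=> k; case: fintype.split.
- move=> i j _ _; case: (fintype.splitP i) => i' ii'; case: (fintype.splitP j) => j' jj'.
  + by move=> /tQ ij; apply/val_inj => /=; rewrite ii' jj' ij.
  + by move=> [t [/QB Bt /PA At]]; have : set0 t by rewrite -AB.
  + by move=> [t [/PA At /QB Bt]]; have : set0 t by rewrite -AB.
  + by move=> /tP ij; apply/val_inj => /=; rewrite ii' jj' ij.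
- by move=> k; case: fintype.split => i; [apply: subset_trans (QB i) _; exact: subsetUr|
    apply: subset_trans (PA i) _; exact: subsetUl].
- rewrite big_split_ord/=; congr (_ + _)%:E; apply: eq_bigr => i _.
    by rewrite -[lshift _ _]/(fintype.unsplit (inl i)) fintype.unsplitK.
  by rewrite -[rshift _ _]/(fintype.unsplit (inr i)) fintype.unsplitK.
Qed.

Lemma tvarU mu A B : measurable A -> measurable B -> A `&` B = set0 ->
  tvar mu (A `|` B) = tvar mu A + tvar mu B.
Proof. by move=> mA mB AB; apply/le_anti; rewrite tvarU_le// tvarU_ge. Qed.

Let charge_dom mu : exists L : 'I_n -> {measure set T -> \bar R},
  forall i, L i setT < +oo /\ forall A, measurable A -> `|mu i A| <= L i A.
Proof.
have /boolp.choice[L LP] : forall i, exists l : {measure set T -> \bar R},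
    l setT < +oo /\ forall A, measurable A -> `|mu i A| <= l A.
  move=> i; have [P [N PN]] := Hahn_decomposition (mu i).
  exists (charge_variation PN); split.
    by rewrite -ge0_fin_numE// fin_num_measure.
  by move=> A mA; exact: abse_charge_variation.
by exists L.
Qed.

Let tvar_dom mu (L : 'I_n -> {measure set T -> \bar R}) :
  (forall i A, measurable A -> `|mu i A| <= L i A) ->
  forall A, measurable A -> tvar mu A <= \sum_(i < n) L i A.
Proof.
move=> Lmu A mA; apply: ge_ereal_sup => x [m [P [mP tP PA ->]]].
apply: (@le_trans _ _ (\sum_(k < m) \sum_(i < n) L i (P k))).
  rewrite -sumEFin; apply: lee_sum => k _.
  apply: (@le_trans _ _ (\sum_(i < n) `|vval mu (P k) 0%R i|%:E)).
    by rewrite sumEFin lee_fin enorm_le_sum.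
  apply: lee_sum => i _; rewrite mxE -abse_EFin fineK ?fin_num_measure//.
  exact: Lmu.
rewrite exchange_big/=; apply: lee_sum => i _.
have mUP : measurable (\big[setU/set0]_(k < m) P k).
  by apply: bigsetU_measurable => k _; exact: mP.
rewrite -measure_semi_additive_ord//; apply: le_measure; rewrite ?inE//.
by elim/big_ind : _ => // X Y XA YA; rewrite subUset.
Qed.

Lemma tvar_fin mu : tvar mu setT < +oo.
Proof.
have [L LP] := charge_dom mu.
apply: le_lt_trans (tvar_dom (fun i => (LP i).2) measurableT) _.
by apply: lte_sum_pinfty => i _; exact: (LP i).1.
Qed.

Let tvar_semi_sigma_additive mu : semi_sigma_additive (tvar mu).
Proof.
move=> F mF tF mUF.
have [L LP] := charge_dom mu.
set U := \bigcup_k F k; pose V k := \big[setU/set0]_(0 <= i < k) F i.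
have mV k : measurable (V k) by exact: bigsetU_measurable.
have VU k : V k `<=` U.
  by rewrite /V big_mkord; exact: bigsetU_bigcup.
have fT A : tvar mu A \is a fin_num.
  rewrite ge0_fin_numE ?tvar_ge0//; apply: le_lt_trans (tvar_fin mu).
  exact: le_tvar.
have VE k : \sum_(0 <= i < k) tvar mu (F i) = tvar mu (V k).
  elim: k => [|k ih]; first by rewrite /V !big_nil tvar0.
  rewrite /V !big_nat_recr//= ih tvarU; [by []|exact: mV|exact: mF|].
  rewrite big_mkord -subset0 -bigcup_mkord => t [[i /= ik Fit] Fkt].
  have ik' : i = k by apply: tF => //; exists t.
  by rewrite ik' ltnn in ik.
have UE k : tvar mu (V k) = tvar mu U - tvar mu (U `\` V k).
  rewrite -[in tvar mu U](setDUK (VU k)) tvarU//; first by rewrite addeK.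
  + exact: measurableD.
  + by rewrite -subset0 => t [Vt [_ nVt]].
under eq_fun do rewrite VE UE.
suff : tvar mu U - tvar mu (U `\` V k) @[k --> \oo] --> tvar mu U - 0.
  by rewrite sube0.
apply: cvgeB; [by rewrite fin_num_adde_defr|exact: cvg_cst|].
have W0 : \bigcap_k (U `\` V k) = set0.
  rewrite -subset0 => t Wt; have [[i _ Fit] _] := Wt 0%N I.
  have [_] := Wt i.+1 I; apply.
  by rewrite /V big_mkord -bigcup_mkord; exists i => /=.
have mW k : measurable (U `\` V k) by exact: measurableD.
have cL : (\sum_(i < n) L i (U `\` V k)) @[k --> \oo] --> 0.
  have L0 : \sum_(i < n) L i (\bigcap_k (U `\` V k)) = 0.
    by rewrite big1// => i _; rewrite W0 measure0.
  suff : (\sum_(i < n) L i (U `\` V k)) @[k --> \oo] -->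
    \sum_(i < n) L i (\bigcap_k (U `\` V k)) by rewrite L0.
  apply: cvg_nnesum => i _; first exact: nearW.
  apply: nonincreasing_cvg_mu => //.
  - apply: le_lt_trans (LP i).1; apply: le_measure; rewrite ?inE//.
  - by rewrite W0.
  - move=> k l kl; apply/subsetPset; apply: setDS.
    by rewrite /V !big_mkord; exact: subset_bigsetU.
apply: (squeeze_cvge _ (cvg_cst _) cL).
apply: nearW => k; rewrite tvar_ge0/=.
by apply: tvar_dom => [i A mA|]; [exact: (LP i).2|exact: measurableD].
Qed.

HB.instance Definition _ mu := isMeasure.Build _ _ _ (tvar mu)
  (tvar0 mu) (tvar_ge0 mu) (@tvar_semi_sigma_additive mu).

Let tvar_fin_num_fun mu : fin_num_fun (tvar mu).
Proof.
move=> A mA; rewrite ge0_fin_numE//; apply: le_lt_trans (tvar_fin mu).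
exact: le_tvar.
Qed.

HB.instance Definition _ mu := Measure_isFinite.Build _ _ _ (tvar mu)
  (tvar_fin_num_fun mu).

Lemma dominates_tvar mu i : mu i `<< tvar mu.
Proof.
apply/null_content_dominatesP => A mA muA0.
have : (enorm (vval mu A))%:E <= 0 by rewrite -muA0 enorm_le_tvar.
rewrite lee_fin => eA.
have /enorm_eq0/rowP/(_ i) : enorm (vval mu A) = 0%R.
  by apply/le_anti; rewrite eA enorm_ge0.
by rewrite !mxE => /eqP; rewrite fine_eq0 ?fin_num_measure// => /eqP.
Qed.

(* The density mu / |mu| of the polar decomposition of mu. *)
Definition polar mu (x : T) : 'rV[R]_n :=
  \row_i fine (Radon_Nikodym (mu i) (tvar mu) x).

End VectorMeasure.

(* The torus R^d/Z^d is represented by Z^d-periodic functions on R^d and by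
   measures on R^d carried by the fundamental domain [0, 1[^d. *)

Definition row_display : measure_display.
Proof. exact: default_measure_display. Qed.

Section TorusMeasure.
Context {R : realType}.

Section RowSigmaAlgebra.
Variable n : nat.

Let coord (i : 'I_n) (x : 'rV[R]_n) : measurableTypeR R := x 0 i.

Let row_set0 : g_sigma_preimage coord set0.
Proof. exact: sigma_algebra0. Qed.

Let row_setC A : g_sigma_preimage coord A -> g_sigma_preimage coord (~` A).
Proof. exact: sigma_algebraC. Qed.

Let row_bigcup (F : (set 'rV[R]_n)^nat) :
  (forall i, g_sigma_preimage coord (F i)) ->
  g_sigma_preimage coord (\bigcup_i F i).
Proof. exact: sigma_algebra_bigcup. Qed.

(* The Borel sigma-algebra of R^n, generated by the coordinates. *)
HB.instance Definition _ :=
  @isMeasurable.Build row_display 'rV[R]_n (g_sigma_preimage coord)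
    row_set0 row_setC row_bigcup.

End RowSigmaAlgebra.

Section ConsRow.
Variable n : nat.

Definition cons_row (z : measurableTypeR R * 'rV[R]_n) : 'rV[R]_n.+1 :=
  \row_i (if unlift ord0 i is Some j then z.2 0 j else z.1).

Lemma measurable_cons_row : measurable_fun setT cons_row.
Proof.
apply: (@measurability _ _ _ _ _ _
  (\big[setU/set0]_(i < n.+1) preimage_set_system setT
     (fun x : 'rV[R]_n.+1 => x 0 i : measurableTypeR R) measurable)) => //.
move=> _ [B + <-]; rewrite -bigcup_seq => -[i /= _ [C mC <-]].
rewrite !setTI.
case: (unliftP ord0 i) => [j ->|->]; last first.
  rewrite (_ : _ @^-1` _ = fst @^-1` C); last first.
    by apply/funext => z /=; rewrite mxE unlift_none.
  by have := @measurable_fst _ _ (measurableTypeR R) 'rV[R]_n measurableT C mC;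
    rewrite setTI.
rewrite (_ : _ @^-1` _ =
    snd @^-1` ((fun x : 'rV[R]_n => x 0 j : measurableTypeR R) @^-1` C)); last first.
  by apply/funext => z /=; rewrite mxE liftK.
rewrite -[X in measurable X]setTI; apply: measurable_snd => //.
apply: sub_sigma_algebra.
rewrite -bigcup_seq; exists j; first by rewrite /= mem_index_enum.
by exists C => //; rewrite setTI.
Qed.

HB.instance Definition _ :=
  isMeasurableFun.Build _ _ _ _ cons_row measurable_cons_row.

End ConsRow.

(* The d-fold product of the Lebesgue measure on [0, 1]. *)
Fixpoint torus_measure (n : nat) : probability 'rV[R]_n R :=
  match n with
  | 0 => \d_(0 : 'rV[R]_0)
  | n'.+1 => distribution (uniform_prob (@ltr01 R) \x torus_measure n')%E
               (@cons_row n')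
  end.

End TorusMeasure.
Arguments torus_measure : clear implicits.

Section Smooth.
Context {R : realType}.

Definition partial (V : normedModType R) (I : Type) (e : I -> V) (s : seq I)
    (f : V -> R^o) : V -> R^o :=
  foldr (fun i g x => 'D_(e i) g x) f s.

Variable d : nat.

Definition ebase (i : 'I_d) : 'rV[R]_d := delta_mx 0 i.

Definition ebase2 (i : 'I_d + 'I_d) : 'rV[R]_d * 'rV[R]_d :=
  match i with inl j => (ebase j, 0) | inr j => (0, ebase j) end.

Definition smooth (f : 'rV[R]_d -> R) : Prop :=
  forall s : seq 'I_d, continuous (partial ebase s f) /\
    forall i x, derivable (partial ebase s f) x (ebase i).

(* Class C^{2,alpha} on the open set D; the Hoelder condition is local,
   i.e., uniform on the compact subsets of D. *)
Definition C2alpha (alpha : R) (D : set ('rV[R]_d * 'rV[R]_d))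
    (f : 'rV[R]_d * 'rV[R]_d -> R) : Prop :=
  [/\ forall s z, (size s <= 2)%N -> D z ->
        {for z, continuous (partial ebase2 s f)},
      forall s i z, (size s < 2)%N -> D z ->
        derivable (partial ebase2 s f) z (ebase2 i)
    & forall s (K : set ('rV[R]_d * 'rV[R]_d)), size s = 2%N ->
        compact K -> K `<=` D ->
        exists C : R, forall z w, K z -> K w ->
          `|partial ebase2 s f z - partial ebase2 s f w| <=
            C * `|z - w| `^ alpha].

Definition periodic (U : Type) (f : 'rV[R]_d -> U) : Prop :=
  forall (k : 'rV[int]_d) x, f (x + map_mx intr k) = f x.

Record Cinf := MkCinf {
  Cinf_fun :> 'rV[R]_d -> R ;
  Cinf_periodic : periodic Cinf_fun ;
  Cinf_smooth : smooth Cinf_fun }.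

HB.instance Definition _ := gen_eqMixin Cinf.
HB.instance Definition _ := gen_choiceMixin Cinf.

(* The Frechet topology: uniform convergence of every partial derivative. *)
HB.instance Definition _ := Topological.copy Cinf
  (sup_topology (fun s : seq 'I_d => Topological.class
    (initial_topology
      (fun f : Cinf => partial ebase s f : {uniform 'rV[R]_d -> R^o})))).

Definition nonneg_Cinf : set Cinf := [set f | forall x, 0 <= f x].

Definition convex_on_space (h : 'rV[R]_d -> R) :=
  @convex_function R 'rV[R]_d setT h.

Definition admissible (F : 'rV[R]_d -> 'rV[R]_d -> R) : Prop :=
  [/\ forall p, periodic (F ^~ p),
      forall x, convex_on_space (F x),
      forall x p t, 0 < t -> F x (t *: p) = t * F x p
    & [/\ exists c0 : R, 0 < c0 /\ forall x p,
            c0 * enorm p <= F x p <= c0^-1 * enorm p,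
          exists alpha : R, 0 < alpha < 1 /\
            C2alpha alpha [set z | z.2 != 0] (fun z => F z.1 z.2)
        & exists C : R, 0 < C /\
            forall x, convex_on_space (fun p => F x p - C * enorm p)]].

Definition rational_vector (p : 'rV[R]_d) : Prop :=
  exists (t : R) (q : 'rV[int]_d), p = t *: map_mx intr q.

End Smooth.
Arguments Cinf : clear implicits.
Arguments nonneg_Cinf : clear implicits.

Definition residual (T : topologicalType) (O : set T) : Prop :=
  exists U : (set T)^nat,
    (forall n, open (U n) /\ dense (U n)) /\ O = \bigcap_n U n.

Section CellProblem.
Context {R : realType} {d : nat}.

Local Notation leb := (torus_measure R d).

Definition fund_cube : set 'rV[R]_d := [set x | forall i, 0 <= x 0 i < 1].

(* mu is the distributional derivative Dv; v is in BV iff it is in L^1 and such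
   a (finite) mu exists. The integral of phi against mu i is written through
   the polar decomposition. Carrying mu by the half-open cube makes it a
   measure on the torus: jumps of v across the faces are charged once. *)
Definition is_gradient (v : 'rV[R]_d -> R)
    (mu : @vmeasure _ 'rV[R]_d R d) : Prop :=
  (forall i A, measurable A -> A `&` fund_cube = set0 -> mu i A = 0%E) /\
  (forall (phi : Cinf R d) (i : 'I_d),
    \int[leb]_x (v x * 'D_(ebase i) phi x)%:E =
    - \int[tvar mu]_x (phi x * polar mu x 0 i)%:E)%E.

Definition L1torus (v : 'rV[R]_d -> R) : Prop :=
  periodic v /\ leb.-integrable setT (EFin \o v).

(* The vector measure p + Dv. *)
Definition shift_vmeasure (p : 'rV[R]_d) (mu : @vmeasure _ 'rV[R]_d R d) :
    @vmeasure _ 'rV[R]_d R d :=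
  fun i => cadd (cscale (p 0 i) (charge_of_finite_measure leb)) (mu i).

Definition cell_energy (F : 'rV[R]_d -> 'rV[R]_d -> R) (f : 'rV[R]_d -> R)
    (mu : @vmeasure _ 'rV[R]_d R d) : \bar R :=
  (\int[tvar mu]_x (F x (polar mu x))%:E + \int[tvar mu]_x (f x)%:E)%E.

Definition is_minimizer (F : 'rV[R]_d -> 'rV[R]_d -> R) (f : 'rV[R]_d -> R)
    (p : 'rV[R]_d) (v : 'rV[R]_d -> R) : Prop :=
  L1torus v /\ exists2 mu, is_gradient v mu &
    forall w nu, L1torus w -> is_gradient w nu ->
      (cell_energy F f (shift_vmeasure p mu) <= cell_energy F f (shift_vmeasure p nu))%E.

End CellProblem.

(* Main.v *)
From HB Require Import structures.
From mathcomp Require Import all_boot all_order all_algebra finmap.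
From mathcomp Require Import all_classical all_reals all_analysis measurable_realfun.
From mathcomp Require Import ring lra zify.
Require Import Defs.

(* Let G(f) be the minimum of the cell problem. As a minimum of functions that
   are affine in f it is concave, and if [mu1], [mu2] are the measures p + Dv of
   two minimizers for f, then for every trigonometric g and small t > 0
     G(f + t g) + G(f - t g) - 2 G(f) <= t (int g d|mu1| - int g d|mu2|).
   The weights at which, for each m, the left-hand side exceeds - t / m for some
   t form an open set since G is continuous; the set is dense since the second
   differences of a concave function along the segments f + s g telescope, hence
   cannot all be large. For f in the intersection of these sets over the countable
   family of the functions g and over m, all minimizers have the same measure
   |p + Dv|. The mean of two minimizers is again one, with the same |p + Dv|, and
   the strict convexity of the Euclidean ball then gives Dv = Dw.

   Minimizers exist by the compactness of Young measures: the pairs (position,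
   direction) of a minimizing sequence are coded by binary digits, an ultrafilter
   selects the limit law of the digits, and calibrations of the convex integrand F
   give the lower semicontinuity. The limit is a gradient because its Fourier
   coefficients are curl-free; a primitive is obtained by convolution with a
   vector field of divergence delta_0 - 1. No compactness of BV in L^1 is used. *)

Set Implicit Arguments.
Unset Strict Implicit.
Unset Printing Implicit Defensive.

Import Order.TTheory GRing.Theory Num.Theory.
Import numFieldNormedType.Exports.

Local Open Scope classical_set_scope.
Local Open Scope ring_scope.

(** * Bounded measurable functions and continuous functionals *)

Import HBNNSimple.

Section BoundedMeasurable.
Context {dT : measure_display} {T : measurableType dT} {R : realType}.
Implicit Types (a b : T -> R) (L : (T -> R) -> R).

(** Every minimizer for f gives a supergradient g -> int g d|p + Dv| of the concave function G, so a
    small second difference means that G is nearly differentiable along g, and then all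
    supergradients nearly agree. The obstacle is that weights may vanish, so that f - t g can leave
    the cone of nonnegative functions: the open sets therefore require f to exceed t by a margin,
    and the density argument first lifts f by a small constant, after which a whole segment of
    perturbations is admissible. Coding by digits reduces the compactness to the masses of countably
    many cylinders. Their limits are again consistent, and a quantile construction realizes them as
    the law of digits that are functions of one uniform variable on [0, 1]. Equality of measures and
    the gradient condition are both tested on characters only. Differentiation of a test function is
    not continuous under bounded convergence, so the passage from characters to all smooth test
    functions goes through finite differences. *)

Definition bmeas a := measurable_fun setT a /\ exists C : R, forall x, `|a x| <= C.

Lemma bmeas_cst (c : R) : bmeas (cst c).
Proof. by split; [exact: measurable_cst|exists `|c|]. Qed.

Lemma bmeasD a b : bmeas a -> bmeas b -> bmeas (fun x => a x + b x).
Proof.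
move=> [ma [C aC]] [mb [D bD]]; split; first exact: measurable_funD.
by exists (C + D) => x; rewrite (le_trans (ler_normD _ _))// lerD.
Qed.

Lemma bmeasM a b : bmeas a -> bmeas b -> bmeas (fun x => a x * b x).
Proof.
move=> [ma [C aC]] [mb [D bD]]; split; first exact: measurable_funM.
by exists (C * D) => x; rewrite normrM ler_pM.
Qed.

Lemma bmeasZ c a : bmeas a -> bmeas (fun x => c * a x).
Proof. by move=> ma; apply: bmeasM => //; exact: bmeas_cst. Qed.

Lemma bmeasB a b : bmeas a -> bmeas b -> bmeas (fun x => a x - b x).
Proof.
move=> ma mb; have := bmeasD ma (bmeasZ (-1) mb).
by congr bmeas; apply/funext => x; rewrite mulN1r.
Qed.

Lemma bmeas_indic A : measurable A -> bmeas (\1_A).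
Proof.
move=> mA; split; first exact: measurable_indic.
by exists 1 => x; rewrite indicE; case: (_ \in _); rewrite ?normr1 ?normr0.
Qed.

Lemma bmeas_sum (I : Type) (r : seq I) (F : I -> T -> R) :
  (forall i, bmeas (F i)) -> bmeas (fun x => \sum_(i <- r) F i x).
Proof.
move=> mF; elim: r => [|i r ih].
  have := bmeas_cst 0; congr bmeas.
  by apply/funext => x; rewrite big_nil.
have := bmeasD (mF i) ih; congr bmeas.
by apply/funext => x; rewrite big_cons.
Qed.

Lemma bmeas_comp (d' : measure_display) (S : measurableType d') (X : S -> T) a :
  measurable_fun setT X -> bmeas a ->
  measurable_fun setT (a \o X) /\ exists C : R, forall x, `|(a \o X) x| <= C.
Proof.
move=> mX [ma [C aC]]; split; first exact: measurableT_comp.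
by exists C => x; exact: aC.
Qed.

(* The linear functionals [a |-> \int a dm], for m a signed measure, are
   characterized by continuity under bounded pointwise convergence; phrasing
   the comparisons of measures on functionals avoids manipulating charges. *)
Record bcf L : Prop := Bcf {
  bcfD : forall a b, bmeas a -> bmeas b -> L (fun x => a x + b x) = L a + L b;
  bcfZ : forall c a, bmeas a -> L (fun x => c * a x) = c * L a;
  bcf_cvg : forall (a_ : nat -> T -> R) a C, (forall n, measurable_fun setT (a_ n)) ->
    (forall n x, `|a_ n x| <= C) -> (forall x, a_ n x @[n --> \oo] --> a x) ->
    L (a_ n) @[n --> \oo] --> L a }.

Lemma bcf0 L : bcf L -> L (cst 0) = 0.
Proof.
move=> bL; have := bcfZ bL 0 (bmeas_cst 0); rewrite mul0r => h.
by rewrite -[RHS]h; congr L; apply/funext => x; rewrite mul0r.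
Qed.

Lemma bcfB L a b : bcf L -> bmeas a -> bmeas b ->
  L (fun x => a x - b x) = L a - L b.
Proof.
move=> bL ma mb; rewrite -(mulN1r (L b)) -(bcfZ bL)// -(bcfD bL)//; last exact: bmeasZ.
by congr L; apply/funext => x; rewrite mulN1r.
Qed.

Lemma bcf_sum L (I : Type) (r : seq I) (F : I -> T -> R) :
  bcf L -> (forall i, bmeas (F i)) ->
  L (fun x => \sum_(i <- r) F i x) = \sum_(i <- r) L (F i).
Proof.
move=> bL mF; elim: r => [|i r ih].
  rewrite big_nil -[RHS](bcf0 bL); congr L.
  by apply/funext => x; rewrite big_nil.
rewrite big_cons -ih -(bcfD bL) //; last exact: bmeas_sum.
by congr L; apply/funext => x; rewrite big_cons.
Qed.

Lemma bcf_lin L1 L2 (c1 c2 : R) : bcf L1 -> bcf L2 ->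
  bcf (fun a => c1 * L1 a + c2 * L2 a).
Proof.
move=> b1 b2; split => [a b ma mb|c a ma|a_ a C ma aC aa].
- by rewrite (bcfD b1)// (bcfD b2)//; ring.
- by rewrite (bcfZ b1)// (bcfZ b2)//; ring.
- apply: cvgD; apply: cvgM; try exact: cvg_cst.
  + exact: bcf_cvg aa.
  + exact: bcf_cvg aa.
Qed.

Lemma bcf_indic_eq0 L : bcf L -> (forall A, measurable A -> L (\1_A) = 0) ->
  forall a, bmeas a -> L a = 0.
Proof.
move=> bL L0 a ma; have [ma1 [C aC]] := ma.
(* Adding the bound [C] makes the function nonnegative, so that it is an increasing limit of simple
   functions; the constant itself is a multiple of the indicator of the whole space. *)
pose g x : R := a x + C.
have g0 x : 0 <= g x.
  by have := aC x; rewrite ler_norml => /andP[]; rewrite /g; lra.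
have mg : measurable_fun setT (EFin \o g).
  by apply/measurable_EFinP; apply: measurable_funD.
suff Lg : L g = 0.
  have LC : L (cst C) = 0.
    have := bcfZ bL C (bmeas_indic measurableT); rewrite (L0 _ measurableT) mulr0 => <-.
    by congr L; apply/funext => x; rewrite indicT/= mulr1.
  have := bcfD bL ma (bmeas_cst C); rewrite LC addr0 => <-.
  by rewrite -Lg.
pose s n := nnsfun_approx measurableT mg n.
have cs x : s n x @[n --> \oo] --> g x.
  have /= := cvg_nnsfun_approx measurableT mg (fun x _ => (g0 x : (0 <= (EFin \o g) x)%E)) (I : setT x).
  by move/fine_cvg.
have s0 n x : 0 <= s n x by exact: fun_ge0.
have sg n x : s n x <= g x.
  have nd : nondecreasing_seq (fun n => s n x).
    by move=> p q pq; have /lefP := nd_nnsfun_approx measurableT mg pq; exact.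
  have := nondecreasing_cvgn_le nd (cvgP _ (cs x)) n.
  by move/cvg_lim : (cs x) => ->.
have Ls n : L (s n) = 0.
  rewrite (_ : (s n : T -> R) = fun x => \sum_(y <- fset_set (range (s n)))
      y * \1_(s n @^-1` [set y]) x); last first.
    by apply/funext => x; rewrite {1}fimfunE fsbig_finite.
  rewrite bcf_sum//; first last.
    by move=> i; apply: bmeasZ; apply: bmeas_indic.
  rewrite big1// => i _; rewrite (bcfZ bL); last exact: bmeas_indic.
  by rewrite L0 ?mulr0.
have : L (s n) @[n --> \oo] --> L g.
  apply: (bcf_cvg bL (C := C + C)) => // n x.
  rewrite ger0_norm// (le_trans (sg n x))// lerD2r (le_trans (ler_norm _))//.
under eq_fun do rewrite Ls.
by move/cvg_lim => <- //; rewrite lim_cst.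
Qed.

Lemma bcf_indic_eq L1 L2 : bcf L1 -> bcf L2 ->
  (forall A, measurable A -> L1 (\1_A) = L2 (\1_A)) ->
  forall a, bmeas a -> L1 a = L2 a.
Proof.
move=> b1 b2 L12 a ma; have := bcf_indic_eq0 (bcf_lin 1 (-1) b1 b2).
move=> /(_ _ a ma) h; apply/eqP; rewrite -subr_eq0 -[X in X - _]mul1r -mulN1r h//.
by move=> A mA; rewrite L12// mul1r mulN1r subrr.
Qed.

End BoundedMeasurable.

Section PushedIntegral.
Context {dT : measure_display} {T : measurableType dT}
  {dO : measure_display} {O : measurableType dO} {R : realType}.
Variables (th : {measure set O -> \bar R}) (X : O -> T) (Q : O -> R).

(** The integral of [a] against the image under [X] of the signed measure with density [Q] with
    respect to [th]. The components of a vector measure, the barycentre of a Young measure and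
    convolutions all have this form. *)
Definition pint (a : T -> R) : R := \int[th]_w (a (X w) * Q w).

Hypotheses (mX : measurable_fun setT X) (iQ : th.-integrable setT (EFin \o Q)).

Lemma pint_integrable a : bmeas a ->
  th.-integrable setT (EFin \o (fun w => a (X w) * Q w)).
Proof.
move=> [ma [C aC]].
rewrite (_ : _ \o _ = (EFin \o (a \o X)) \* (EFin \o Q))%E; last first.
  by apply/funext => w /=; rewrite EFinM.
apply: integrableMr => //; first exact: measurableT_comp.
exists C; split; first exact: num_real.
by move=> y Cy x _ /=; apply/ltW/(le_lt_trans _ Cy)/aC.
Qed.

Lemma bcf_pint : bcf pint.
Proof.
have mQ := measurable_int _ iQ.
split => [a b ma mb|c a ma|a_ a C ma aC aa].
- rewrite /pint -RintegralD//; try exact: pint_integrable.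
  by apply: eq_Rintegral => w _; rewrite mulrDl.
- rewrite /pint -RintegralZl//; last exact: pint_integrable.
  by apply: eq_Rintegral => w _; rewrite mulrA.
- have ma' : measurable_fun setT a by apply: (measurable_fun_cvg ma) => x _.
  have aC' x : `|a x| <= C.
    by apply: (cvgr_to_le (cvg_norm (aa x))); apply: nearW => n; exact: aC.
  apply: fine_cvg; rewrite fineK; last first.
    by apply: integrable_fin_num => //; apply: pint_integrable; split => //; exists C.
  have [|||||//] := @dominated_convergence _ O R th setT measurableT
    (fun n w => (a_ n (X w) * Q w)%:E) (fun w => (a (X w) * Q w)%:E)
    (fun w => (`|C| * `|Q w|)%:E).
  + move=> n; apply/measurable_EFinP; apply: measurable_funM.
      exact: measurableT_comp.
    exact/measurable_EFinP.
  + apply/measurable_EFinP; apply: measurable_funM; first exact: measurableT_comp.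
    exact/measurable_EFinP.
  + apply: aeW => w _; apply: cvg_EFin; first exact: nearW.
    by apply: cvgM => //; exact: cvg_cst.
  + have := integrableZl measurableT `|C| (integrable_abse iQ).
    by apply: eq_integrable => // w _ /=; rewrite EFinM.
  + apply: aeW => w n _ /=; rewrite lee_fin normrM ler_wpM2r//.
    by rewrite (le_trans (aC n _))// ler_norm.
Qed.

End PushedIntegral.

(** * Trigonometric functions on the torus *)

Section RowMeasurability.
Context {R : realType}.

Lemma measurable_coord n (i : 'I_n) :
  measurable_fun setT (fun x : 'rV[R]_n => x 0 i).
Proof.
move=> _ C mC; rewrite setTI; apply: sub_sigma_algebra.
by rewrite -bigcup_seq; exists i => /=; [rewrite mem_index_enum|exists C => //; rewrite setTI].
Qed.

Lemma measurable_row (d : measure_display) (S : measurableType d) n (X : S -> 'rV[R]_n) :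
  (forall i, measurable_fun setT (fun w => X w 0 i)) -> measurable_fun setT X.
Proof.
move=> mX; apply: (@measurability _ _ _ _ _ _
  (\big[setU/set0]_(i < n) preimage_set_system setT
     (fun x : 'rV[R]_n => x 0 i : measurableTypeR R) measurable)) => //.
move=> _ [B + <-]; rewrite -bigcup_seq => -[i /= _ [C mC <-]].
rewrite !setTI; have := mX i measurableT C mC; by rewrite setTI.
Qed.

Lemma measurable_rowP (d : measure_display) (S : measurableType d) n (X : S -> 'rV[R]_n) :
  measurable_fun setT X -> forall i, measurable_fun setT (fun w => X w 0 i).
Proof. by move=> mX i; apply: (measurableT_comp (measurable_coord i)). Qed.

Lemma measurable_floor : measurable_fun setT (fun x : R => (Num.floor x)%:~R : R).
Proof.
apply: nondecreasing_measurable => // x y xy.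
by rewrite ler_int le_floor.
Qed.

(** The projection onto the torus, with the fundamental cube as set of representatives. *)
Definition fracr n (x : 'rV[R]_n) : 'rV[R]_n :=
  \row_i (x 0 i - (Num.floor (x 0 i))%:~R).

Lemma fracr_cube n (x : 'rV[R]_n) : fund_cube (fracr x).
Proof.
move=> i; rewrite mxE; have /andP[h1 h2] := floor_itv (x 0 i).
by rewrite subr_ge0 h1/= ltrBlDl; move: h2; rewrite intrD.
Qed.

Lemma fracrE n (x : 'rV[R]_n) :
  fracr x = x + map_mx intr (\row_i - Num.floor (x 0 i)).
Proof. by apply/rowP => i; rewrite !mxE rmorphN. Qed.

Lemma fracr_id n (x : 'rV[R]_n) : fund_cube x -> fracr x = x.
Proof.
move=> cx; apply/rowP => i; rewrite mxE (_ : Num.floor _ = 0) ?subr0//.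
by apply/eqP; rewrite floor_eq add0r; exact: cx.
Qed.

Lemma periodic_fracr n U (a : 'rV[R]_n -> U) x : periodic a -> a (fracr x) = a x.
Proof. by rewrite fracrE; exact. Qed.

Lemma fracr_periodic n : periodic (@fracr n).
Proof.
move=> k x; apply/rowP => i; rewrite !mxE floorDrz ?intr_int//.
by rewrite intrKfloor intrD; ring.
Qed.

Lemma measurable_fracr n : measurable_fun setT (@fracr n).
Proof.
apply: measurable_row => i.
rewrite (_ : (fun _ => _) = fun w : 'rV[R]_n => w 0 i - (Num.floor (w 0 i))%:~R); last first.
  by apply/funext => w; rewrite mxE.
apply: measurable_funB; first exact: measurable_coord.
apply: (measurableT_comp measurable_floor); exact: measurable_coord.
Qed.

Lemma measurable_rowD (d : measure_display) (S : measurableType d) n (X Y : S -> 'rV[R]_n) :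
  measurable_fun setT X -> measurable_fun setT Y -> measurable_fun setT (fun w => X w + Y w).
Proof.
move=> mX mY; apply: measurable_row => i.
under eq_fun do rewrite mxE.
by apply: measurable_funD; exact: measurable_rowP.
Qed.

Lemma measurable_rowZ (d : measure_display) (S : measurableType d) n (c : S -> R)
    (X : S -> 'rV[R]_n) :
  measurable_fun setT c -> measurable_fun setT X -> measurable_fun setT (fun w => c w *: X w).
Proof.
move=> mc mX; apply: measurable_row => i.
under eq_fun do rewrite mxE.
by apply: measurable_funM => //; exact: measurable_rowP.
Qed.

Lemma measurable_fund_cube n : measurable (@fund_cube R n).
Proof.
rewrite (_ : fund_cube = \bigcap_(i in [set: 'I_n])
    ((fun x : 'rV[R]_n => x 0 i) @^-1` `[0, 1[)); last first.
  apply/seteqP; split => x cx; first by move=> i _; rewrite /= in_itv/=; exact: cx.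
  by move=> i; have := cx i I; rewrite /= in_itv.
apply: fin_bigcap_measurable => // i _.
rewrite -[X in measurable X]setTI; exact: measurable_coord.
Qed.

End RowMeasurability.

Section RealContinuous.
Context {R : realType} {T : topologicalType}.
Implicit Types f g : T -> R.

Lemma continuous_addr f g : continuous f -> continuous g -> continuous (fun x => f x + g x).
Proof. by move=> cf cg x; exact: cvgD (cf x) (cg x). Qed.

Lemma continuous_mulr f g : continuous f -> continuous g -> continuous (fun x => f x * g x).
Proof. by move=> cf cg x; exact: cvgM (cf x) (cg x). Qed.

Lemma continuous_const (c : R) : continuous (fun _ : T => c).
Proof. by move=> x; exact: cvg_cst. Qed.

Lemma continuous_sumr (I : Type) (r : seq I) (f : I -> T -> R) :
  (forall i, continuous (f i)) -> continuous (fun x => \sum_(i <- r) f i x).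
Proof.
move=> cf; elim: r => [|i r ih].
  by under eq_fun do rewrite big_nil; exact: continuous_const.
by under eq_fun do rewrite big_cons; exact: continuous_addr.
Qed.

End RealContinuous.

Section Trig.
Context {R : realType} {d : nat}.
Implicit Types (k l : 'rV[int]_d) (x y : 'rV[R]_d) (t : R).

Definition dotz k x : R := \sum_i (k 0 i)%:~R * x 0 i.

(** The real characters: phase 0 gives the cosine and phase - pi / 2 the sine. With a free phase a
    single family is stable under translations, and its span is stable under products. *)
Definition trig k t x : R := cos (2 * pi * dotz k x + t).

Lemma dotzD k x y : dotz k (x + y) = dotz k x + dotz k y.
Proof. by rewrite /dotz -big_split; apply: eq_bigr => i _; rewrite mxE/=; ring. Qed.

Lemma dotzZ k c x : dotz k (c *: x) = c * dotz k x.
Proof. by rewrite /dotz mulr_sumr; apply: eq_bigr => i _; rewrite mxE; ring. Qed.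

Lemma dotzDl k l x : dotz (k + l) x = dotz k x + dotz l x.
Proof. by rewrite /dotz -big_split; apply: eq_bigr => i _; rewrite mxE/= intrD; ring. Qed.

Lemma dotzNl k x : dotz (- k) x = - dotz k x.
Proof. by rewrite /dotz -sumrN; apply: eq_bigr => i _; rewrite mxE/= rmorphN; ring. Qed.

Lemma dotz_base k i : dotz k (ebase i) = (k 0 i)%:~R.
Proof.
rewrite /dotz (bigD1 i)//= mxE !eqxx mulr1 big1 ?addr0// => j ji.
by rewrite mxE eqxx/= (negbTE ji) mulr0.
Qed.

Lemma trig_shift k t x y : trig k t (x + y) = trig k (t + 2 * pi * dotz k y) x.
Proof. by rewrite /trig dotzD; congr cos; ring. Qed.

Lemma cosD2piz (z : int) t : cos (t + 2 * pi * z%:~R) = cos t :> R.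
Proof.
have nat_case (n : nat) s : cos (s + 2 * pi * n%:R) = cos s :> R.
  rewrite -[RHS](periodicn (@cosD2pi R) n); congr cos.
  by rewrite -mulrnA -[pi *+ _]mulr_natr natrM; ring.
case: z => n; first exact: nat_case.
by rewrite NegzE rmorphN/= -[LHS](nat_case n.+1); congr cos; ring.
Qed.

Lemma trig_periodic k t : periodic (trig k t).
Proof.
move=> l x; rewrite trig_shift {2}/trig -(cosD2piz (\sum_i k 0 i * l 0 i)) /trig.
congr cos; rewrite -addrA; congr (_ + (_ + _ * _)).
by rewrite /dotz rmorph_sum; apply: eq_bigr => i _; rewrite mxE rmorphM.
Qed.

Lemma trigM k l t u x :
  trig k t x * trig l u x = 2^-1 * trig (k + l) (t + u) x + 2^-1 * trig (k - l) (t - u) x.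
Proof.
rewrite /trig !dotzDl dotzNl.
set a := 2 * pi * dotz k x + t; set b := 2 * pi * dotz l x + u.
rewrite (_ : 2 * pi * _ + (t + u) = a + b); last by rewrite /a /b; ring.
rewrite (_ : 2 * pi * _ + (t - u) = a - b); last by rewrite /a /b; ring.
by rewrite [cos (a + b)]cosD [cos (a - b)]cosB; field.
Qed.

(** A linear functional on the characters of frequency [k] is thus known from two phases a quarter
    period apart, which keeps the family of test functions countable. *)
Lemma trig_rot k t u x :
  trig k (t + u) x = cos u * trig k t x + sin u * trig k (t + pi / 2) x.
Proof. by rewrite /trig !addrA cosDpihalf cosD; ring. Qed.

Lemma trig_le1 k t x : `|trig k t x| <= 1.
Proof. exact: cos_max. Qed.

Lemma trig0 t x : trig 0 t x = cos t.
Proof.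
rewrite /trig /dotz big1 ?mulr0 ?add0r// => i _; by rewrite mxE mul0r.
Qed.

Lemma measurable_dotz k : measurable_fun setT (dotz k).
Proof.
apply: measurable_sum => i; apply: measurable_funM => //; exact: measurable_coord.
Qed.

Lemma measurable_trig k t : measurable_fun setT (trig k t).
Proof.
apply: (measurableT_comp (continuous_measurable_fun (@continuous_cos R))).
apply: measurable_funD => //; apply: measurable_funM => //; exact: measurable_dotz.
Qed.

Lemma bmeas_trig k t : bmeas (trig k t).
Proof. by split; [exact: measurable_trig|exists 1 => x; exact: trig_le1]. Qed.

Lemma continuous_dotz k : continuous (dotz k).
Proof.
apply: continuous_sumr => i; apply: continuous_mulr; first exact: continuous_const.
exact: coord_continuous.
Qed.

Lemma continuous_trig k t : continuous (trig k t : 'rV[R]_d -> R^o).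
Proof.
move=> x; apply: (@continuous_comp _ _ _ (fun y => 2 * pi * dotz k y + t) (@cos R)).
  apply: continuous_addr; last exact: continuous_const.
  by apply: continuous_mulr; [exact: continuous_const|exact: continuous_dotz].
exact: continuous_cos.
Qed.

(* Phase shifting makes the family [trig] stable under differentiation. *)
Lemma is_derive_trig k t i x : is_derive x (ebase i) (trig k t : 'rV[R]_d -> R^o)
  (2 * pi * (k 0 i)%:~R * trig k (t + pi / 2) x).
Proof.
pose f (h : R) : R := cos (h * (2 * pi * (k 0 i)%:~R) + (2 * pi * dotz k x + t)).
have df : is_derive (0 : R) 1 f (2 * pi * (k 0 i)%:~R * trig k (t + pi / 2) x).
  apply: is_derive_eq.
  rewrite mul0r add0r /trig addrA cosDpihalf/= /GRing.scale/=; ring.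
have E : (fun h : R => h^-1 *: ((trig k t : 'rV[R]_d -> R^o) (h *: ebase i + x) - trig k t x)) =
         (fun h : R => h^-1 *: ((f : R -> R^o) (h *: 1 + 0) - f 0)).
  apply/funext => h; rewrite addr0 /f/= /trig dotzD dotzZ dotz_base mul0r add0r.
  congr (_ *: (cos _ - _)); rewrite /GRing.scale/=; ring.
have [d1 d2] := df.
split; first by rewrite /derivable E.
by rewrite /derive E.
Qed.

(** The amplitude and the phase are left unspecified: the shape alone yields continuity and a bound
    on every derivative. *)
Lemma partial_trig k t s : exists (c u : R),
  partial (@ebase R d) s (trig k t : 'rV[R]_d -> R^o) = fun x => c * trig k u x.
Proof.
elim: s => [|i s [c [u ih]]] /=.
  by exists 1, t; apply/funext => x; rewrite mul1r.
exists (c * (2 * pi * (k 0 i)%:~R)), (u + pi / 2); apply/funext => x.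
have dk := is_derive_trig k u i x.
rewrite -/(partial _ _ _) ih.
rewrite -[LHS]/('D_(ebase i) (c \*: (trig k u : 'rV[R]_d -> R^o)) x).
rewrite (@derive_val _ _ _ _ _ _ _ (is_deriveZ c dk)) /GRing.scale/=.
by rewrite !mulrA.
Qed.

Lemma smooth_trig k t : smooth (trig k t).
Proof.
move=> s; have [c [u ->]] := partial_trig k t s; split.
  by apply: continuous_mulr; [exact: continuous_const|exact: continuous_trig].
move=> i x; have dk := is_derive_trig k u i x.
by apply: (@derivableZ _ _ _ (trig k u : _ -> R^o)).
Qed.

Definition trigC k t : Cinf R d := MkCinf (trig_periodic k t) (smooth_trig k t).

Inductive tpoly : ('rV[R]_d -> R) -> Prop :=
| tpoly_trig k t c : tpoly (fun x => c * trig k t x)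
| tpolyD a b : tpoly a -> tpoly b -> tpoly (fun x => a x + b x).

Lemma tpoly_cst c : tpoly (cst c).
Proof.
have := tpoly_trig 0 0 c; congr tpoly.
by apply/funext => x; rewrite trig0 cos0 mulr1.
Qed.

Lemma tpolyM a b : tpoly a -> tpoly b -> tpoly (fun x => a x * b x).
Proof.
move=> ta; elim: ta b => {a}[k t c|a a' _ iha _ iha'] b tb; last first.
  have := tpolyD (iha _ tb) (iha' _ tb); congr tpoly.
  by apply/funext => x; rewrite mulrDl.
elim: tb => {b}[l u e|b b' _ ihb _ ihb']; last first.
  by have := tpolyD ihb ihb'; congr tpoly; apply/funext => x; rewrite mulrDr.
have := tpolyD (tpoly_trig (k + l) (t + u) (c * e * 2^-1)) (tpoly_trig (k - l) (t - u) (c * e * 2^-1)).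
congr tpoly; apply/funext => x.
rewrite (_ : c * trig k t x * _ = c * e * (trig k t x * trig l u x)); last by ring.
by rewrite trigM; ring.
Qed.

Lemma tpolyZ c a : tpoly a -> tpoly (fun x => c * a x).
Proof. by apply: tpolyM; exact: tpoly_cst. Qed.

Lemma bmeas_tpoly a : tpoly a -> bmeas a.
Proof.
elim => [k t c|b b' _ mb _ mb']; first exact/bmeasZ/bmeas_trig.
exact: bmeasD.
Qed.

Lemma bcf_tpoly0 (L : ('rV[R]_d -> R) -> R) : bcf L ->
  (forall k t, L (trig k t) = 0) -> forall a, tpoly a -> L a = 0.
Proof.
move=> bL L0 a; elim => [k t c|b b' tb b0 tb' b'0].
  by rewrite (bcfZ bL) ?L0 ?mulr0//; exact: bmeas_trig.
by rewrite (bcfD bL) ?b0 ?b'0 ?addr0//; exact: bmeas_tpoly.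
Qed.

Lemma bcf_trig_rot (L : ('rV[R]_d -> R) -> R) k t u : bcf L ->
  L (trig k (t + u)) = cos u * L (trig k t) + sin u * L (trig k (t + pi / 2)).
Proof.
move=> bL; rewrite -!(bcfZ bL); try exact: bmeas_trig.
rewrite -(bcfD bL); try exact/bmeasZ/bmeas_trig.
by congr L; apply/funext => x; rewrite trig_rot.
Qed.

End Trig.

(** * Measures on the torus are determined by their Fourier coefficients *)

Section TrigUniqueness.
Context {R : realType}.

(* Iterating [x |-> (3 x - x^3) / 2] on [-1, 1] converges to the sign function:
   this makes indicators of half-spaces limits of trigonometric polynomials. *)
Definition sgn_step (x : R) : R := (3 * x - x ^+ 3) / 2.

Definition sgn_iter n (x : R) : R := iter n sgn_step x.

Lemma sgn_stepN x : sgn_step (- x) = - sgn_step x.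
Proof. by rewrite /sgn_step; field. Qed.

Lemma sgn_iterN n x : sgn_iter n (- x) = - sgn_iter n x.
Proof. by elim: n => //= n ih; rewrite [sgn_iter n (- x)]ih sgn_stepN. Qed.

Lemma sgn_iter0 n : sgn_iter n 0 = 0.
Proof. by elim: n => //= n ->; rewrite /sgn_step; ring. Qed.

(** The distance to 1 becomes (1 - y)^2 (2 + y) / 2, that is, 1 - y times the factor 1 - (y + y^2) /
    2, which is at most 1 - x / 2. *)
Lemma sgn_step_itv (x y : R) : 0 <= x -> x <= y <= 1 ->
  x <= sgn_step y <= 1 /\ 1 - sgn_step y <= (1 - x / 2) * (1 - y).
Proof.
move=> x0 /andP[xy y1]; have y0 := le_trans x0 xy.
have h : 0 <= (1 - y) * (1 - y) * (2 + y) by rewrite !mulr_ge0//; lra.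
have h2 : 0 <= y * (1 - y) * (1 + y) by rewrite !mulr_ge0//; lra.
have yy : 0 <= y * y by rewrite mulr_ge0.
have h3 : 0 <= (1 - y) * (y - x + y * y) by apply: mulr_ge0; lra.
rewrite /sgn_step; split; first by apply/andP; split; nra.
nra.
Qed.

(** The iterates never fall below their starting point, so the same contraction factor serves at
    each step and the convergence to 1 is geometric. *)
Lemma sgn_iter_gt0 n (x : R) : 0 < x <= 1 ->
  x <= sgn_iter n x <= 1 /\ 1 - sgn_iter n x <= (1 - x / 2) ^+ n.
Proof.
move=> /andP[x0 x1]; elim: n => [|n [ih1 ih2]] /=.
  by rewrite lexx x1 expr0; split=> //; lra.
have [h1 h2] := sgn_step_itv (ltW x0) ih1; split => //.
by rewrite exprS (le_trans h2)// ler_wpM2l//; lra.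
Qed.

Lemma sgn_iter_le1 n (x : R) : `|x| <= 1 -> `|sgn_iter n x| <= 1.
Proof.
have pos y : 0 < y -> y <= 1 -> `|sgn_iter n y| <= 1.
  move=> y0 y1; have [|/andP[h1 h2] _] := @sgn_iter_gt0 n y; first by rewrite y0.
  by rewrite ger0_norm// (le_trans (ltW y0)).
have [x0|x0|->] := ltgtP x 0; last by rewrite sgn_iter0 normr0.
  rewrite -(normrN x) => x1; rewrite -(normrN (sgn_iter n x)) -sgn_iterN.
  by apply: pos; [rewrite oppr_gt0|exact: le_trans (ler_norm _) x1].
by move=> x1; apply: pos => //; exact: le_trans (ler_norm _) x1.
Qed.

Lemma cvg_sgn_iter (x : R) : `|x| <= 1 -> sgn_iter n x @[n --> \oo] --> Num.sg x.
Proof.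
have pos y : 0 < y -> y <= 1 -> sgn_iter n y @[n --> \oo] --> (1 : R).
  move=> y0 y1; apply: (@squeeze_cvgr _ _ _ _ (fun n => 1 - (1 - y / 2) ^+ n) (cst 1)).
  - apply: nearW => n.
    have [|/andP[h1 h2] h3] := @sgn_iter_gt0 n y; first by rewrite y0.
    by rewrite h2 andbT lerBlDl -lerBlDr.
  - rewrite -[X in _ --> X]subr0; apply: cvgB; first exact: cvg_cst.
    by apply: cvg_expr; rewrite ger0_norm; lra.
  - exact: cvg_cst.
have [x0|x0|->] := ltgtP x 0; last first.
- by move=> _; rewrite sgr0; under eq_fun do rewrite sgn_iter0; exact: cvg_cst.
- by move=> x1; rewrite gtr0_sg//; apply: pos => //; exact: le_trans (ler_norm _) x1.
rewrite ltr0_sg// -(normrN x) => x1.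
rewrite (_ : (fun n => _) = fun n => - sgn_iter n (- x)); last first.
  by apply/funext => n; rewrite sgn_iterN opprK.
by apply: cvgN; apply: pos; [rewrite oppr_gt0|exact: le_trans (ler_norm _) x1].
Qed.

Lemma tpoly_sgn_iter d (z : 'rV[R]_d -> R) n : tpoly z -> tpoly (fun x => sgn_iter n (z x)).
Proof.
move=> tz; elim: n => [|n ih]//=.
have t3 : tpoly (fun x => sgn_iter n (z x) * (sgn_iter n (z x) * sgn_iter n (z x))).
  by apply: tpolyM => //; exact: tpolyM.
have := tpolyD (tpolyZ (3 / 2) ih) (tpolyZ (- 2^-1) t3); congr tpoly.
by apply/funext => x; rewrite /sgn_step -/(sgn_iter n (z x)); field.
Qed.

Context {d : nat}.
Implicit Types (L : ('rV[R]_d -> R) -> R) (W z : 'rV[R]_d -> R).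

(** Periodic functions do not separate points that differ by an integer vector; a functional that
    sees only the cube has no such ambiguity. *)
Definition cube_carried L := forall a b, bmeas a -> bmeas b ->
  (forall x, fund_cube x -> a x = b x) -> L a = L b.

Lemma measurable_ge0_set z : measurable_fun setT z -> measurable [set x | 0 <= z x].
Proof.
move=> mz; rewrite (_ : [set _ | _] = setT `&` z @^-1` `[0, +oo[%classic); first exact: mz.
by rewrite setTI; apply/seteqP; split => x /=; rewrite in_itv/= andbT.
Qed.

(** The indicator is a bounded pointwise limit of trigonometric polynomials, which the hypothesis
    absorbs into [T]. The factor [W] carries the indicators treated before, so the lemma can be
    iterated over the coordinates. *)
Lemma bcf_mul_indic L W z : bcf L -> bmeas W -> tpoly z -> (forall x, `|z x| <= 1) ->
  (forall T, tpoly T -> L (fun x => T x * W x) = 0) ->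
  forall T, tpoly T -> L (fun x => T x * (\1_[set x | 0 <= z x] x * W x)) = 0.
Proof.
move=> bL mW tz z1 LW T tT.
(* The polynomial 1 - (s^2 - s) / 2 takes the values 0, 1, 1 at s = -1, 0, 1: in the limit it is the
   indicator of [0 <= z], the zero set included. *)
pose g n x := 1 - (sgn_iter n (z x) * sgn_iter n (z x) - sgn_iter n (z x)) / 2.
have tg n : tpoly (g n).
  have ts := tpoly_sgn_iter n tz.
  have := tpolyD (tpoly_cst 1) (tpolyD (tpolyZ (2^-1) ts) (tpolyZ (- 2^-1) (tpolyM ts ts))).
  by congr tpoly; apply/funext => x; rewrite /g /=; field.
have L0 n : L (fun x => T x * (g n x * W x)) = 0.
  rewrite -(LW _ (tpolyM tT (tg n))); congr L.
  by apply/funext => x; rewrite mulrA.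
have [_ [C TC]] := bmeas_tpoly tT; have [_ [D WD]] := mW.
suff : L (fun x => T x * (g n x * W x)) @[n --> \oo] -->
    L (fun x => T x * (\1_[set x | 0 <= z x] x * W x)).
  under eq_fun do rewrite L0.
  by move/cvg_lim => <- //; rewrite lim_cst.
apply: (bcf_cvg bL (C := C * (2 * D))) => [n|n x|x].
- have [h _] : bmeas (fun x => T x * (g n x * W x)).
    by apply: bmeasM; [exact: bmeas_tpoly|apply: bmeasM => //; exact: bmeas_tpoly].
  exact: h.
- rewrite !normrM ler_pM ?mulr_ge0// ler_pM//.
  have := sgn_iter_le1 n (z1 x); rewrite ler_norml => /andP[s1 s2].
  by rewrite /g ler_norml; apply/andP; split; nra.
- apply: cvgM; first exact: cvg_cst.
  apply: cvgM; last exact: cvg_cst.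
  rewrite indicE.
  have cs := cvg_sgn_iter (z1 x).
  rewrite (_ : (_ : bool)%:R = 1 - (Num.sg (z x) * Num.sg (z x) - Num.sg (z x)) / 2).
    apply: cvgB; first exact: cvg_cst.
    by apply: cvgM; [apply: cvgB => //; exact: cvgM|exact: cvg_cst].
  have [z0|z0|z0] := ltgtP (z x) 0.
  + by rewrite memNset/=; [rewrite ltr0_sg//; field|rewrite lt_geF].
  + by rewrite mem_set/=; [rewrite gtr0_sg//; field|exact: ltW].
  + by rewrite mem_set/= z0 ?sgr0//; field.
Qed.

(** Over the full period that starts at - c / 2, the cosine exceeds its value at the end of the arc
    of half-length c / 2 exactly on that arc. Beyond 1 / 2, the reflection of [y] to 1 - y returns
    to the interval where the cosine decreases. *)
Lemma cos_le_cospi (c y : R) : 0 <= c < 1 -> - (c / 2) <= y < 1 - c / 2 ->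
  (cos (pi * c) <= cos (2 * pi * y)) = (y <= c / 2).
Proof.
move=> /andP[c0 c1] /andP[y0 y1].
have p0 := pi_gt0 R.
have [yc|cy] := leP y (c / 2).
  have hy : `|y| <= c / 2 by rewrite ler_norml y0.
  rewrite -(cos_norm (2 * pi * y)) normrM (ger0_norm (_ : 0 <= 2 * pi)); last by lra.
  by rewrite leNgt ltr_cos ?in_itv/= -?leNgt; [nra| |]; have := normr_ge0 y; nra.
apply/negbTE; rewrite -ltNge.
have [yh|hy] := leP y (1 / 2).
  by rewrite ltr_cos ?in_itv/=; nra.
rewrite (_ : cos (2 * pi * y) = cos (2 * pi * (1 - y))); last first.
  rewrite -cosN -[RHS](cosD2piz (-1)); congr cos; rewrite rmorphN1; ring.
by rewrite ltr_cos ?in_itv/=; nra.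
Qed.

(** Half of cos (2 pi (x_i - c / 2)) - cos (pi c): on the cube it is nonnegative exactly on the arc
    from 0 to [c], which is centred at c / 2. The factor 1 / 2 keeps it in [-1, 1], where [sgn_iter]
    converges. *)
Definition zcoord (c : R) (i : 'I_d) x : R :=
  2^-1 * trig (delta_mx 0 i) (- (pi * c)) x + - (2^-1 * cos (pi * c)).

Lemma tpoly_zcoord c i : tpoly (zcoord c i).
Proof. exact: tpolyD (tpoly_trig _ _ _) (tpoly_cst _). Qed.

Lemma zcoord_le1 c i x : `|zcoord c i x| <= 1.
Proof.
have h1 := trig_le1 (delta_mx 0 i) (- (pi * c)) x; have h2 := cos_max (pi * c).
move: h1 h2; rewrite /zcoord !ler_norml => /andP[? ?] /andP[? ?].
by apply/andP; split; lra.
Qed.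

Lemma zcoord_ge0 c i x : 0 <= c < 1 -> fund_cube x ->
  (0 <= zcoord c i x) = (x 0 i <= c).
Proof.
move=> c01 /(_ i)/andP[x0 x1]; have /andP[c0 c1] := c01.
rewrite /zcoord subr_ge0 ler_pM2l ?invr_gt0// /trig.
rewrite (_ : dotz _ x = x 0 i); last first.
  rewrite /dotz (bigD1 i)//= mxE !eqxx mul1r big1 ?addr0// => j ji.
  by rewrite mxE eqxx/= (negbTE ji) mul0r.
rewrite (_ : _ - pi * c = 2 * pi * (x 0 i - c / 2)); last by field.
rewrite cos_le_cospi//; last by apply/andP; split; lra.
by apply/idP/idP; lra.
Qed.

(** A threshold outside [0, 1[ cuts nothing or everything out of the cube; there [zcoord] would give
    a wrong arc, and a constant is used instead. *)
Definition half_ind (c : R) (i : 'I_d) : 'rV[R]_d -> R :=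
  if c < 0 then cst 0 else if c < 1 then \1_[set x | 0 <= zcoord c i x] else cst 1.

Lemma bmeas_half_ind c i : bmeas (half_ind c i).
Proof.
rewrite /half_ind; case: ifPn => _; first exact: bmeas_cst.
case: ifPn => _; last exact: bmeas_cst.
apply: bmeas_indic; apply: measurable_ge0_set.
by have [] := bmeas_tpoly (tpoly_zcoord c i).
Qed.

Lemma half_indE c i x : fund_cube x -> half_ind c i x = (x 0 i <= c)%R%:R.
Proof.
move=> cx; have /andP[x0 x1] := cx i; rewrite /half_ind; case: ifPn => [c0|].
  by rewrite leNgt (lt_le_trans c0 x0).
rewrite -leNgt => c0; case: ifPn => [c1|].
  rewrite indicE -(@zcoord_ge0 c i x) ?c0//.
  case: (boolP (0 <= zcoord c i x)) => h; first by rewrite mem_set.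
  by rewrite memNset//=; exact/negP.
by rewrite -leNgt => c1; rewrite (le_trans (ltW x1) c1).
Qed.

Definition half_prod (c : 'I_d -> R) (s : seq 'I_d) x : R :=
  \prod_(i <- s) half_ind (c i) i x.

Lemma bmeas_half_prod c s : bmeas (half_prod c s).
Proof.
elim: s => [|i s ih].
  rewrite (_ : half_prod c [::] = cst 1); first exact: bmeas_cst.
  by apply/funext => x; rewrite /half_prod big_nil.
have := bmeasM (bmeas_half_ind (c i) i) ih; congr bmeas.
by apply/funext => x; rewrite /half_prod big_cons.
Qed.

Lemma bcf_half_prod L c s : bcf L -> (forall T, tpoly T -> L T = 0) ->
  forall T, tpoly T -> L (fun x => T x * half_prod c s x) = 0.
Proof.
move=> bL L0; elim: s => [|i s ih] T tT.
  rewrite -(L0 _ tT); congr L; apply/funext => x.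
  by rewrite /half_prod big_nil mulr1.
rewrite (_ : (fun _ => _) = fun x => T x * (half_ind (c i) i x * half_prod c s x)); last first.
  by apply/funext => x; rewrite /half_prod big_cons.
rewrite /half_ind; case: ifPn => _.
  rewrite -[RHS](bcf0 bL); congr L; apply/funext => x /=.
  by rewrite mul0r mulr0.
case: ifPn => _; last first.
  by rewrite -[RHS](ih T tT); congr L; apply/funext => x /=; rewrite mul1r.
apply: bcf_mul_indic => //; [exact: bmeas_half_prod|exact: tpoly_zcoord|exact: zcoord_le1].
Qed.

Definition lower_orthant (c : 'I_d -> R) : set 'rV[R]_d := [set x | forall i, x 0 i <= c i].

Lemma half_prodE c x : fund_cube x -> half_prod c (enum 'I_d) x = \1_(lower_orthant c) x.
Proof.
move=> cx; rewrite /half_prod indicE.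
have [/= h|/= h] := pselect (lower_orthant c x).
  by rewrite mem_set// big1// => i _; rewrite half_indE// h.
rewrite memNset//.
have [i hi] : exists i, ~ (x 0 i <= c i).
  by apply/existsNP => h'; exact: h.
by rewrite (bigD1_seq i) ?mem_enum ?enum_uniq//= half_indE// (negbTE (introN idP hi)) mul0r.
Qed.

Lemma measurable_lower_orthant c : measurable (lower_orthant c).
Proof.
rewrite (_ : lower_orthant c = \bigcap_(i in [set: 'I_d])
    ((fun x : 'rV[R]_d => x 0 i) @^-1` `]-oo, c i])); last first.
  apply/seteqP; split => x cx; first by move=> i _; rewrite /= in_itv/=; exact: cx.
  by move=> i; have := cx i I; rewrite /= in_itv.
apply: fin_bigcap_measurable => // i _.
rewrite -[X in measurable X]setTI; exact: measurable_coord.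
Qed.

Lemma sub_sigma_lower_orthant :
  (@measurable _ 'rV[R]_d) `<=` <<s [set A | exists c, A = lower_orthant c] >>.
Proof.
set G := [set A | _].
suff : measurable_fun setT (fun x : g_sigma_algebraType G => x : 'rV[R]_d).
  by move=> h A mA; have := h measurableT A mA; rewrite setTI.
apply: measurable_row => i.
apply: (measurability _ (RGenOInfty.measurableE R)) => _ [_ [a ->] <-].
(* The complementary half-space is the union over [m] of the orthants that bound all other
   coordinates by [m]. *)
rewrite setTI (_ : _ @^-1` _ = ~` \bigcup_m
    lower_orthant (fun j => if j == i then a else m%:R)).
  apply: measurableC; apply: bigcupT_measurable => m.
  by apply: sub_sigma_algebra; exists (fun j => if j == i then a else m%:R).
apply/seteqP; split => x /=; rewrite in_itv/= andbT.
  by move=> ax [m _ /(_ i)]; rewrite eqxx leNgt ax.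
move=> nx; rewrite ltNge; apply/negP => xa; apply: nx.
(* A sum of upper bounds of the individual coordinates bounds them all at once. *)
exists (\sum_(j < d) (Num.trunc (`|x 0 j|)%R).+1)%N => // j.
case: eqP => [->//|_]; rewrite (le_trans (ler_norm _))//.
rewrite (le_trans (ltW (truncnS_gt _)))// ler_nat (bigD1 j)//=.
exact: leq_addr.
Qed.

(** The functional vanishes on trigonometric polynomials, hence on products of half-space
    indicators, one per coordinate; on the cube these are the indicators of lower orthants. Orthants
    are stable under intersection and generate the Borel sets, and the sets of zero value form a
    lambda-system. *)
Theorem bcf_trig_eq0 L : bcf L -> cube_carried L ->
  (forall k t, L (trig k t) = 0) -> forall a, bmeas a -> L a = 0.
Proof.
move=> bL cL Lk; have L0 := bcf_tpoly0 bL Lk.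
apply: bcf_indic_eq0 => // A mA.
pose H := [set A : set 'rV[R]_d | measurable A /\ L (\1_A) = 0].
suff HG : <<s [set A | exists c, A = lower_orthant c] >> `<=` H.
  by have [] := HG A (sub_sigma_lower_orthant mA).
apply: lambda_system_subset => //.
- move=> _ _ [c ->] [c' ->]; exists (fun i => Num.min (c i) (c' i)).
  apply/seteqP; split => x /=; first by move=> [h h'] i; rewrite le_min h h'.
  by move=> h; split => i; have := h i; rewrite le_min => /andP[].
- split => //.
  + split => //; rewrite indicT -(L0 _ (tpoly_cst 1)); congr L.
  + move=> B C CB [mB LB] [mC LC]; split; first exact: measurableD.
    rewrite (_ : \1_(B `\` C) = fun x => \1_B x - \1_C x).
      by rewrite bcfB//; [rewrite LB LC subrr|exact: bmeas_indic|exact: bmeas_indic].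
    apply/funext => x; rewrite !indicE in_setD.
    have [xC|xC] := boolP (x \in C); last by rewrite andbT subr0.
    by rewrite (_ : x \in B) ?subrr//; apply/mem_set/CB/set_mem.
  + move=> B ndB HB; split; first by apply: bigcupT_measurable => n; have [] := HB n.
    have : L (\1_(B n)) @[n --> \oo] --> L (\1_(\bigcup_n B n)).
      apply: (bcf_cvg bL (C := 1)) => [n|n x|x].
      * by apply: measurable_indic; have [] := HB n.
      * by rewrite indicE; case: (_ \in _); rewrite ?normr1 ?normr0.
      * have [[n _ Bnx]|nB] := pselect ((\bigcup_n B n) x); last first.
          rewrite indicE memNset//.
          rewrite (_ : (fun n => _) = cst 0); first exact: cvg_cst.
          apply/funext => n; rewrite indicE memNset// => Bx; apply: nB; by exists n.
        rewrite indicE mem_set; last by exists n.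
        apply: cvg_near_cst; exists n => // m /= nm.
        rewrite indicE mem_set//; by have /subsetPset := ndB _ _ nm; exact.
    under eq_fun do rewrite (HB _).2.
    by move/cvg_lim => <- //; rewrite lim_cst.
- move=> _ [c ->]; split; first exact: measurable_lower_orthant.
  rewrite -(@bcf_half_prod L c (enum 'I_d) bL L0 _ (tpoly_cst 1)).
  apply: cL; first by apply: bmeas_indic; exact: measurable_lower_orthant.
    by apply: bmeasM; [exact: bmeas_cst|exact: bmeas_half_prod].
  by move=> x cx /=; rewrite mul1r half_prodE.
Qed.

Corollary bcf_trig_eq L1 L2 : bcf L1 -> bcf L2 -> cube_carried L1 -> cube_carried L2 ->
  (forall k t, L1 (trig k t) = L2 (trig k t)) -> forall a, bmeas a -> L1 a = L2 a.
Proof.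
move=> b1 b2 c1 c2 h a ma; have := bcf_trig_eq0 (bcf_lin 1 (-1) b1 b2).
move=> /(_ _ _ a ma) h'; apply/eqP; rewrite -subr_eq0 -[X in X - _]mul1r -mulN1r h'//.
  by move=> b b' mb mb' bb'; rewrite (c1 b b')// (c2 b b').
by move=> k t; rewrite h mul1r mulN1r subrr.
Qed.

End TrigUniqueness.

(** * Polar decomposition *)

Section RintegralExtra.
Context {dT : measure_display} {T : measurableType dT} {R : realType}.
Variable mu : {measure set T -> \bar R}.
Implicit Types (A : set T) (g : T -> R).

Lemma integrable_sumr (I : Type) (r : seq I) (F : I -> T -> R) A : measurable A ->
  (forall i, mu.-integrable A (EFin \o F i)) ->
  mu.-integrable A (EFin \o (fun x => \sum_(i <- r) F i x)).
Proof.
move=> mA iF; have := integrable_sum mA r (P := xpredT) (fun i _ => iF i).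
by apply: eq_integrable => // x _ /=; rewrite sumEFin.
Qed.

Lemma Rintegral_sum (I : Type) (r : seq I) (F : I -> T -> R) A : measurable A ->
  (forall i, mu.-integrable A (EFin \o F i)) ->
  \int[mu]_(x in A) (\sum_(i <- r) F i x) = \sum_(i <- r) \int[mu]_(x in A) F i x.
Proof.
move=> mA iF; elim: r => [|i r ih].
  rewrite big_nil -[RHS](mul0r (fine (mu A))) -Rintegral_cst//.
  by apply: eq_Rintegral => x _; rewrite big_nil.
rewrite big_cons -ih -RintegralD//; last exact: integrable_sumr.
by apply: eq_Rintegral => x _; rewrite big_cons.
Qed.

Lemma integrableZr g A c : measurable A -> mu.-integrable A (EFin \o g) ->
  mu.-integrable A (EFin \o (fun x => c * g x)).
Proof.
move=> mA ig; have := integrableZl mA c ig.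
by apply: eq_integrable => // x _ /=; rewrite EFinM.
Qed.

Lemma integrableBr f g A : measurable A -> mu.-integrable A (EFin \o f) ->
  mu.-integrable A (EFin \o g) -> mu.-integrable A (EFin \o (fun x => f x - g x)).
Proof.
move=> mA iF ig; have := integrableB mA iF ig.
by apply: eq_integrable => // x _ /=; rewrite EFinB.
Qed.

(** On the set where [g] is positive the integral of its absolute value is at most 0, so this set is
    negligible. *)
Lemma ae_le0_integral g : mu.-integrable setT (EFin \o g) ->
  (forall A, measurable A -> \int[mu]_(x in A) g x <= 0) ->
  {ae mu, forall x, g x <= 0}.
Proof.
move=> ig gA; have mg := measurable_int _ ig.
pose A := [set x | 0 < g x].
have mA : measurable A.
  rewrite (_ : A = setT `&` g @^-1` `]0, +oo[%classic).
    by apply: (measurable_EFinP _ _).1.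
  by rewrite setTI; apply/seteqP; split => x /=; rewrite in_itv/= andbT.
have iA : mu.-integrable A (EFin \o g) by apply: integrableS ig.
have mgA := measurable_int _ iA.
have : (\int[mu]_(x in A) `|(EFin \o g) x| = 0)%E.
  rewrite (eq_integral (EFin \o g)); last first.
    by move=> x /set_mem /= gx; rewrite gtr0_norm.
  apply/eqP; rewrite eq_le; apply/andP; split.
    by have := gA A mA; rewrite /Rintegral -lee_fin fineK//; exact: integrable_fin_num.
  by apply: integral_ge0 => x /= gx; rewrite lee_fin ltW.
move/(ae_eq_integral_abs _ mA mgA).1; apply: filterS => x /= h.
by rewrite leNgt; apply/negP => gx; move: (h gx) => -[] g0; rewrite g0 ltxx in gx.
Qed.

Lemma ae_Rintegral_eq f g : measurable_fun setT f -> measurable_fun setT g ->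
  {ae mu, forall x, f x = g x} -> \int[mu]_x f x = \int[mu]_x g x.
Proof.
move=> mf mg fg; congr fine; apply: ae_eq_integral => //.
- exact/measurable_EFinP.
- exact/measurable_EFinP.
- by apply: filterS fg => x /= -> _.
Qed.

End RintegralExtra.

Section EnormMeasurable.
Context {R : realType}.

Lemma measurable_enorm n : measurable_fun setT (@enorm R n).
Proof.
apply: (measurableT_comp (continuous_measurable_fun (@sqrt_continuous R))).
apply: measurable_sum => i; apply: measurable_funX; exact: measurable_coord.
Qed.

Definition dotv n (x y : 'rV[R]_n) : R := \sum_i x 0 i * y 0 i.

Lemma dotvv n (x : 'rV[R]_n) : dotv x x = enorm x ^+ 2.
Proof. by rewrite enorm_sqr; apply: eq_bigr => i _; rewrite expr2. Qed.

Lemma dotv_le n (x y : 'rV[R]_n) : dotv x y <= enorm x * enorm y.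
Proof. exact: enorm_dot. Qed.

Lemma coord_le_enorm n (x : 'rV[R]_n) i : `|x 0 i| <= enorm x.
Proof.
rewrite -sqrtr_sqr ler_wsqrtr// (bigD1 i)//= lerDl.
by apply: sumr_ge0 => j _; exact: sqr_ge0.
Qed.

(** Countably many directions suffice, so an almost everywhere statement can be proved for each of
    them separately. Testing with a rational vector within [eta] of [x] in each coordinate gives
    |x|^2 <= |x| + 2 eta S. *)
Lemma enorm_le1_rat n (x : 'rV[R]_n) :
  (forall e : 'rV[rat]_n, dotv (map_mx ratr e) x <= enorm (map_mx ratr e : 'rV[R]_n)) ->
  enorm x <= 1.
Proof.
move=> h; have [x0|x0] := leP (enorm x) 0; first exact: le_trans ler01.
apply/ler_addgt0Pl => eps eps0.
pose S := \sum_i (`|x 0 i| + 1).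
have S0 : 0 <= S by apply: sumr_ge0 => i _; rewrite addr_ge0.
(* Chosen so that 2 eta S <= eps |x|; division by |x| then leaves |x| <= 1 + eps. *)
pose eta := eps * enorm x / (2 * S + 1).
have eta0 : 0 < eta by rewrite divr_gt0// ?mulr_gt0// ltr_pwDr// mulr_ge0.
have [e he] : exists e : 'rV[rat]_n, forall i, x 0 i - eta < ratr (e 0 i) < x 0 i + eta.
  have /boolp.choice[q hq] : forall i, exists q : rat, x 0 i - eta < ratr q < x 0 i + eta.
    move=> i; have [|q] := @rat_in_itvoo R (x 0 i - eta) (x 0 i + eta); first by lra.
    by rewrite in_itv/= => ?; exists q.
  by exists (\row_i q i) => i; rewrite mxE.
set y : 'rV[R]_n := map_mx ratr e.
have yx : enorm (y - x) <= eta * n%:R.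
  apply: le_trans (enorm_le_sum _) _.
  rewrite -[n in n%:R]card_ord -sum1_card natr_sum mulr_sumr; apply: ler_sum => i _.
  rewrite mulr1 !mxE; have /andP[h1 h2] := he i.
  by rewrite ler_norml; apply/andP; split; lra.
have nS : n%:R <= S.
  rewrite -[n in n%:R]card_ord -sum1_card natr_sum; apply: ler_sum => i _.
  by rewrite lerDr.
have dS : `|dotv (y - x) x| <= eta * S.
  rewrite (le_trans (ler_norm_sum _ _ _))// mulr_sumr; apply: ler_sum => i _.
  rewrite !mxE normrM ler_pM//; last by rewrite lerDl.
  have /andP[h1 h2] := he i.
  by rewrite ler_norml; apply/andP; split; lra.
have hy := h e; rewrite -/y in hy.
have y_le : enorm y <= enorm x + eta * S.
  rewrite -(subrK x y) addrC (le_trans (enormD _ _))// lerD2l (le_trans yx)//.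
  by rewrite ler_wpM2l// ltW.
have dE : dotv y x = dotv x x + dotv (y - x) x.
  by rewrite -big_split; apply: eq_bigr => i _; rewrite !mxE/=; ring.
have : enorm x ^+ 2 <= enorm x + 2 * (eta * S).
  move: dS; rewrite ler_norml => /andP[d1 d2].
  rewrite -dotvv; lra.
have e2 : 2 * (eta * S) <= eps * enorm x.
  rewrite (_ : 2 * (eta * S) = eps * enorm x * (2 * S / (2 * S + 1))).
    have q1 : 2 * S / (2 * S + 1) <= 1.
      by rewrite ler_pdivrMr ?mul1r ?lerDl// ltr_wpDl// mulr_ge0.
    by apply: ler_piMr => //; rewrite mulr_ge0// ltW.
  by rewrite /eta; field; rewrite gt_eqF// ltr_wpDl// mulr_ge0.
move=> h2; have : enorm x * enorm x <= enorm x * (eps + 1).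
  by rewrite -expr2; lra.
by rewrite ler_pM2l.
Qed.

End EnormMeasurable.

Section Polar.
Context {dT : measure_display} {T : measurableType dT} {R : realType} {n : nat}.
Implicit Types (mu : @vmeasure _ T R n) (A B : set T).

Lemma polar_integrable mu i : (tvar mu).-integrable setT (EFin \o (fun x => polar mu x 0 i)).
Proof.
have h := Radon_Nikodym_integrable (@dominates_tvar _ T R n mu i).
apply: eq_integrable h => // x _ /=.
by rewrite mxE fineK//; apply: Radon_Nikodym_fin_num; exact: dominates_tvar.
Qed.

Lemma measurable_polar mu i : measurable_fun setT (fun x => polar mu x 0 i).
Proof. by have := measurable_int _ (polar_integrable mu i); exact: (measurable_EFinP _ _).1. Qed.

Lemma vval_polar mu A i : measurable A ->
  vval mu A 0 i = \int[tvar mu]_(x in A) polar mu x 0 i.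
Proof.
move=> mA; rewrite mxE (Radon_Nikodym_integral (@dominates_tvar _ T R n mu i) mA).
congr fine; apply: eq_integral => x _.
by rewrite mxE fineK//; apply: Radon_Nikodym_fin_num; exact: dominates_tvar.
Qed.

Lemma ae_countable (mu : {measure set T -> \bar R}) (I : countType) (P : I -> T -> Prop) :
  (forall i, {ae mu, forall x, P i x}) -> {ae mu, forall x, forall i, P i x}.
Proof.
move=> h; have : forall k : nat, \forall x \ae mu, if @choice.unpickle I k is Some i then P i x else True.
  move=> k; case: choice.unpickle => [i|]; first exact: h.
  by apply: aeW.
move/ae_foralln; apply: filterS => x hx i.
by have := hx (choice.pickle i); rewrite choice.pickleK.
Qed.

Lemma measurable_enorm_polar mu : measurable_fun setT (fun x => enorm (polar mu x)).
Proof.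
have mp : measurable_fun setT (polar mu) by apply: measurable_row; exact: measurable_polar.
exact: (measurableT_comp (@measurable_enorm R n) mp).
Qed.

Lemma enorm_polar_integrable mu : (tvar mu).-integrable setT (EFin \o (fun x => enorm (polar mu x))).
Proof.
have iS : (tvar mu).-integrable setT (EFin \o (fun x => \sum_i `|polar mu x 0 i|)).
  apply: integrable_sumr => // i; have := integrable_norm (polar_integrable mu i).
  by [].
apply: le_integrable iS => //.
  by apply/measurable_EFinP; exact: measurable_enorm_polar.
move=> x _ /=; rewrite lee_fin ger0_norm ?enorm_ge0// ger0_norm ?enorm_le_sum//.
exact: sumr_ge0.
Qed.

Lemma dotv_polar mu (e : 'rV[R]_n) A : measurable A ->
  \int[tvar mu]_(x in A) dotv e (polar mu x) = dotv e (vval mu A).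
Proof.
move=> mA.
have iA i : (tvar mu).-integrable A (EFin \o (fun x => polar mu x 0 i)).
  by apply: integrableS (polar_integrable mu i).
rewrite Rintegral_sum//; last by move=> i; exact: integrableZr.
by apply: eq_bigr => i _; rewrite RintegralZl// vval_polar.
Qed.

Lemma dotv_polar_integrable mu e A : measurable A ->
  (tvar mu).-integrable A (EFin \o (fun x => dotv e (polar mu x))).
Proof.
move=> mA; apply: integrable_sumr => // i; apply: integrableZr => //.
by apply: integrableS (polar_integrable mu i).
Qed.

Lemma tvar_fin_num mu A : measurable A -> tvar mu A \is a fin_num.
Proof. by move=> mA; exact: fin_num_measure. Qed.

Lemma cst_integrable (mu : {finite_measure set T -> \bar R}) (c : R) A : measurable A ->
  mu.-integrable A (EFin \o cst c).
Proof. by move=> mA; exact: finite_measure_integrable_cst. Qed.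

(** For fixed e, the integral of e . polar over A is e . mu(A), which is at most |e| |mu|(A); hence
    e . polar <= |e| almost everywhere, for all rational e simultaneously. *)
Lemma ae_enorm_polar_le1 mu : {ae tvar mu, forall x, enorm (polar mu x) <= 1}.
Proof.
suff : {ae tvar mu, forall x, forall e : 'rV[rat]_n,
    dotv (map_mx ratr e) (polar mu x) - enorm (map_mx ratr e : 'rV[R]_n) <= 0}.
  apply: filterS => x h; apply: enorm_le1_rat => e.
  by rewrite -subr_le0; exact: h.
apply: ae_countable => e; set y : 'rV[R]_n := map_mx ratr e.
apply: ae_le0_integral.
  apply: integrableBr => //; first exact: dotv_polar_integrable.
  exact: cst_integrable.
move=> A mA; rewrite RintegralB//; first last.
- exact: cst_integrable.
- exact: dotv_polar_integrable.
rewrite dotv_polar// Rintegral_cst// subr_le0 (le_trans (dotv_le _ _))//.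
rewrite ler_wpM2l ?enorm_ge0// -lee_fin fineK ?tvar_fin_num//.
exact: enorm_le_tvar.
Qed.

(** The density is tested in the direction of the vector mu(A) itself, after which its length is
    divided out. *)
Lemma enorm_vval_le mu A : measurable A ->
  enorm (vval mu A) <= \int[tvar mu]_(x in A) enorm (polar mu x).
Proof.
move=> mA; set u := vval mu A.
have iA : (tvar mu).-integrable A (EFin \o (fun x => enorm (polar mu x))).
  by apply: integrableS (enorm_polar_integrable mu).
have [u0|u0] := leP (enorm u) 0.
  by apply: (le_trans u0); apply: Rintegral_ge0 => x _; exact: enorm_ge0.
rewrite -(ler_pM2l u0) -expr2 -dotvv -{2}/u -dotv_polar// -RintegralZl//.
apply: le_Rintegral => //; first exact: dotv_polar_integrable.
  exact: integrableZr.
by move=> x _; exact: dotv_le.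
Qed.

(** Summing [enorm_vval_le] over a disjoint family bounds each competitor in the supremum that
    defines the total variation. Together with [ae_enorm_polar_le1] this makes the density a unit
    vector almost everywhere. *)
Lemma tvar_le_polar mu A : measurable A ->
  fine (tvar mu A) <= \int[tvar mu]_(x in A) enorm (polar mu x).
Proof.
move=> mA.
have iA B : measurable B -> (tvar mu).-integrable B (EFin \o (fun x => enorm (polar mu x))).
  by move=> mB; apply: integrableS (enorm_polar_integrable mu).
have mE B : measurable B -> measurable_fun B (EFin \o (fun x => enorm (polar mu x))).
  by move=> mB; exact: measurable_int (iA B mB).
rewrite -lee_fin fineK ?tvar_fin_num//.
apply: ge_ereal_sup => _ [m [P [mP tP PA ->]]].
rewrite /Rintegral fineK; last by apply: integrable_fin_num => //; exact: iA.
apply: (@le_trans _ _ (\sum_(k < m) \int[tvar mu]_(x in P k) (enorm (polar mu x))%:E)%E).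
  rewrite -sumEFin; apply: lee_sum => k _.
  have := enorm_vval_le mu (mP k); rewrite -lee_fin /Rintegral fineK//.
  by apply: integrable_fin_num => //; exact: iA.
have mU : measurable (\big[setU/set0]_(k <- index_enum 'I_m) P k).
  by apply: bigsetU_measurable => k _; exact: mP.
rewrite -ge0_integral_bigsetU ?index_enum_uniq//; first last.
- by move=> x _; rewrite lee_fin enorm_ge0.
- exact: mE.
- exact: sub_trivIset tP.
apply: ge0_subset_integral => //.
- exact: mE.
- by move=> x _; rewrite lee_fin enorm_ge0.
- by elim/big_ind : _ => // X Y XA YA; rewrite subUset.
Qed.

Lemma ae_enorm_polar mu : {ae tvar mu, forall x, enorm (polar mu x) = 1}.
Proof.
have ge1 : {ae tvar mu, forall x, 1 - enorm (polar mu x) <= 0}.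
  apply: ae_le0_integral.
    apply: integrableBr => //; [exact: cst_integrable|exact: enorm_polar_integrable].
  move=> A mA; rewrite RintegralB//; first last.
  - by apply: integrableS (enorm_polar_integrable mu).
  - exact: cst_integrable.
  by rewrite Rintegral_cst// mul1r subr_le0; exact: tvar_le_polar.
move: (ae_enorm_polar_le1 mu) ge1; apply: filterS2 => x h1.
by rewrite subr_le0 => h2; apply/le_anti; rewrite h1.
Qed.

(* [polar] is a unit vector only almost everywhere; the bound on [dir] holds
   everywhere, which keeps [dir] in the class [bmeas]. *)
Definition dir mu x : 'rV[R]_n := if enorm (polar mu x) == 1 then polar mu x else 0.

Lemma ae_dir mu : {ae tvar mu, forall x, dir mu x = polar mu x}.
Proof. by move: (ae_enorm_polar mu); apply: filterS => x; rewrite /dir => ->; rewrite eqxx. Qed.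

Lemma enorm_dir_le1 mu x : enorm (dir mu x) <= 1.
Proof. by rewrite /dir; case: eqP => [->//|_]; rewrite enorm0. Qed.

Lemma ae_enorm_dir mu : {ae tvar mu, forall x, enorm (dir mu x) = 1}.
Proof.
move: (ae_dir mu) (ae_enorm_polar mu); apply: filterS2 => x -> //.
Qed.

Lemma measurable_dir mu : measurable_fun setT (dir mu).
Proof.
have mp : measurable_fun setT (polar mu) by apply: measurable_row; exact: measurable_polar.
apply: measurable_fun_if => //.
- apply: (@measurable_fun_eqr _ _ _ setT (fun x => enorm (polar mu x)) (cst 1)) => //.
  exact: measurable_enorm_polar.
- exact: measurable_funTS.
Qed.

Lemma measurable_dir_coord mu i : measurable_fun setT (fun x => dir mu x 0 i).
Proof. exact/measurable_rowP/measurable_dir. Qed.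

Lemma dir_coord_le1 mu i x : `|dir mu x 0 i| <= 1.
Proof. exact: le_trans (coord_le_enorm _ _) (enorm_dir_le1 _ _). Qed.

Lemma bmeas_dir_coord mu i : bmeas (fun x => dir mu x 0 i).
Proof. by split; [exact: measurable_dir_coord|exists 1 => x; exact: dir_coord_le1]. Qed.

End Polar.

Lemma bmeas_integrable (dT : measure_display) (T : measurableType dT) (R : realType)
  (mu : {finite_measure set T -> \bar R}) (a : T -> R) : bmeas a ->
  mu.-integrable setT (EFin \o a).
Proof.
move=> [ma [C aC]]; apply: measurable_bounded_integrable => //.
  by rewrite -ge0_fin_numE ?fin_num_measure.
exists C; split; first exact: num_real.
by move=> y Cy x _; apply/ltW/(le_lt_trans _ Cy)/aC.
Qed.

Section ChargeIntegral.
Context {dT : measure_display} {T : measurableType dT} {R : realType} {n : nat}.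
Implicit Types (mu nu : @vmeasure _ T R n) (a : T -> R).

(** The integral against the signed measure [mu i]. Using [dir] in place of [polar] makes the
    density bounded everywhere. *)
Definition cint mu (i : 'I_n) a : R := pint (tvar mu) id (fun x => dir mu x 0 i) a.

Lemma bcf_cint mu i : bcf (cint mu i).
Proof.
apply: bcf_pint; first exact: measurable_id.
by apply: bmeas_integrable; exact: bmeas_dir_coord.
Qed.

Lemma cint_indic mu i A : measurable A -> cint mu i (\1_A) = fine (mu i A).
Proof.
move=> mA; have := vval_polar mu i mA; rewrite mxE => ->.
rewrite [RHS]Rintegral_mkcond; apply: ae_Rintegral_eq.
- apply: measurable_funM; first exact: measurable_indic.
  exact: measurable_dir_coord.
- apply: (measurable_restrictT _ mA).1.
  by apply: measurable_funTS; exact: measurable_polar.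
move: (ae_dir mu); apply: filterS => x ->.
rewrite patchE indicE; case: ifP => _; by rewrite ?mul1r ?mul0r.
Qed.

Lemma cint_polar mu i a : measurable_fun setT a ->
  cint mu i a = \int[tvar mu]_x (a x * polar mu x 0 i).
Proof.
move=> ma; apply: ae_Rintegral_eq.
- by apply: measurable_funM => //; exact: measurable_dir_coord.
- by apply: measurable_funM => //; exact: measurable_polar.
by move: (ae_dir mu); apply: filterS => x ->.
Qed.

(** A vector measure built from others (shift, mean, limit) has an unrelated total variation and
    direction; its integrals are obtained from its values on sets instead. *)
Lemma bcf_cint_eq (L : (T -> R) -> R) mu i : bcf L ->
  (forall A, measurable A -> L (\1_A) = fine (mu i A)) ->
  forall a, bmeas a -> L a = cint mu i a.
Proof.
move=> bL h; apply: bcf_indic_eq => //; first exact: bcf_cint.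
by move=> A mA; rewrite h// cint_indic.
Qed.

End ChargeIntegral.

(** * Calibrations of the integrand *)

Section RowTopology.
Context {R : realType} {n : nat}.
Implicit Types x y : 'rV[R]_n.

Lemma coord_le_norm x i : `|x 0 i| <= `|x|.
Proof.
rewrite [leRHS]/Num.norm/= mx_normrE.
by rewrite (le_bigmax _ (fun i : 'I_1 * 'I_n => `|x i.1 i.2|) (0, i)).
Qed.

Lemma norm_le_coord x (c : R) : 0 <= c -> (forall i, `|x 0 i| <= c) -> `|x| <= c.
Proof.
move=> c0 h; rewrite [leLHS]/Num.norm/= mx_normrE.
by apply: bigmax_le => // -[i j] _ /=; rewrite ord1.
Qed.

Lemma enorm_le_norm x : enorm x <= n%:R * `|x|.
Proof.
rewrite (le_trans (enorm_le_sum _))// -[n in n%:R]card_ord -sum1_card natr_sum mulr_suml.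
by apply: ler_sum => i _; rewrite mul1r coord_le_norm.
Qed.

Lemma cvg_row (I : Type) (F : set_system I) (FF : Filter F) (f : I -> 'rV[R]_n) x :
  (forall i, f t 0 i @[t --> F] --> x 0 i) -> f t @[t --> F] --> x.
Proof.
move=> h; apply/cvgrPdist_le => e e0.
have : forall i, \forall t \near F, `|x 0 i - f t 0 i| <= e.
  by move=> i; have /cvgrPdist_le := h i; apply.
move/filter_forall; apply: filterS => t ht; apply: norm_le_coord; first exact: ltW.
by move=> i; rewrite !mxE; exact: ht.
Qed.

Lemma continuous_enorm : continuous (@enorm R n : 'rV[R]_n -> R).
Proof.
move=> x; apply: (@continuous_comp _ _ _ (fun y : 'rV[R]_n => \sum_i y 0 i ^+ 2) (@Num.sqrt R)).
  apply: continuous_sumr => i y.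
  by apply: (@continuous_comp _ _ _ (fun y : 'rV[R]_n => y 0 i) (fun t : R => t ^+ 2));
    [exact: coord_continuous|exact: exprn_continuous].
exact: sqrt_continuous.
Qed.

Definition grid (m : nat) x : 'rV[R]_n :=
  \row_i ((Num.floor (m.+1%:R * x 0 i))%:~R / m.+1%:R).

Lemma cvg_grid x : grid m x @[m --> \oo] --> x.
Proof.
apply: cvg_row => i; apply/cvgrPdist_le => e e0.
have /cvgrPdist_le/(_ e e0) := @cvg_harmonic R.
apply: filterS => m; rewrite /harmonic/= sub0r normrN ger0_norm// => hm.
have mp : 0 < m.+1%:R :> R by rewrite ltr0n.
rewrite (le_trans _ hm)// !mxE.
have /andP[h1 h2] := floor_itv (m.+1%:R * x 0 i).
rewrite (_ : x 0 i - _ = (m.+1%:R * x 0 i - (Num.floor (m.+1%:R * x 0 i))%:~R) / m.+1%:R); last first.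
  by field; rewrite addrC natr1 pnatr_eq0.
rewrite normrM [X in _ * X]ger0_norm ?invr_ge0// ler_piMl ?invr_ge0//.
rewrite ger0_norm ?subr_ge0// lerBlDl; move: h2; rewrite intrD => /ltW; by rewrite addrC.
Qed.

End RowTopology.

Section CountableComp.
Context {dO : measure_display} {O : measurableType dO} {R : realType}.

Lemma measurable_countable_comp (I : countType) (k : O -> I) (h : I -> R) :
  (forall i, measurable (k @^-1` [set i])) -> measurable_fun setT (h \o k).
Proof.
move=> mk _ B mB; rewrite setTI.
rewrite (_ : _ @^-1` _ = \bigcup_i (if h i \in B then k @^-1` [set i] else set0)).
  by apply: countable_bigcupT_measurable => // i; case: ifPn.
apply/seteqP; split => w /=.
  by move=> hB; exists (k w) => //; rewrite mem_set.
by move=> [i _]; case: ifPn => // /set_mem hB /= kw; rewrite kw.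
Qed.

Context {n m : nat}.

(* Continuous functions are limits of functions with countably many values. *)
Lemma measurable_comp_continuous2 (F : 'rV[R]_n -> 'rV[R]_m -> R)
    (X : O -> 'rV[R]_n) (Q : O -> 'rV[R]_m) :
  continuous (fun z : 'rV[R]_n * 'rV[R]_m => F z.1 z.2) ->
  measurable_fun setT X -> measurable_fun setT Q ->
  measurable_fun setT (fun w => F (X w) (Q w)).
Proof.
move=> cF mX mQ.
apply: (measurable_fun_cvg (h := fun k w => F (grid k (X w)) (grid k (Q w)))); last first.
  move=> w _.
  have h := continuous2_cvg _ (cF (X w, Q w)) (@cvg_grid R n (X w)) (@cvg_grid R m (Q w)).
  exact: h.
move=> k.
pose fl l (x : 'rV[R]_l) : 'rV[int]_l := \row_i Num.floor (k.+1%:R * x 0 i).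
pose ufl l (c : 'rV[int]_l) : 'rV[R]_l := \row_i ((c 0 i)%:~R / k.+1%:R).
have gE l (x : 'rV[R]_l) : grid k x = ufl l (fl l x).
  by apply/rowP => i; rewrite !mxE.
have mfl l (Y : O -> 'rV[R]_l) c : measurable_fun setT Y -> measurable [set w | fl l (Y w) = c].
  move=> mY; rewrite (_ : [set _ | _] = \bigcap_(i in [set: 'I_l])
      ((fun w => (Num.floor (k.+1%:R * Y w 0 i))%:~R : R) @^-1` [set (c 0 i)%:~R])).
    apply: fin_bigcap_measurable => // i _; rewrite -[X in measurable X]setTI.
    have mf : measurable_fun setT (fun w => (Num.floor (k.+1%:R * Y w 0 i))%:~R : R).
      apply: (measurableT_comp measurable_floor).
      by apply: measurable_funM => //; exact: measurable_rowP.
    by apply: mf => //; exact: measurable_set1.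
  apply/seteqP; split => w /=; first by move=> <- i _ /=; rewrite mxE.
  by move=> h; apply/rowP => i; rewrite mxE; have /= /intr_inj := h i I.
pose h (c : 'rV[int]_n * 'rV[int]_m) := F (ufl n c.1) (ufl m c.2).
rewrite (_ : (fun w => _) = h \o (fun w => (fl n (X w), fl m (Q w)))); last first.
  by apply/funext => w /=; rewrite !gE.
apply: measurable_countable_comp => -[c c'].
rewrite (_ : _ @^-1` _ = [set w | fl n (X w) = c] `&` [set w | fl m (Q w) = c']).
  by apply: measurableI; exact: mfl.
by apply/seteqP; split => w /= [-> ->].
Qed.

Lemma measurable_comp_continuous (f : 'rV[R]_n -> R) (X : O -> 'rV[R]_n) :
  continuous f -> measurable_fun setT X -> measurable_fun setT (f \o X).
Proof.
move=> cf mX.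
apply: (measurable_fun_cvg (h := fun k w => f (grid k (X w)))); last first.
  move=> w _; have h := continuous_cvg _ (cf (X w)) (@cvg_grid R n (X w)).
  exact: h.
move=> k.
pose fl (x : 'rV[R]_n) : 'rV[int]_n := \row_i Num.floor (k.+1%:R * x 0 i).
pose ufl (c : 'rV[int]_n) : 'rV[R]_n := \row_i ((c 0 i)%:~R / k.+1%:R).
rewrite (_ : (fun w => _) = (f \o ufl) \o (fun w => fl (X w))); last first.
  by apply/funext => w /=; congr f; apply/rowP => i; rewrite !mxE.
apply: measurable_countable_comp => c.
rewrite (_ : _ @^-1` _ = \bigcap_(i in [set: 'I_n])
      ((fun w => (Num.floor (k.+1%:R * X w 0 i))%:~R : R) @^-1` [set (c 0 i)%:~R])).
  apply: fin_bigcap_measurable => // i _; rewrite -[X in measurable X]setTI.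
  have mf : measurable_fun setT (fun w => (Num.floor (k.+1%:R * X w 0 i))%:~R : R).
    apply: (measurableT_comp measurable_floor).
    by apply: measurable_funM => //; exact: measurable_rowP.
  by apply: mf => //; exact: measurable_set1.
apply/seteqP; split => w /=; first by move=> <- i _ /=; rewrite mxE.
by move=> h; apply/rowP => i; rewrite mxE; have /= /intr_inj := h i I.
Qed.

End CountableComp.

Lemma cvg_right_mul (R : realType) (c : R) : c != 0 -> (t * c) @[t --> 0^'+] --> 0^'.
Proof.
move=> c0 A [e /= e0 eA].
have c1 : 0 < `|c| by rewrite normr_gt0.
suff : \forall t \near 0^'+, A (t * c) by [].
near=> t.
have t0 : 0 < t by near: t; exact: nbhs_right_gt.
apply: eA; last by rewrite mulf_neq0// gt_eqF.
rewrite /ball_/= sub0r normrN normrM gtr0_norm// -ltr_pdivlMr//.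
by near: t; apply: nbhs_right_lt; rewrite divr_gt0.
Unshelve. all: by end_near.
Qed.

Section Admissible.
Context {R : realType} {d : nat}.
Variable F : 'rV[R]_d -> 'rV[R]_d -> R.
Hypothesis hF : admissible F.
Implicit Types x p q s : 'rV[R]_d.

Lemma adm_periodic q : periodic (F ^~ q).
Proof. by have [h _ _ _] := hF; exact: h. Qed.

Lemma adm_hom x p t : 0 < t -> F x (t *: p) = t * F x p.
Proof. by have [_ _ h _] := hF; exact: h. Qed.

Lemma adm_bound : exists c0 : R, 0 < c0 /\ forall x p, c0 * enorm p <= F x p <= c0^-1 * enorm p.
Proof. by have [_ _ _ [h _ _]] := hF. Qed.

Lemma adm_ge0 x p : 0 <= F x p.
Proof.
have [c [c0 h]] := adm_bound; have /andP[h1 _] := h x p.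
by rewrite (le_trans _ h1)// mulr_ge0 ?enorm_ge0// ltW.
Qed.

Lemma adm0 x : F x 0 = 0.
Proof.
have [c [c0 /(_ x 0)]] := adm_bound.
by rewrite enorm0 !mulr0 => /andP[h1 h2]; apply/le_anti; rewrite h2.
Qed.

Lemma adm_homge0 x p t : 0 <= t -> F x (t *: p) = t * F x p.
Proof.
rewrite le_eqVlt => /predU1P[<-|]; last exact: adm_hom.
by rewrite scale0r adm0 mul0r.
Qed.

Lemma adm_convex x p q (t : R) : 0 <= t -> t <= 1 ->
  F x (t *: p + (1 - t) *: q) <= t * F x p + (1 - t) * F x q.
Proof.
move=> t0 t1; have [_ h _ _] := hF.
have := h x (Itv01 t0 t1) p q; rewrite !inE => /(_ I I).
by rewrite convRE.
Qed.

Lemma adm_subadd x p q : F x (p + q) <= F x p + F x q.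
Proof.
have h0 : (0 : R) <= 2^-1 by rewrite invr_ge0.
have h1 : (2^-1 : R) <= 1 by rewrite invf_le1// ler1n.
have := adm_convex x p q h0 h1.
rewrite (_ : 1 - 2^-1 = 2^-1 :> R); last by field.
rewrite -scalerDr -mulrDr adm_hom ?invr_gt0//.
by rewrite ler_pM2l ?invr_gt0.
Qed.

Lemma adm_sum (I : Type) (r : seq I) x (p : I -> 'rV[R]_d) :
  F x (\sum_(i <- r) p i) <= \sum_(i <- r) F x (p i).
Proof.
elim: r => [|i r ih]; first by rewrite !big_nil adm0.
by rewrite !big_cons (le_trans (adm_subadd _ _ _))// lerD2l.
Qed.

(** The regularity assumption covers p != 0 only; at p = 0 continuity comes from the bound by a
    multiple of |p|. *)
Lemma adm_continuous : continuous (fun z : 'rV[R]_d * 'rV[R]_d => F z.1 z.2).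
Proof.
move=> [x p]; have [p0|p0] := eqVneq p 0.
  rewrite p0; suff : F z.1 z.2 @[z --> (x, 0 : 'rV[R]_d)] --> F x 0 by [].
  rewrite adm0; have [c [c0 h]] := adm_bound.
  apply: (@squeeze_cvgr _ _ _ _ (cst 0) (fun z : 'rV[R]_d * 'rV[R]_d => c^-1 * enorm z.2)).
  - apply: nearW => z; rewrite adm_ge0/=.
    by have /andP[] := h z.1 z.2.
  - exact: cvg_cst.
  - rewrite -[X in _ --> X](mulr0 c^-1); apply: cvgM; first exact: cvg_cst.
    rewrite -[X in _ --> X](@enorm0 R d).
    apply: (@cvg_comp _ _ _ snd (@enorm R d) _ (nbhs (0 : 'rV[R]_d))); last exact: continuous_enorm.
    exact: cvg_snd.
have [_ _ _ [_ [al [_ [cF _ _]]] _]] := hF.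
by have := cF [::] (x, p) isT p0.
Qed.

Definition dquot x s i (h : R) : R := h^-1 * (F x (s + h *: ebase i) - F x s).

Definition pder x s i : R := 'D_(ebase2 (inr i)) ((fun z => F z.1 z.2) : _ -> R^o) (x, s).

Lemma cvg_dquot x s i : s != 0 -> dquot x s i h @[h --> 0^'] --> pder x s i.
Proof.
move=> s0; have [_ _ _ [_ [al [_ [_ dF _]]] _]] := hF.
have := dF [::] (inr i) (x, s) isT s0.
rewrite /derivable /pder /derive /= => h; rewrite /dquot.
apply: cvg_trans h; apply: near_eq_cvg; apply: nearW => t /=.
by rewrite scaler0 add0r [_ + s]addrC.
Qed.

(* One-sided difference quotients of a convex function along any direction
   decrease to a limit that is dominated by the increment; splitting the
   direction along the axes only costs a convex combination. *)
Lemma adm_support x s q : s != 0 ->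
  F x s + \sum_i pder x s i * (q - s) 0 i <= F x q.
Proof.
move=> s0; set h := q - s.
have d0 : (0 < d)%N.
  by move: s0; case: (d) s {h} => [s|//]; rewrite (_ : s = 0) ?eqxx//; apply/rowP => -[].
have dR : 0 < d%:R :> R by rewrite ltr0n.
(* The mean over the axes of backward difference quotients, with increments stretched by [d]: its
   limit is the directional derivative along [h], although only partial derivatives are known to
   exist. *)
pose G t := \sum_i (d%:R * t)^-1 * (F x s - F x (s - (t * d%:R * h 0 i) *: ebase i)).
have Gle t : 0 < t -> G t <= F x q - F x s.
  move=> t0.
  have t1 : 0 < 1 + t by lra.
  (* The point [s] is the convex combination of [q] and [s - t h] with weights t / (1 + t) and 1 /
     (1 + t). *)
  have c1 : (1 + t) * F x s <= t * F x q + F x (s - t *: h).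
    have h0 : 0 <= t / (1 + t) by rewrite divr_ge0 ?ltW.
    have h1 : t / (1 + t) <= 1 by rewrite ler_pdivrMr// mul1r lerDr.
    have := adm_convex x q (s - t *: h) h0 h1.
    rewrite (_ : 1 - _ = (1 + t)^-1); last by field; rewrite gt_eqF.
    rewrite (_ : (t / (1 + t)) *: q + _ = s); last first.
      apply/rowP => i; rewrite /h !mxE; field; rewrite gt_eqF//.
    move=> c1; rewrite -(ler_pM2l t1) in c1; apply: (le_trans c1).
    by rewrite le_eqVlt; apply/orP; left; apply/eqP; field; rewrite gt_eqF.
  (* The point [s - t h] is the mean of [d] points, each displaced along one axis by [d] times the
     corresponding coordinate of [t h]. *)
  have c2 : F x (s - t *: h) <= \sum_i d%:R^-1 * F x (s - (t * d%:R * h 0 i) *: ebase i).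
    rewrite (_ : s - t *: h = \sum_i d%:R^-1 *: (s - (t * d%:R * h 0 i) *: ebase i)).
      apply: le_trans (adm_sum _ _ _) _; apply: ler_sum => i _.
      by rewrite adm_homge0// invr_ge0 ltW.
    apply/rowP => j; rewrite !mxE summxE.
    rewrite (eq_bigr (fun i => d%:R^-1 * s 0 j - (t * h 0 i) * (j == i)%:R)); last first.
      by move=> i _; rewrite !mxE eqxx/=; field; rewrite gt_eqF.
    rewrite sumrB sumr_const card_ord (bigD1 j)//= eqxx mulr1 big1 => [|i ij]; last first.
      by rewrite eq_sym (negbTE ij) mulr0.
    by rewrite addr0 -[X in _ = X - _]mulr_natl mulrA divff ?gt_eqF// mul1r !mxE.
  have GE : t * G t = F x s - \sum_i d%:R^-1 * F x (s - (t * d%:R * h 0 i) *: ebase i).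
    rewrite /G mulr_sumr.
    rewrite (eq_bigr (fun i => d%:R^-1 * F x s - d%:R^-1 * F x (s - (t * d%:R * h 0 i) *: ebase i))); last first.
      by move=> i _; field; rewrite !gt_eqF.
    by rewrite sumrB sumr_const card_ord -[X in X - _ = _]mulr_natl mulrA divff ?gt_eqF// mul1r.
  rewrite -(ler_pM2l t0) GE; lra.
have Gcvg : G t @[t --> 0^'+] --> \sum_i pder x s i * h 0 i.
  apply: cvg_big => [|i _]; first exact: add_continuous.
  have [hi|hi] := eqVneq (h 0 i) 0.
    rewrite hi mulr0 (_ : (fun _ => _) = cst 0); first exact: cvg_cst.
    by apply/funext => t; rewrite mulr0 scale0r subr0 subrr mulr0.
  rewrite (_ : (fun _ => _) = fun t => dquot x s i (- (t * d%:R * h 0 i)) * h 0 i); last first.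
    apply/funext => t; rewrite /dquot scaleNr.
    have [->|t0] := eqVneq t 0; first by rewrite !mul0r scale0r subr0 oppr0 subrr !mulr0 mul0r.
    by field; rewrite hi t0 gt_eqF.
  apply: cvgM; last exact: cvg_cst.
  apply: (@cvg_comp _ _ _ (fun t => - (t * d%:R * h 0 i)) (dquot x s i) _ 0^');
    last exact: (@cvg_dquot x s i s0).
  rewrite (_ : (fun t => _) = fun t => t * (- (d%:R * h 0 i))); last first.
    by apply/funext => t; ring.
  by apply: cvg_right_mul; rewrite oppr_eq0 mulf_neq0// gt_eqF.
rewrite -lerBrDl; apply: (cvgr_to_le Gcvg).
near=> t; apply: Gle; near: t; exact: nbhs_right_gt.
Unshelve. all: by end_near.
Qed.

(** The support inequality at 2 s and at s / 2 gives the two halves of Euler's identity for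
    one-homogeneous functions; with it the affine support function becomes linear. *)
Lemma adm_pder_le x s q : s != 0 -> \sum_i pder x s i * q 0 i <= F x q.
Proof.
move=> s0.
have h1 := adm_support x (2 *: s) s0; have h2 := adm_support x (2^-1 *: s) s0.
have h3 := adm_support x q s0.
rewrite adm_hom// in h1; rewrite adm_hom ?invr_gt0// in h2.
have e1 : \sum_i pder x s i * (2 *: s - s) 0 i = \sum_i pder x s i * s 0 i.
  by apply: eq_bigr => i _; rewrite !mxE; ring.
have e2 : \sum_i pder x s i * (2^-1 *: s - s) 0 i = - 2^-1 * \sum_i pder x s i * s 0 i.
  by rewrite mulr_sumr; apply: eq_bigr => i _; rewrite !mxE; field.
have e3 : \sum_i pder x s i * (q - s) 0 i = \sum_i pder x s i * q 0 i - \sum_i pder x s i * s 0 i.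
  by rewrite -sumrB; apply: eq_bigr => i _; rewrite !mxE; ring.
rewrite e1 in h1; rewrite e2 in h2; rewrite e3 in h3; lra.
Qed.

Lemma adm_pder_eq x s : s != 0 -> \sum_i pder x s i * s 0 i = F x s.
Proof.
move=> s0; apply/le_anti; rewrite adm_pder_le//=.
have h1 := adm_support x 0 s0; rewrite adm0 in h1.
have e1 : \sum_i pder x s i * (0 - s) 0 i = - \sum_i pder x s i * s 0 i.
  by rewrite -sumrN; apply: eq_bigr => i _; rewrite !mxE; ring.
rewrite e1 in h1; lra.
Qed.

Lemma measurable_dquot (dO : measure_display) (O : measurableType dO)
    (X Q : O -> 'rV[R]_d) i (h : R) : measurable_fun setT X -> measurable_fun setT Q ->
  measurable_fun setT (fun w => dquot (X w) (Q w) i h).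
Proof.
move=> mX mQ; apply: measurable_funM => //; apply: measurable_funB.
  apply: (@measurable_comp_continuous2 _ _ _ _ _ F X (fun w => Q w + h *: ebase i)) => //.
    exact: adm_continuous.
  exact: measurable_rowD.
exact: measurable_comp_continuous2 adm_continuous mX mQ.
Qed.

(** A measurable and bounded choice of subgradients: the derivative in p at [Q w], measurable as a
    limit of difference quotients, and 0 where [Q w = 0], which is admissible because F >= 0.
    Testing it against the vectors of the basis and their opposites bounds its coordinates
    independently of [O]. *)
Lemma adm_calibration : exists C : R, forall (dO : measure_display) (O : measurableType dO)
    (X Q : O -> 'rV[R]_d), measurable_fun setT X -> measurable_fun setT Q ->
  exists a : O -> 'rV[R]_d, [/\ measurable_fun setT a, forall w i, `|a w 0 i| <= C,
    forall w q, dotv (a w) q <= F (X w) q & forall w, dotv (a w) (Q w) = F (X w) (Q w)].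
Proof.
have [c [c0 hc]] := adm_bound; exists c^-1 => dO O X Q mX mQ.
pose a w : 'rV[R]_d := \row_i (if Q w == 0 then 0 else pder (X w) (Q w) i).
have aq w q : dotv (a w) q <= F (X w) q.
  have [Q0|Q0] := eqVneq (Q w) 0.
    rewrite /dotv big1 ?adm_ge0// => i _.
    by rewrite mxE Q0 eqxx mul0r.
  apply: le_trans (adm_pder_le (X w) q Q0).
  by apply: ler_sum => i _; rewrite mxE (negbTE Q0).
exists a; split => //.
- apply: measurable_row => i.
  pose g k w := if Q w == 0 then 0 else dquot (X w) (Q w) i k.+1%:R^-1.
  apply: (measurable_fun_cvg (h := g)) => [k|w _].
    have m0 : measurable [set w | Q w = 0].
      rewrite (_ : [set _ | _] = \bigcap_(j in [set: 'I_d])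
          ((fun w => Q w 0 j) @^-1` [set 0])).
        apply: fin_bigcap_measurable => // j _; rewrite -[X in measurable X]setTI.
        by apply: measurable_rowP.
      apply/seteqP; split => w /=; first by move=> Qw j _ /=; rewrite Qw mxE.
      by move=> h; apply/rowP => j; rewrite mxE; exact: h j I.
    apply: measurable_fun_ifT => //.
      apply: (measurable_fun_bool true); rewrite setTI.
      rewrite (_ : _ @^-1` _ = [set w | Q w = 0])//.
      by apply/seteqP; split => w /= /eqP.
    exact: measurable_dquot.
  rewrite /g mxE; case: eqVneq => Q0; first exact: cvg_cst.
  apply: (@cvg_comp _ _ _ (fun k : nat => k.+1%:R^-1 : R) (dquot (X w) (Q w) i) _ 0^');
    last exact: (@cvg_dquot (X w) (Q w) i Q0).
  move=> A [e /= e0 eA]; have /cvgrPdist_lt/(_ e e0) := @cvg_harmonic R.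
  apply: filterS => k hk; apply: eA; first exact: hk.
  by rewrite invr_neq0// pnatr_eq0.
- move=> w i; rewrite ler_norml; apply/andP; split.
    have := aq w (- ebase i); have /andP[_] := hc (X w) (- ebase i).
    rewrite (_ : enorm (- ebase i) = 1); last first.
      rewrite /enorm (bigD1 i)//= !mxE !eqxx big1 ?addr0 ?sqrrN ?expr1n ?sqrtr1//.
      by move=> j ji; rewrite !mxE (negbTE ji) andbF oppr0 expr0n.
    rewrite (_ : dotv _ _ = - a w 0 i); first by lra.
    rewrite /dotv (bigD1 i)//= !mxE !eqxx big1 ?addr0 ?mulrN1// => j ji.
    by rewrite !mxE (negbTE ji) andbF oppr0 mulr0.
  have := aq w (ebase i); have /andP[_] := hc (X w) (ebase i).
  rewrite (_ : enorm (ebase i) = 1); last first.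
    rewrite /enorm (bigD1 i)//= !mxE !eqxx big1 ?addr0 ?expr1n ?sqrtr1//.
    by move=> j ji; rewrite !mxE (negbTE ji) andbF expr0n.
  rewrite (_ : dotv _ _ = a w 0 i); first by lra.
  rewrite /dotv (bigD1 i)//= !mxE !eqxx big1 ?addr0 ?mulr1// => j ji.
  by rewrite !mxE (negbTE ji) andbF mulr0.
- move=> w; have [Q0|Q0] := eqVneq (Q w) 0.
    by rewrite /dotv Q0 adm0 big1// => i _; rewrite !mxE mulr0.
  rewrite -(adm_pder_eq _ Q0); apply: eq_bigr => i _.
  by rewrite mxE (negbTE Q0).
Qed.

End Admissible.

(** * Compactness of Young measures *)

Section BinaryCode.

(** The first [m] bits read as a binary number, most significant bit first. Cylinders of depth [m]
    become integers in lexicographic order, and the cylinder [c] splits into [c.*2] and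
    [c.*2.+1]. *)
Fixpoint code (b : nat -> bool) (m : nat) : nat :=
  if m is m'.+1 then ((code b m').*2 + b m')%N else 0%N.

Definition cbit (m c j : nat) : bool := odd (c %/ 2 ^ (m.-1 - j)).

Lemma code_lt b m : (code b m < 2 ^ m)%N.
Proof.
elim: m => //= m ih; rewrite expnS mul2n -addnn.
by case: (b m); rewrite -?addnn; lia.
Qed.

Lemma cbit_code b m j : (j < m)%N -> cbit m (code b m) j = b j.
Proof.
elim: m => // m ih; rewrite ltnS leq_eqVlt => /predU1P[->|jm].
  by rewrite /cbit/= subnn expn0 divn1 oddD odd_double; case: (b m).
rewrite -ih// /cbit /=; congr odd.
rewrite (_ : (m - j)%N = (m.-1 - j).+1); last by lia.
rewrite expnS divnMA; congr (_ %/ _)%N.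
by rewrite divn2 halfD odd_double doubleK; case: (b m); rewrite ?addn0.
Qed.

End BinaryCode.

Section UltraLimit.
Context {R : realType}.

Lemma ultra_fmap (T S : Type) (f : T -> S) (U : set_system T) :
  UltraFilter U -> UltraFilter (f @ U).
Proof.
move=> UF; split; first exact: fmap_proper_filter.
move=> G GF UG; apply/seteqP; split => A; last exact: UG.
move=> GA; have [//|UnA] := in_ultra_setVsetC (f @^-1` A) UF.
have : G (~` A) by apply: UG.
move=> GnA; have h : G (A `&` ~` A) by exact: filterI.
by rewrite setICr in h; have := @filter_not_empty _ _ GF h.
Qed.

Lemma ultra_bounded_cvg (U : set_system nat) (UF : UltraFilter U) (u : nat -> R) (K : R) :
  (forall n, 0 <= u n <= K) -> exists l : R, u n @[n --> U] --> l.
Proof.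
move=> uK; have := @segment_compact R 0 K; rewrite compact_ultra => /(_ (u @ U)).
case; last by move=> l [_ ul]; exists l.
- exact: ultra_fmap.
- change (U [set n | `[0, K]%classic (u n)]).
  apply: (@filterS _ _ _ setT); last exact: filterT.
  by move=> n _ /=; rewrite in_itv/=; exact: uK.
Qed.

End UltraLimit.

Section BitCompactness.
Context {dT : measure_display} {T : measurableType dT} {R : realType}.
Variables (th : nat -> {finite_measure set T -> \bar R}) (K : R).
Hypothesis thK : forall n, fine (th n setT) <= K.
Variable b : nat -> nat -> T -> bool.
Hypothesis mb : forall n j, measurable [set w | b n j w].
Variable U : set_system nat.
Hypothesis UF : UltraFilter U.

Let cset n m c := [set w | code (b n ^~ w) m = c].

Lemma measurable_code n m c : measurable (cset n m c).
Proof.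
elim: m c => [|m ih] c.
  have [->|c0] := eqVneq c 0%N.
    by rewrite (_ : cset n 0 0 = setT)//; apply/seteqP; split.
  rewrite (_ : cset n 0 c = set0)//; apply/seteqP; split => // w /= c0'.
  by rewrite -c0' eqxx in c0.
have E w : [set w | b n m w] w = (b n m w : Prop) by [].
rewrite (_ : cset n m.+1 c = (cset n m c./2 `&` [set w | b n m w] `&` (if odd c then setT else set0)) `|`
   ((cset n m c./2 `\` [set w | b n m w]) `&` (if odd c then set0 else setT))).
  apply: measurableU; (apply: measurableI; last by case: odd).
    exact: measurableI.
  exact: measurableD.
apply/seteqP; split => w; rewrite /cset /=.
  move=> <-; rewrite oddD odd_double/=.
  case: (b n m w) => /=; [left|right]; rewrite ?oddb; (split => //; split => //).
    by rewrite addn1 -[(_.*2.+1)%N]/((true + _.*2)%N) half_bit_double.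
  by rewrite addn0 doubleK.
have := odd_double_half c; case: (odd c) => /= cE [[[h1 h2] []]|[[h1 h2] []]] //.
  by move: cE h1 h2; case: (b n m w) => //= cE h1 _; lia.
by rewrite h1; case: (b n m w) h2 => //= _; rewrite addn0 -{2}cE.
Qed.

Let a n m c := fine (th n (cset n m c)).

Lemma mass_itv n m c : 0 <= a n m c <= K.
Proof.
rewrite /a fine_ge0 ?measure_ge0//= (le_trans _ (thK n))//.
apply: fine_le; rewrite ?fin_num_measure//; [exact: measurable_code|].
by apply: le_measure; rewrite ?inE//; exact: measurable_code.
Qed.

Lemma mass_split n m c : a n m c = a n m.+1 c.*2 + a n m.+1 c.*2.+1.
Proof.
rewrite /a -fineD ?fin_num_measure//; try exact: measurable_code.
rewrite -measureU; try exact: measurable_code; last first.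
  rewrite -subset0 => w; rewrite /cset /= => -[-> h]; suff : false by []; lia.
congr (fine (th n _)); apply/seteqP; split => w; rewrite /cset/=.
  by move=> ->; case: (b n m w); [right; rewrite addn1|left; rewrite addn0].
case: (b n m w); rewrite ?addn1 ?addn0 => -[] h; lia.
Qed.

(** The masses of cylinders converge along the ultrafilter, and their limits inherit the splitting
    rule. Laying the limit masses side by side in [0, M[ gives nested partitions into intervals; the
    digits of [t] record the intervals that contain M t. *)
Theorem bits_compactness : exists (M : R) (bt : nat -> R -> bool),
  [/\ 0 <= M, forall j, measurable [set t | bt j t] &
   forall m c, a n m c @[n --> U] -->
     M * fine (uniform_prob (@ltr01 R) [set t | code (bt ^~ t) m = c])].
Proof.
have /boolp.choice[l0 l0P] : forall mc : nat * nat, exists l : R, a n mc.1 mc.2 @[n --> U] --> l.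
  by move=> mc; apply: (@ultra_bounded_cvg R U UF _ K) => n; exact: mass_itv.
pose l m c := l0 (m, c).
have lP m c : a n m c @[n --> U] --> l m c := l0P (m, c).
have l_ge0 m c : 0 <= l m c.
  apply: (cvgr_to_ge (lP m c)); apply: nearW => n.
  by have /andP[] := mass_itv n m c.
have l_split m c : l m c = l m.+1 c.*2 + l m.+1 c.*2.+1.
  have h1 : a n m.+1 c.*2 + a n m.+1 c.*2.+1 @[n --> U] --> l m.+1 c.*2 + l m.+1 c.*2.+1.
    exact: cvgD (lP _ _) (lP _ _).
  have h2 := lP m c.
  rewrite (_ : (fun n => a n m c) = fun n => a n m.+1 c.*2 + a n m.+1 c.*2.+1) in h2.
    exact: (cvg_unique (@Rhausdorff R) h2 h1).
  by apply/funext => n; exact: mass_split.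
(* The cumulated masses, which are the end points of the intervals of depth [m]; [A_double] says
   that each partition refines the previous one. *)
pose A m c := \sum_(k < c) l m k.
have AS m c : A m c.+1 = A m c + l m c by rewrite /A big_ord_recr.
have A0 m : A m 0%N = 0 by rewrite /A big_ord0.
have A_mono m c c' : (c <= c')%N -> A m c <= A m c'.
  elim: c' => [|c' ih]; first by rewrite leqn0 => /eqP ->.
  rewrite leq_eqVlt => /predU1P[->//|]; rewrite ltnS => /ih h.
  by rewrite AS (le_trans h)// lerDl.
have A_double m c : A m c = A m.+1 c.*2.
  elim: c => [|c ih]; first by rewrite !A0.
  by rewrite doubleS !AS ih l_split addrA.
pose M := A 0%N 1%N.
have A_last m : A m (2 ^ m)%N = M.
  by elim: m => [//|m ih]; rewrite expnS mul2n -A_double.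
have M0 : 0 <= M by rewrite /M -(A0 0%N) A_mono.
(* The number of the interval of depth [m] that contains M t, found by bisection: the new bit tells
   on which side of the splitting point M t lies. *)
pose fix J (m : nat) (t : R) {struct m} : nat := if m is m'.+1 then
  ((J m' t).*2 + (A m'.+1 (J m' t).*2.+1 <= M * t)%R)%N else 0%N.
pose bt m (t : R) := A m.+1 (J m t).*2.+1 <= M * t.
have JE m t : code (bt ^~ t) m = J m t by elim: m => //= m ->.
have J_itv m t : 0 <= M * t < M -> A m (J m t) <= M * t < A m (J m t).+1.
  move=> tM; elim: m => [|m /andP[ih1 ih2]] /=; first by rewrite A0.
  case: (leP (A m.+1 (J m t).*2.+1) (M * t)) => h; rewrite ?addn1 ?addn0.
    by rewrite h/= -doubleS -A_double.
  by rewrite -A_double ih1 h.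
have J_lt m t : (J m t < 2 ^ m)%N by rewrite -JE code_lt.
have mJ m c : measurable [set t | J m t = c] /\ measurable [set t | bt m t].
  have mAt (x : R) : measurable [set t | x <= M * t].
    rewrite (_ : [set _ | _] = setT `&` (fun t => M * t) @^-1` `[x, +oo[%classic).
      have h : measurable_fun setT (fun t : R => M * t) by apply: measurable_funM.
      by apply: h.
    by rewrite setTI; apply/seteqP; split => t /=; rewrite in_itv/= andbT.
  have mbt m' : (forall c, measurable [set t | J m' t = c]) -> measurable [set t | bt m' t].
    move=> h; rewrite (_ : [set _ | _] = \bigcup_c ([set t | J m' t = c] `&`
        [set t | A m'.+1 c.*2.+1 <= M * t])).
      by apply: bigcupT_measurable => k; exact: measurableI.
    apply/seteqP; split => t /=; first by move=> h'; exists (J m' t).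
    by move=> [k _ [/= <-]].
  suff h : forall c, measurable [set t | J m t = c] by split=> //; exact: mbt.
  elim: m {c} => [|m ih] c.
    have [->|c0] := eqVneq c 0%N.
      by rewrite (_ : [set _ | _] = setT)//; apply/seteqP; split.
    rewrite (_ : [set _ | _] = set0)//; apply/seteqP; split => // w /= c0'.
    by rewrite -c0' eqxx in c0.
  rewrite (_ : [set _ | _] = \bigcup_k ([set t | J m t = k] `&`
     ((if c == k.*2.+1 then [set t | bt m t] else set0) `|`
      (if c == k.*2 then ~` [set t | bt m t] else set0)))).
    apply: bigcupT_measurable => k; apply: measurableI => //.
    have h := mbt m ih.
    apply: measurableU; case: ifP => // _; exact: measurableC.
  apply/seteqP; split => t /=.
    move=> <-; exists (J m t) => //; split => //=; rewrite /bt.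
    case E: (A m.+1 (J m t).*2.+1 <= M * t) => /=; [left|right].
      by rewrite addn1 eqxx /= E.
    by rewrite addn0 eqxx /= E.
  move=> [k _ [/= Jk []]]; case: eqP => // -> /=; rewrite /bt Jk => h.
    by rewrite h addn1.
  by case: (_ <= _) h => //= _; rewrite addn0.
exists M, bt; split => //; first by move=> j; have [] := mJ j 0%N.
move=> m c; rewrite (_ : M * _ = l m c); first exact: lP.
under eq_set do rewrite JE.
have [cm|mc] := leqP (2 ^ m) c.
  rewrite (_ : [set _ | _] = set0); last first.
    by apply/seteqP; split => // t /= tc; have := J_lt m t; rewrite tc ltnNge cm.
  rewrite measure0 mulr0; apply/esym.
  have h2 := lP m c.
  rewrite (_ : (fun n => a n m c) = cst 0) in h2.
    exact: (cvg_unique (@Rhausdorff R) h2 (cvg_cst _)).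
  apply/funext => n; rewrite /a (_ : cset n m c = set0) ?measure0//.
  apply/seteqP; split => // w; rewrite /cset/= => wc.
  by have := code_lt (b n ^~ w) m; rewrite wc ltnNge cm.
have lM : A m c.+1 <= M by rewrite -(A_last m) A_mono.
have Ac0 : 0 <= A m c by rewrite -(A0 m) A_mono.
have [M00|Mn0] := eqVneq M 0.
  rewrite M00 mul0r; apply/le_anti; rewrite l_ge0 /=.
  by have := lM; rewrite M00 AS; lra.
have Mp : 0 < M by rewrite lt_neqAle eq_sym Mn0.
have Jc t : 0 <= t < 1 -> (J m t = c) <-> (A m c <= M * t < A m c.+1).
  move=> /andP[t0 t1]; have tM : 0 <= M * t < M by rewrite mulr_ge0//= gtr_pMr.
  have /andP[j1 j2] := J_itv m t tM; split => [<-|/andP[h1 h2]]; first by rewrite j1.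
  apply/eqP; rewrite eqn_leq; apply/andP; split; rewrite leqNgt; apply/negP => h.
    by have := A_mono m _ _ h; rewrite leNgt (le_lt_trans j1 h2).
  by have := A_mono m _ _ h; rewrite leNgt (le_lt_trans h1 j2).
rewrite /uniform_prob integral_uniform_pdf.
rewrite (eq_integral (cst 1%:E)); last first.
  move=> t /set_mem[_ /=]; rewrite in_itv/= /uniform_pdf => ->.
  by rewrite subr0 invr1.
have mS : measurable ([set t | J m t = c] `&` `[0, 1]) by apply: measurableI => //; have [] := mJ m c.
rewrite integral_cst// mul1e.
pose I := `[A m c / M, A m c.+1 / M[%classic : set R.
rewrite [X in fine X](_ : _ = lebesgue_measure I); last first.
  (* The point t = 1 is discarded: there M t = M lies to the right of all the half-open intervals,
     and [Jc] does not apply. *)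
  have E : ([set t | J m t = c] `&` `[0, 1]) `\` [set 1] = I `\` [set 1].
    apply/seteqP; split => t; rewrite /I /= !in_itv/=.
      move=> [[h1 /andP[h2 h3]] h4]; split => //.
      have t1 : 0 <= t < 1 by rewrite h2/= lt_neqAle h3 andbT; apply/eqP.
      by move/(Jc _ t1) : h1; rewrite ler_pdivrMr// ltr_pdivlMr// mulrC.
    rewrite ler_pdivrMr// ltr_pdivlMr// => -[h h4]; split => //.
    have /andP[h1 h2] := h.
    have t0 : 0 <= t by rewrite -(pmulr_lge0 _ Mp) (le_trans Ac0).
    have t1 : t < 1 by rewrite -(ltr_pM2r Mp) mul1r (lt_le_trans h2).
    by split; [apply/Jc; rewrite ?t0// mulrC|rewrite t0 ltW].
  have D (S : set R) : measurable S -> lebesgue_measure S = lebesgue_measure (S `\` [set 1]).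
    move=> mS'; rewrite (@measureDI _ _ _ lebesgue_measure S [set 1])//.
    rewrite [X in (_ + X)%E](_ : _ = 0%E) ?adde0//.
    apply: (@subset_measure0 _ _ _ lebesgue_measure _ [set 1]) => //; first exact: measurableI.
    exact: lebesgue_measure_set1.
  have mI : measurable I by exact: measurable_itv.
  exact: (etrans (D _ mS) (etrans (congr1 lebesgue_measure E) (esym (D _ mI)))).
rewrite lebesgue_measure_itv/= lte_fin.
have h : A m c / M <= A m c.+1 / M by rewrite ler_pM2r ?invr_gt0// A_mono.
move: h; rewrite le_eqVlt => /predU1P[h|h].
  rewrite h ltxx/= mulr0; apply/esym/eqP.
  move/(congr1 (fun x => x * M)): h; rewrite !divfK// AS; lra.
by rewrite h/= AS; field.
Qed.

End BitCompactness.

Section UniformCube.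
Context {R : realType} {n : nat}.
Implicit Types (f : 'rV[R]_n -> R) (x y : 'rV[R]_n).

Definition box01 : set 'rV[R]_n := [set x | forall i, 0 <= x 0 i <= 1].

Lemma compact_box01 : compact box01.
Proof.
have := @rV_compact R n (fun=> `[0, 1]%classic) (fun=> @segment_compact R 0 1).
exact.
Qed.

Lemma continuous_bounded_box f : continuous f -> exists C : R, forall x, box01 x -> `|f x| <= C.
Proof.
move=> cf; have /compact_near_coveringP nc := compact_box01.
have := nc R (pinfty_nbhs R) (fun M x => `|f x| <= M) _.
case; last first.
  move=> M [_ hM]; exists (M + 1) => x bx; apply: hM => //; by rewrite ltrDl.
move=> x _; exists ([set y | `|f x - f y| < 1], [set M | `|f x| + 1 < M]).
  split; first by have /cvgrPdist_lt := cf x; apply.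
  by exists (`|f x| + 1); split=> //; exact: num_real.
move=> [y M] /= [h1 h2]; rewrite -(subrK (f x) (f y)) (le_trans (ler_normD _ _))//.
by rewrite distrC; lra.
Qed.

Lemma continuous_unif_box f (e : R) : continuous f -> 0 < e -> exists2 dl : R, 0 < dl &
  forall x y, box01 x -> box01 y -> (forall i, `|x 0 i - y 0 i| <= dl) -> `|f x - f y| <= e.
Proof.
move=> cf e0; have /compact_near_coveringP nc := compact_box01.
have := nc R (0^'+) (fun dl x => forall y, `|x - y| <= dl -> `|f x - f y| <= e) _.
case.
  move=> x _; have e2 : 0 < e / 2 by rewrite divr_gt0.
  have /cvgrPdist_lt/(_ _ e2)/nbhs_ballP[r /= r0 hr] := cf x.
  exists (ball x (r / 2), [set dl | dl < r / 2]).
    split; first by apply: nbhsx_ballx; rewrite divr_gt0.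
    by apply: nbhs_right_lt; rewrite divr_gt0.
  move=> [z dl] /= [xz dlr] y zy.
  rewrite -ball_normE /= in xz.
  have h1 : `|f x - f z| < e / 2.
    by apply: hr; rewrite -ball_normE /=; lra.
  have h2 : `|f x - f y| < e / 2.
    apply: hr; rewrite -ball_normE /=.
    rewrite (_ : x - y = (x - z) + (z - y)); last by rewrite addrA subrK.
    by rewrite (le_lt_trans (ler_normD _ _))//; lra.
  rewrite (_ : f z - f y = (f x - f y) - (f x - f z)); last by ring.
  by rewrite (le_trans (ler_normB _ _))//; lra.
move=> dl /= dl0 hdl; exists (dl / 2); first by rewrite divr_gt0.
move=> x y bx _ xy; apply: (hdl (dl / 2)) => //.
- rewrite /= sub0r normrN gtr0_norm ?divr_gt0//; lra.
- by rewrite divr_gt0.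
- by apply: norm_le_coord => [|i]; [rewrite divr_ge0// ltW|rewrite !mxE].
Qed.

End UniformCube.

Section Dyadic.
Context {R : realType}.
Implicit Types (x : R) (b : nat -> bool).

Definition digit j x : bool := odd (Num.trunc (2 ^+ j.+1 * x)).

Definition dyad b m : R := \sum_(l < m) (b l)%:R / 2 ^+ l.+1.

Lemma trunc_digit j x : 0 <= x ->
  Num.trunc (2 ^+ j.+1 * x) = ((Num.trunc (2 ^+ j * x)).*2 + digit j x)%N.
Proof.
move=> x0; rewrite /digit.
have h0 : 0 <= 2 ^+ j * x by rewrite mulr_ge0// exprn_ge0.
have h1 : 0 <= 2 ^+ j.+1 * x by rewrite mulr_ge0// exprn_ge0.
have /andP[a1 a2] := truncn_itv h0; have /andP[b1 b2] := truncn_itv h1.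
set p := Num.trunc (2 ^+ j * x) in a1 a2 *; set q := Num.trunc _ in b1 b2 *.
have e : 2 ^+ j.+1 * x = 2 * (2 ^+ j * x) by rewrite exprS; ring.
have h3 : (p.*2 <= q)%N.
  rewrite -ltnS -(ltr_nat R) (le_lt_trans _ b2)// e -mul2n natrM ler_pM2l//.
have h4 : (q < p.*2.+2)%N.
  rewrite -(ltr_nat R) (le_lt_trans b1)// e -doubleS -mul2n natrM ltr_pM2l//.
have := odd_double_half q; lia.
Qed.

Lemma dyadS b m : dyad b m.+1 = dyad b m + (b m)%:R / 2 ^+ m.+1.
Proof. by rewrite /dyad big_ord_recr. Qed.

Lemma dyad_digit x m : 0 <= x < 1 ->
  dyad (digit ^~ x) m = (Num.trunc (2 ^+ m * x))%:R / 2 ^+ m.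
Proof.
move=> /andP[x0 x1]; elim: m => [|m ih].
  rewrite /dyad big_ord0 expr0 mul1r divr1 (truncn_def (n := 0)) ?x0//.
rewrite dyadS ih trunc_digit// natrD -muln2 natrM exprS; field.
by rewrite expf_neq0.
Qed.

Lemma dyad_approx x m : 0 <= x < 1 -> `|x - dyad (digit ^~ x) m| <= 2^-1 ^+ m.
Proof.
move=> x01; have /andP[x0 x1] := x01; rewrite dyad_digit//.
have p2 : 0 < 2 ^+ m :> R by rewrite exprn_gt0.
have h0 : 0 <= 2 ^+ m * x by rewrite mulr_ge0// ltW.
have /andP[a1 a2] := truncn_itv h0.
rewrite (_ : x - _ = (2 ^+ m * x - (Num.trunc (2 ^+ m * x))%:R) / 2 ^+ m); last first.
  by field; rewrite gt_eqF.
rewrite exprVn normrM [X in _ * X]gtr0_norm ?invr_gt0// ler_piMl ?invr_ge0 ?ltW//.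
by rewrite ger0_norm ?subr_ge0// ltrBlDl natr1.
Qed.

Lemma dyad_itv b m : 0 <= dyad b m <= 1 - 2^-1 ^+ m.
Proof.
elim: m => [|m /andP[h1 h2]]; first by rewrite /dyad big_ord0 expr0 subrr lexx.
rewrite dyadS -exprVn exprS.
have p2 : 0 < 2^-1 ^+ m :> R by rewrite exprn_gt0// invr_gt0.
by case: (b m); rewrite ?mul1r ?mul0r ?addr0; apply/andP; split; lra.
Qed.

Lemma dyad_shift b m k : dyad b m <= dyad b (m + k) <= dyad b m + 2^-1 ^+ m.
Proof.
suff h : dyad b m <= dyad b (m + k) <= dyad b m + (2^-1 ^+ m - 2^-1 ^+ (m + k)).
  have p2 : 0 < 2^-1 ^+ (m + k) :> R by rewrite exprn_gt0// invr_gt0.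
  by have /andP[h1 h2] := h; rewrite h1; lra.
elim: k => [|k /andP[h1 h2]]; first by rewrite addn0 subrr addr0 lexx.
rewrite addnS dyadS -exprVn [2^-1 ^+ (m + k).+1]exprS.
have p2 : 0 < 2^-1 ^+ (m + k) :> R by rewrite exprn_gt0// invr_gt0.
by case: (b _); rewrite ?mul1r ?mul0r ?addr0; apply/andP; split; lra.
Qed.

Lemma cvg_dyad b : exists z : R, [/\ dyad b m @[m --> \oo] --> z, 0 <= z <= 1 &
  forall m, `|z - dyad b m| <= 2^-1 ^+ m].
Proof.
have nd : nondecreasing_seq (dyad b).
  by move=> p q pq; have /andP[] := dyad_shift b p (q - p); rewrite subnKC.
have c : cvgn (dyad b).
  apply: nondecreasing_is_cvgn => //; exists 1 => _ [m _ <-].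
  have /andP[_ h] := dyad_itv b m.
  have p2 : 0 < 2^-1 ^+ m :> R by rewrite exprn_gt0// invr_gt0.
  lra.
exists (limn (dyad b)); split => //.
- apply/andP; split.
    by apply: limr_ge => //; apply: nearW => m; have /andP[] := dyad_itv b m.
  apply: limr_le => //; apply: nearW => m; have /andP[_ h] := dyad_itv b m.
  have p2 : 0 < 2^-1 ^+ m :> R by rewrite exprn_gt0// invr_gt0.
  lra.
move=> m; have h1 : dyad b m <= limn (dyad b) by exact: nondecreasing_cvgn_le.
rewrite ger0_norm ?subr_ge0// lerBlDl addrC.
apply: limr_le => //; exists m => // k /= mk.
by have /andP[_] := dyad_shift b m (k - m); rewrite subnKC// addrC.
Qed.

End Dyadic.

Section IntegralCode.
Context {dT : measure_display} {T : measurableType dT} {R : realType}.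

Lemma Rintegral_indic (mu : {finite_measure set T -> \bar R}) A : measurable A ->
  \int[mu]_w \1_A w = fine (mu A).
Proof. by move=> mA; rewrite /Rintegral integral_indic// setIT. Qed.

Lemma Rintegral_code (mu : {finite_measure set T -> \bar R}) (c : T -> nat) B (g : nat -> R) :
  (forall k, measurable [set w | c w = k]) -> (forall w, (c w < B)%N) ->
  \int[mu]_w g (c w) = \sum_(k < B) g k * fine (mu [set w | c w = k]).
Proof.
move=> mc cB.
rewrite (_ : (fun w => g (c w)) = fun w => \sum_(k < B) g k * \1_[set w | c w = k] w); last first.
  apply/funext => w; rewrite (bigD1 (Ordinal (cB w)))//= indicE mem_set//= mulr1.
  rewrite big1 ?addr0// => k kc; rewrite indicE memNset ?mulr0//= => ck.
  by move/negP: kc; apply; apply/eqP/val_inj.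
have ig (k : 'I_B) : mu.-integrable setT (EFin \o (\1_[set w | c w = k] : T -> R)).
  by apply: bmeas_integrable; apply: bmeas_indic; exact: mc.
rewrite Rintegral_sum//; last by move=> k; exact: integrableZr.
by apply: eq_bigr => k _; rewrite RintegralZl// Rintegral_indic//; exact: mc.
Qed.

Lemma bmeas_code (c : T -> nat) B (g : nat -> R) :
  (forall k, measurable [set w | c w = k]) -> (forall w, (c w < B)%N) ->
  bmeas (fun w => g (c w)).
Proof.
move=> mc cB; split.
  exact: (@measurable_countable_comp _ _ _ _ c g mc).
exists (\sum_(k < B) `|g k|) => w.
by rewrite (bigD1 (Ordinal (cB w)))//= lerDl sumr_ge0.
Qed.

Lemma Rintegral_dist (mu : {finite_measure set T -> \bar R}) (f g : T -> R) (e : R) :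
  bmeas f -> bmeas g -> (forall w, `|f w - g w| <= e) ->
  `|\int[mu]_w f w - \int[mu]_w g w| <= e * fine (mu setT).
Proof.
move=> mf mg fg; have i1 := bmeas_integrable mu mf; have i2 := bmeas_integrable mu mg.
rewrite -RintegralB//; apply: le_trans (le_normr_Rintegral _ _) _ => //.
  exact: integrableBr.
rewrite -Rintegral_cst//; apply: le_Rintegral => //.
- apply: bmeas_integrable; have [m1 [C hC]] := bmeasB mf mg; split.
    by apply: measurableT_comp.
  by exists C => w; rewrite normr_id.
- exact: cst_integrable.
Qed.

End IntegralCode.

Section YoungCompactness.
Context {dT : measure_display} {T : measurableType dT} {R : realType} {N' : nat}.
Local Notation N := N'.+1.
Variables (th : nat -> {finite_measure set T -> \bar R}) (K : R).
Hypothesis thK : forall n, fine (th n setT) <= K.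
Variable u : nat -> T -> 'rV[R]_N.
Hypothesis mu : forall n, measurable_fun setT (u n).
Hypothesis u01 : forall n w i, 0 <= u n w 0 i < 1.
Variable U : set_system nat.
Hypothesis UF : UltraFilter U.

(* The binary digits of all coordinates are interleaved in a single sequence. *)
Let b n j w : bool := digit (j %/ N) (u n w 0 (inord (j %% N))).

Let dec (be : nat -> bool) m : 'rV[R]_N := \row_i dyad (fun l => be (l * N + i)%N) m.

Let mb n j : measurable [set w | b n j w].
Proof.
pose x w := 2 ^+ (j %/ N).+1 * u n w 0 (inord (j %% N)).
have mx : measurable_fun setT x by apply: measurable_funM => //; exact: measurable_rowP.
have x0 w : 0 <= x w.
  by rewrite /x mulr_ge0 ?exprn_ge0//; have /andP[] := u01 n w (inord (j %% N)).
rewrite (_ : [set _ | _] = \bigcup_k (x @^-1` `[k.*2.+1%:R, k.*2.+2%:R[)).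
  by apply: bigcupT_measurable => k; rewrite -[X in measurable X]setTI; exact: mx.
apply/seteqP; split => w; rewrite /b /digit /= -/(x w).
  move=> ox; exists (Num.trunc (x w))./2 => //=; rewrite in_itv/= -truncn_eq//.
  by have := odd_double_half (Num.trunc (x w)); rewrite ox add1n => ->.
by move=> [k _ /=]; rewrite in_itv/= -truncn_eq// => /eqP ->; rewrite oddS odd_double.
Qed.

(** Precision [m] in all [N] coordinates involves the first [m * N] interleaved bits only, so it is
    a function of a single integer with finitely many values. *)
Lemma dec_code be m : dec be m = dec (cbit (m * N) (code be (m * N))) m.
Proof.
apply/rowP => i; rewrite !mxE; apply: eq_bigr => l _; congr (_%:R / _).
rewrite cbit_code//; have := ltn_ord l; have := ltn_ord i => h1 h2.
rewrite (leq_trans (_ : _ < l * N + N)%N) ?ltn_add2l//.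
by rewrite addnC -mulSn leq_mul2r h2 orbT.
Qed.

Lemma dec_b n w m i : `|u n w 0 i - dec (b n ^~ w) m 0 i| <= 2^-1 ^+ m.
Proof.
rewrite mxE (_ : dyad _ m = dyad (digit ^~ (u n w 0 i)) m); first exact: dyad_approx.
apply: eq_bigr => l _; rewrite /b divnMDl// divn_small// addn0 modnMDl modn_small//.
by rewrite inord_val.
Qed.

Lemma box_dec be m : box01 (dec be m).
Proof.
move=> i; rewrite mxE; have /andP[h1 h2] := @dyad_itv R (fun l => be (l * N + i)%N) m.
rewrite h1/= (le_trans h2)// gerBl exprn_ge0//.
Qed.

(** By uniform continuity, f is uniformly close to a function of finitely many digits. For the
    latter the integrals are finite sums of cylinder masses, and [bits_compactness] applies term by
    term. *)
Theorem young_compactness : exists (M : R) (Z : R -> 'rV[R]_N),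
  [/\ 0 <= M, measurable_fun setT Z, forall t, box01 (Z t) &
   forall f : 'rV[R]_N -> R, continuous f ->
     \int[th n]_w f (u n w) @[n --> U] --> M * \int[uniform_prob (@ltr01 R)]_t f (Z t)].
Proof.
have [M [bt [M0 mbt hc]]] := bits_compactness thK mb UF.
have /boolp.choice[z hz] : forall ti : R * 'I_N, exists z : R,
    [/\ dyad (fun l => bt (l * N + ti.2)%N ti.1) m @[m --> \oo] --> z, 0 <= z <= 1 &
      forall m, `|z - dyad (fun l => bt (l * N + ti.2)%N ti.1) m| <= 2^-1 ^+ m].
  by move=> ti; exact: cvg_dyad.
(* The limit digits may end in ones only, so a coordinate can equal 1: values are controlled in the
   closed cube, although those of [u] lie in the half-open one. *)
pose Z t : 'rV[R]_N := \row_i z (t, i).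
have bZ t : box01 (Z t) by move=> i; rewrite mxE; have [] := hz (t, i).
have Zd t m i : `|Z t 0 i - dec (bt ^~ t) m 0 i| <= 2^-1 ^+ m.
  by rewrite !mxE; have [_ _] := hz (t, i).
have mZ : measurable_fun setT Z.
  apply: measurable_row => i.
  apply: (measurable_fun_cvg (h := fun m t => dec (bt ^~ t) m 0 i)); last first.
    by move=> t _; have [h _ _] := hz (t, i); rewrite !mxE; under eq_fun do rewrite mxE.
  move=> m; under eq_fun do rewrite mxE.
  apply: measurable_sum => l; apply: measurable_funM => //.
  rewrite (_ : (fun t => _) = \1_[set t | bt (l * N + i)%N t]); last first.
    apply/funext => t; rewrite indicE; case: (boolP (bt _ t)) => h.
      by rewrite mem_set.
    by rewrite memNset//; exact/negP.
  exact: measurable_indic.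
exists M, Z; split => // f cf.
have [C fC] := continuous_bounded_box cf.
have mcb n m k := measurable_code mb n m k.
have mct m k : measurable [set t | code (bt ^~ t) m = k].
  have := @measurable_code _ _ (fun=> bt) (fun=> mbt) 0%N m k.
  exact.
have bmu n : bmeas (fun w => f (u n w)).
  split; first exact: measurable_comp_continuous cf (mu n).
  exists C => w; apply: fC => i; have /andP[h1 h2] := u01 n w i; by rewrite h1 ltW.
have bmZ : bmeas (fun t => f (Z t)).
  split; first exact: measurable_comp_continuous cf mZ.
  by exists C => t; exact: fC.
apply/cvgrPdist_le => e e0.
have K0 : 0 <= K by apply: le_trans (thK 0); rewrite fine_ge0.
(* The two digit approximations cost e' K and M e', together at most e / 3; the added 1 keeps the
   denominator positive. *)
pose e' := e / (3 * (K + M + 1)).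
have e'0 : 0 < e' by rewrite divr_gt0// mulr_gt0//; lra.
have [dl dl0 hdl] := continuous_unif_box cf e'0.
have [m hm] : exists m, 2^-1 ^+ m <= dl.
  have : (2^-1 : R) ^+ m @[m --> \oo] --> 0 by apply: cvg_expr; rewrite ger0_norm// invf_lt1// ltr1n.
  move/cvgrPdist_le/(_ _ dl0) => -[m _ h]; exists m.
  by have := h m (leqnn m); rewrite /= sub0r normrN ger0_norm// exprn_ge0.
pose g k := f (dec (cbit (m * N) k) m).
pose B := (2 ^ (m * N))%N.
have d1 n : `|\int[th n]_w f (u n w) - \int[th n]_w g (code (b n ^~ w) (m * N))| <= e' * fine (th n setT).
  apply: Rintegral_dist => //.
    by apply: (bmeas_code (B := B)) => [k|w]; [exact: mcb|exact: code_lt].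
  move=> w; rewrite /g -dec_code; apply: hdl.
  - by move=> i; have /andP[h1 h2] := u01 n w i; rewrite h1 ltW.
  - exact: box_dec.
  - by move=> i; exact: le_trans (dec_b _ _ _ _) hm.
set P := uniform_prob _.
have d2 : `|\int[P]_t f (Z t) - \int[P]_t g (code (bt ^~ t) (m * N))| <= e' * fine (P setT).
  apply: Rintegral_dist => //.
    by apply: (bmeas_code (B := B)) => [k|w]; [exact: mct|exact: code_lt].
  move=> t; rewrite /g -dec_code; apply: hdl => //; first exact: box_dec.
  by move=> i; exact: le_trans (Zd _ _ _) hm.
have P1 : fine (P setT) = 1.
  by have -> : P setT = 1%E by exact: (probability_setT (uniform_prob (@ltr01 R))).
have : \sum_(k < B) g k * fine (th n [set w | code (b n ^~ w) (m * N) = k]) @[n --> U] -->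
    \sum_(k < B) g k * (M * fine (P [set t | code (bt ^~ t) (m * N) = k])).
  apply: cvg_big => [|k _]; first exact: add_continuous.
  by apply: cvgM; [exact: cvg_cst|exact: hc].
have e3 : 0 < e / 3 by rewrite divr_gt0.
move/cvgrPdist_le/(_ _ e3); apply: filterS => n.
rewrite -(@Rintegral_code _ _ _ (th n) (fun w => code (b n ^~ w) (m * N)) B g); first last.
- by move=> w; exact: code_lt.
- by move=> k; exact: mcb.
rewrite (_ : \sum_(k < B) _ = M * \int[P]_t g (code (bt ^~ t) (m * N))); last first.
  rewrite (@Rintegral_code _ _ _ P (fun t => code (bt ^~ t) (m * N)) B g); first last.
  - by move=> w; exact: code_lt.
  - by move=> k; exact: mct.
  by rewrite mulr_sumr; apply: eq_bigr => k _; ring.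
set I1 := \int[P]_t f (Z t); set I2 := \int[P]_t _; set I3 := \int[th n]_w _; set I4 := \int[th n]_w _.
move=> h3; have h1 := d1 n; rewrite -/I3 -/I4 in h1; rewrite -/I1 -/I2 P1 mulr1 in d2.
have h1' : `|I4 - I3| <= e' * K by apply: (le_trans h1); rewrite ler_wpM2l ?thK// ltW.
have d2' : `|M * I1 - M * I2| <= M * e' by rewrite -mulrBr normrM ger0_norm// ler_wpM2l.
have eE : e' * K + M * e' <= e / 3.
  rewrite (_ : e / 3 = e' * (K + M + 1)); first by lra.
  by rewrite /e'; field; rewrite gt_eqF//; lra.
rewrite (_ : M * I1 - I4 = (M * I1 - M * I2) + (M * I2 - I3) - (I4 - I3)); last by ring.
rewrite (le_trans (ler_normB _ _))//; have := ler_normD (M * I1 - M * I2) (M * I2 - I3).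
lra.
Qed.

End YoungCompactness.

(** * Fourier coefficients on the torus *)

Section PushforwardMeasure.
Context {d1 d2 : measure_display} {T1 : measurableType d1} {T2 : measurableType d2} {R : realType}.
Variables (phi : T1 -> T2) (mphi : measurable_fun setT phi).

Lemma pushforward_measure_ex (mu : {measure set T1 -> \bar R}) :
  exists m : {measure set T2 -> \bar R}, forall A, m A = mu (phi @^-1` A).
Proof. exists (pushforward mu phi) => //. Unshelve. exact: mphi. Qed.

Lemma pushforward_charge_ex (nu : {charge set T1 -> \bar R}) :
  exists m : {charge set T2 -> \bar R}, forall A, m A = nu (phi @^-1` A).
Proof. exists (pushforward nu phi) => //. Unshelve. exact: mphi. Qed.

End PushforwardMeasure.

Section FubiniBounded.
Context {d1 d2 : measure_display} {T1 : measurableType d1} {T2 : measurableType d2} {R : realType}.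
Variables (m1 : {finite_measure set T1 -> \bar R}) (m2 : {finite_measure set T2 -> \bar R}).
Variable f : T1 * T2 -> R.
Hypothesis bf : bmeas f.

Lemma bmeas_integrable_prod : (m1 \x m2)%E.-integrable setT (EFin \o f).
Proof.
have [mf [C fC]] := bf; apply: measurable_bounded_integrable => //.
  apply: (@le_lt_trans _ _ (m1 setT * m2 setT)%E); first by rewrite -product_measure1E// setXTT.
  rewrite lte_mul_pinfty//; first by rewrite fin_num_measure.
  by rewrite -ge0_fin_numE// fin_num_measure.
exists C; split; first exact: num_real.
by move=> y Cy x _; apply/ltW/(le_lt_trans _ Cy)/fC.
Qed.

Lemma bmeas_section1 x : bmeas (fun y => f (x, y)).
Proof.
have [mf [C fC]] := bf; split; last by exists C => y; exact: fC.
exact: (measurableT_comp mf (measurable_pair1 x)).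
Qed.

Lemma bmeas_section2 y : bmeas (fun x => f (x, y)).
Proof.
have [mf [C fC]] := bf; split; last by exists C => x; exact: fC.
exact: (measurableT_comp mf (measurable_pair2 y)).
Qed.

Let FE x : fubini_F m2 (EFin \o f) x = (\int[m2]_y f (x, y))%:E.
Proof.
rewrite /fubini_F /Rintegral fineK//; apply: integrable_fin_num => //.
exact: bmeas_integrable (bmeas_section1 x).
Qed.

Let GE y : fubini_G m1 (EFin \o f) y = (\int[m1]_x f (x, y))%:E.
Proof.
rewrite /fubini_G /Rintegral fineK//; apply: integrable_fin_num => //.
exact: bmeas_integrable (bmeas_section2 y).
Qed.

Lemma bmeas_fubini2 : bmeas (fun y => \int[m1]_x f (x, y)).
Proof.
have [mf [C fC]] := bf; split.
  have := measurable_fubini_G bmeas_integrable_prod => h.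
  by apply/measurable_EFinP; apply: eq_measurable_fun h => y _; rewrite GE.
exists (C * fine (m1 setT)) => y; have bx := bmeas_section2 y.
have := @Rintegral_dist _ _ _ m1 (fun x => f (x, y)) (cst 0) C bx (bmeas_cst 0).
rewrite Rintegral_cst// mul0r subr0; apply => w.
by rewrite subr0.
Qed.

Lemma Rfubini1 : \int[(m1 \x m2)%E]_z f z = \int[m1]_x \int[m2]_y f (x, y).
Proof.
rewrite /Rintegral -(fubini1 bmeas_integrable_prod); congr fine.
by apply: eq_integral => x _; rewrite FE.
Qed.

Lemma Rfubini2 : \int[(m1 \x m2)%E]_z f z = \int[m2]_y \int[m1]_x f (x, y).
Proof.
rewrite /Rintegral -(fubini2 bmeas_integrable_prod); congr fine.
by apply: eq_integral => y _; rewrite GE.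
Qed.

End FubiniBounded.

Section UniformTrig.
Context {R : realType}.
Local Notation U01 := (uniform_prob (@ltr01 R)).

Lemma uniform_setT : fine (U01 setT) = 1.
Proof. by have -> : U01 setT = 1%E by exact: (probability_setT U01). Qed.

Lemma measurable_cos_affine (s t : R) : measurable_fun setT (fun z : R => cos (s * z + t)).
Proof.
apply: (measurableT_comp (continuous_measurable_fun (@continuous_cos R))).
by apply: measurable_funD => //; exact: measurable_funM.
Qed.

Lemma bmeas_cos_affine (s t : R) : bmeas (fun z : R => cos (s * z + t)).
Proof. by split; [exact: measurable_cos_affine|exists 1 => z; exact: cos_max]. Qed.

Lemma bmeas_sin_affine (s t : R) : bmeas (fun z : R => sin (s * z + t)).
Proof.
have := bmeas_cos_affine s (t - pi / 2); congr bmeas; apply/funext => z.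
by rewrite addrA cosBpihalf.
Qed.

(** Multiplying by [s] instead of dividing lets the formula include s = 0. *)
Lemma Rintegral_cos_affine (s t : R) :
  s * \int[U01]_z cos (s * z + t) = sin (s + t) - sin t.
Proof.
have [->|s0] := eqVneq s 0; first by rewrite mul0r add0r subrr.
have icos := bmeas_integrable U01 (bmeas_cos_affine s t).
(* The integral against the uniform law is computed for a nonnegative integrand; the added 1
   contributes exactly 1. *)
pose f (z : R) : R := 1 + cos (s * z + t).
pose F (z : R) : R := z + s^-1 * sin (s * z + t).
have dF (z : R) : is_derive z 1 F (f z).
  apply: is_derive_eq; rewrite /f /GRing.scale/= ; field.
  exact: s0.
have cf : continuous f.
  apply: continuous_addr; first exact: continuous_const.
  move=> z; apply: (@continuous_comp _ _ _ (fun z => s * z + t) (@cos R)); last exact: continuous_cos.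
  apply: continuous_addr; last exact: continuous_const.
  by apply: continuous_mulr; [exact: continuous_const|move=> ?].
have cF : continuous F.
  by move=> z; apply: differentiable_continuous; apply/derivable1_diffP; have [] := dF z.
have fint : \int[U01]_z f z = 1 + \int[U01]_z cos (s * z + t).
  rewrite RintegralD//; last exact: cst_integrable.
  by rewrite Rintegral_cst// uniform_setT mulr1.
have f0 z : 0 <= f z by rewrite /f; have := cos_geN1 (s * z + t); lra.
have : \int[U01]_z f z = F 1 - F 0.
  rewrite /Rintegral integral_uniform.
  - rewrite subr0 invr1 mul1e (@continuous_FTC2 R f F)//.
    + exact: continuous_subspaceT.
    + split; first by move=> z _; have [] := dF z.
        exact/cvg_at_right_filter/cF.
      exact/cvg_at_left_filter/cF.
    + by move=> z _; rewrite derive1E; apply: derive_val.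
  - by apply/measurable_EFinP; apply: continuous_measurable_fun.
  - by move=> z; rewrite lee_fin.
rewrite fint /F mulr1 mulr0 !add0r => h.
move: h; set I := Rintegral _ _ _ => h.
have -> : I = s^-1 * sin (s + t) - s^-1 * sin t by lra.
by field.
Qed.

Lemma Rintegral_sin_affine (s t : R) :
  s * \int[U01]_z sin (s * z + t) = cos t - cos (s + t).
Proof.
have := Rintegral_cos_affine s (t - pi / 2).
rewrite addrA !sinBpihalf => h.
have -> : cos t - cos (s + t) = - cos (s + t) - - cos t by ring.
by rewrite -h; congr (_ * _); apply: eq_Rintegral => z _; rewrite addrA cosBpihalf.
Qed.

End UniformTrig.

Section TorusMeasureFacts.
Context {R : realType}.
Local Notation U01 := (uniform_prob (@ltr01 R)).
Local Notation leb n := (torus_measure R n).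

Lemma Rintegral_torusS n (f : 'rV[R]_n.+1 -> R) : bmeas f ->
  \int[leb n.+1]_x f x = \int[U01]_z \int[leb n]_x f (cons_row (z, x)).
Proof.
move=> bf; have [mf [C fC]] := bf.
have bc : bmeas (f \o @cons_row R n).
  split; last by exists C => z; exact: fC.
  by apply: measurableT_comp => //; exact: measurable_cons_row.
rewrite -(Rfubini1 _ _ bc) /Rintegral /= integral_distribution//.
  exact/measurable_EFinP.
exact: (bmeas_integrable_prod U01 (leb n) bc).
Qed.

Lemma dotz_cons n (k : 'rV[int]_n.+1) z (x : 'rV[R]_n) :
  dotz k (cons_row (z, x)) = (k 0 0)%:~R * z + dotz (\row_j k 0 (lift ord0 j)) x.
Proof.
rewrite /dotz big_ord_recl mxE unlift_none; congr (_ + _).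
by apply: eq_bigr => i _; rewrite !mxE liftK.
Qed.

Lemma Rintegral_trig n (k : 'rV[int]_n) (t : R) :
  \int[leb n]_x trig k t x = (k == 0)%:R * cos t.
Proof.
elim: n k t => [|n ih] k t.
  have -> : k = 0 by apply/rowP => -[].
  rewrite eqxx mul1r.
  transitivity (\int[leb 0]_x (cst (cos t)) x); first by apply: eq_Rintegral => x _; rewrite trig0.
  by rewrite Rintegral_cst// [X in fine X](_ : _ = 1%E) ?mulr1//; exact: (probability_setT (leb 0)).
rewrite Rintegral_torusS; last exact: bmeas_trig.
set k' : 'rV[int]_n := \row_j k 0 (lift ord0 j).
have E z x : trig k t (cons_row (z, x)) = trig k' (2 * pi * (k 0 0)%:~R * z + t) x.
  by rewrite /trig dotz_cons -/k'; congr cos; ring.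
transitivity (\int[U01]_z ((k' == 0)%:R * cos (2 * pi * (k 0 0)%:~R * z + t))).
  by apply: eq_Rintegral => z _; rewrite -ih; apply: eq_Rintegral => x _; exact: E.
rewrite RintegralZl//; last by apply: bmeas_integrable; exact: bmeas_cos_affine.
have kE : (k == 0) = (k 0 0 == 0) && (k' == 0).
  apply/eqP/andP => [k00|[/eqP k0 /eqP k'0]].
    by split; apply/eqP; [rewrite k00 mxE|apply/rowP => j; rewrite !mxE k00 mxE].
  apply/rowP => i; rewrite mxE; case: (unliftP ord0 i) => [j ->|->//].
  by have /rowP/(_ j) := k'0; rewrite !mxE.
rewrite kE; have [k0|k0] := eqVneq (k 0 0) 0.
  rewrite k0 /=; congr (_ * _).
  transitivity (\int[U01]_z (cst (cos t)) z).
    by apply: eq_Rintegral => z _; rewrite mulr0 mul0r add0r.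
  by rewrite Rintegral_cst// uniform_setT mulr1.
rewrite /= mul0r.
have := Rintegral_cos_affine (2 * pi * (k 0 0)%:~R : R) t.
have -> : sin (2 * pi * (k 0 0)%:~R + t) = sin t :> R.
  by rewrite -!cosBpihalf -[RHS](cosD2piz (k 0 0)); congr cos; ring.
rewrite subrr => /eqP; rewrite mulf_eq0 => /orP[|/eqP ->]; last by rewrite mulr0.
by rewrite !mulf_eq0 pnatr_eq0 (gt_eqF (pi_gt0 R)) intr_eq0 (negbTE k0).
Qed.

Lemma uniform_lt1 : U01 (~` `[0, 1[%classic) = 0%E.
Proof.
rewrite /uniform_prob integral_uniform_pdf (_ : _ `&` _ = [set 1]).
  by rewrite integral_set1.
apply/seteqP; split => x /=; rewrite !in_itv/=.
  by move=> [h1 /andP[h2 h3]]; apply/le_anti; rewrite h3 leNgt/=; apply/negP => x1; apply: h1; rewrite h2.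
by move=> ->; rewrite ltxx andbF ler01 lexx; split.
Qed.

Lemma torus_measure_cube n : leb n (~` fund_cube) = 0%E.
Proof.
elim: n => [|n ih].
  rewrite (_ : ~` _ = set0) ?measure0//; apply/seteqP; split => // x /=.
  by move=> h; apply: h => -[].
have mc := @measurable_fund_cube R n; have mc' := @measurable_fund_cube R n.+1.
pose A1 : set (measurableTypeR R) := ~` `[0, 1[%classic.
have mA1 : measurable A1 by apply: measurableC.
rewrite /= /distribution /pushforward.
apply: (@subset_measure0 _ _ _ (U01 \x leb n)%E _ ((A1 `*` setT) `|` (setT `*` ~` fund_cube))).
- by rewrite -[X in measurable X]setTI; apply: measurable_cons_row => //; exact: measurableC.
- apply: measurableU; apply: measurableX => //; exact: measurableC.
- move=> [z x] /= h; have [zA|zA] := pselect (A1 z); first by left.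
  right; split => // cx; apply: h => i; rewrite mxE; case: (unliftP ord0 i) => [j _|_] /=; first exact: cx.
  by move: zA; rewrite /A1 /= in_itv/= => /contrapT.
- apply/eqP; rewrite -measure_le0; apply: (le_trans (measureU2 _ _ _)).
  + exact: measurableX.
  + by apply: measurableX => //; exact: measurableC.
  apply: (@le_trans _ _ (U01 A1 * leb n setT + U01 setT * leb n (~` fund_cube))%E).
    by apply: leeD; rewrite -product_measure1E//; exact: measurableC.
  by rewrite uniform_lt1 mul0e ih mule0 adde0.
Qed.

Lemma torus_setT n : fine (leb n setT) = 1.
Proof. by rewrite [X in fine X](_ : _ = 1%E)//; exact: (probability_setT (leb n)). Qed.

Lemma ae_fund_cube n : {ae leb n, forall x, fund_cube x}.
Proof.
exists (~` fund_cube); split; [|exact: torus_measure_cube|by []].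
by apply: measurableC; exact: measurable_fund_cube.
Qed.

(** The image of Lebesgue measure under h -> y - t h, multiplied by [t], agrees with Lebesgue
    measure on half-open intervals, hence everywhere. *)
Lemma lebesgue_null_affine (A : set R) (y t : R) : 0 < t -> measurable A ->
  lebesgue_measure A = 0%E -> lebesgue_measure ((fun h => y - t * h) @^-1` A) = 0%E.
Proof.
move=> t0 mA A0.
have mh : measurable_fun setT (fun h : R => y - t * h).
  by apply: measurable_funB => //; exact: measurable_funM.
have [m mE] := @pushforward_measure_ex _ _ (measurableTypeR R) (measurableTypeR R) R _ mh lebesgue_measure.
have h := @lebesgue_measure_unique R (mscale (NngNum (ltW t0)) m).
pose phi (h : R) : R := y - t * h.
have : (t%:E * lebesgue_measure (phi @^-1` A) = 0)%E.
  rewrite -mE -[RHS]A0 h// => X [[a b] _ <-] /=.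
  rewrite /mscale/= mE.
  rewrite (_ : _ @^-1` _ = `[(y - b) / t, (y - a) / t[%classic); last first.
    apply/seteqP; split => x /=; rewrite !in_itv/= ler_pdivrMr// ltr_pdivlMr// mulrC => /andP[? ?];
      by apply/andP; split; lra.
  have e2 := @lebesgue_measure_itv R (Interval (BLeft ((y - b) / t)) (BLeft ((y - a) / t))).
  rewrite /= lte_fin ltr_pM2r ?invr_gt0// in e2.
  rewrite (_ : (y - b < y - a) = (a < b)) in e2; last by apply/idP/idP; lra.
  rewrite lebesgue_measure_itv/= lte_fin.
  apply: etrans; last exact: (congr1 (fun z => t%:E * z)%E (esym e2)).
  case: ifPn => _; last by rewrite mule0.
  by rewrite -!EFinB -EFinM; congr EFin; field; rewrite gt_eqF.
by move/eqP; rewrite mule_eq0 => /orP[|/eqP//]; rewrite eqe gt_eqF.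
Qed.

Lemma uniform_probE (A : set R) : measurable A -> U01 A = lebesgue_measure (A `&` `[0, 1]%classic).
Proof.
move=> mA; rewrite /uniform_prob integral_uniform_pdf.
rewrite (eq_integral (cst 1%:E)); last first.
  move=> t /set_mem[_ /=]; rewrite in_itv/= /uniform_pdf => ->.
  by rewrite subr0 invr1.
by rewrite integral_cst ?mul1e//; exact: measurableI.
Qed.

(** Where the integer part equals m, the map is affine; the preimage is therefore covered by
    countably many affine preimages of a null set. *)
Lemma uniform_null_frac (A : set R) (y t : R) : 0 < t -> measurable A ->
  U01 A = 0%E -> U01 ((fun h => (y - t * h) - (Num.floor (y - t * h))%:~R) @^-1` A) = 0%E.
Proof.
move=> t0 mA; rewrite uniform_probE// => A0.
pose A' := A `&` `[0, 1]%classic.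
have mA' : measurable A' by exact: measurableI.
have mh : measurable_fun setT (fun h : R => y - t * h).
  by apply: measurable_funB => //; exact: measurable_funM.
have mf : measurable_fun setT (fun h : R => (y - t * h) - (Num.floor (y - t * h))%:~R).
  by apply: measurable_funB => //; exact: (measurableT_comp (@measurable_floor R) mh).
set P := _ @^-1` A.
have mP : measurable P by rewrite -[X in measurable X]setTI; exact: mf.
have P0 : lebesgue_measure P = 0%E.
  apply/negligibleP => //.
  have : {ae lebesgue_measure, forall h : R, forall m : int, ~ A' ((y - m%:~R) - t * h)}.
    apply: ae_countable => m; exists ((fun h => (y - m%:~R) - t * h) @^-1` A'); split.
    - rewrite -[X in measurable X]setTI.
      have mh' : measurable_fun setT (fun h : R => (y - m%:~R) - t * h).
        by apply: measurable_funB => //; exact: measurable_funM.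
      exact: mh'.
    - exact: lebesgue_null_affine.
    - by move=> h /= /contrapT.
  apply: negligibleS => h Ph /= /(_ (Num.floor (y - t * h))); apply.
  rewrite (_ : y - _ - t * h = (y - t * h) - (Num.floor (y - t * h))%:~R); last by ring.
  split => //=; rewrite in_itv/=; have /andP[h1 h2] := floor_itv (y - t * h).
  by rewrite subr_ge0 h1/= lerBlDl; move: h2; rewrite intrD => /ltW.
rewrite uniform_probE//; apply: (@subset_measure0 _ _ _ lebesgue_measure _ P) => //.
exact: measurableI.
Qed.

(* The image of the uniform law under [h |-> y - t h] mod 1 is absolutely
   continuous; the dimension is peeled off one coordinate at a time. *)
Lemma torus_null_frac n (A : set 'rV[R]_n) (y : 'rV[R]_n) (t : R) : 0 < t ->
  measurable A -> leb n A = 0%E -> leb n ((fun h => fracr (y - t *: h)) @^-1` A) = 0%E.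
Proof.
move=> t0; elim: n A y => [|n ih] A y mA A0.
  rewrite (_ : _ @^-1` _ = A)//; apply/seteqP; split => x /=;
    by rewrite (_ : fracr _ = x)//; apply/rowP => -[].
have mc := @measurable_cons_row R n.
pose B := @cons_row R n @^-1` A.
have mB : measurable B by rewrite -[X in measurable X]setTI; exact: mc.
have B0 : (U01 \x leb n)%E B = 0%E by [].
(* The first coordinates whose slice is not null form a null set, by Fubini; the one-dimensional
   case handles this set, and the induction hypothesis handles the other slices. *)
pose N := [set z | leb n (xsection B z) != 0%E].
have msec : measurable_fun setT (fun z => leb n (xsection B z)).
  exact: measurable_fun_xsection.
have mN : measurable N.
  have := emeasurable_neq measurableT msec 0%E; by rewrite setTI.
have N0 : U01 N = 0%E.
  have h : (\int[U01]_z `|leb n (xsection B z)| = 0)%E.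
    by rewrite -[RHS]B0; apply: eq_integral => z _; rewrite gee0_abs.
  have := (ae_eq_integral_abs U01 measurableT msec).1 h.
  move=> [M [mM M0 NM]]; apply: (@subset_measure0 _ _ _ U01 _ M) => //.
  by move=> z /= Nz; apply: NM => /= /(_ I); exact/eqP.
pose y0 := y 0 0; pose y' : 'rV[R]_n := \row_j y 0 (lift ord0 j).
pose fr (x : R) := x - (Num.floor x)%:~R.
have fE z x : fracr (y - t *: cons_row (z, x)) = cons_row (fr (y0 - t * z), fracr (y' - t *: x)).
  apply/rowP => i; rewrite !mxE; case: (unliftP ord0 i) => [j ->|->] /=.
    by rewrite !mxE.
  by [].
set P := _ @^-1` A.
have mP : measurable P.
  rewrite -[X in measurable X]setTI; apply: (measurableT_comp (@measurable_fracr R _)) => //.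
  rewrite (_ : (fun h : 'rV[R]_n.+1 => _) = fun h : 'rV[R]_n.+1 => cst y h + cst (- t) h *: id h).
    apply: measurable_rowD => //.
    by apply: measurable_rowZ => //; exact: measurable_id.
  by apply/funext => h; rewrite scaleNr.
rewrite /= /distribution /pushforward.
have mP' : measurable (@cons_row R n @^-1` P) by rewrite -[X in measurable X]setTI; exact: mc.
have N'0 := uniform_null_frac y0 t0 mN N0.
set N' := _ @^-1` N in N'0.
have mN' : measurable N'.
  rewrite -[X in measurable X]setTI.
  have mh : measurable_fun setT (fun h : R => y0 - t * h).
    by apply: measurable_funB => //; exact: measurable_funM.
  have mf : measurable_fun setT (fun h : R => (y0 - t * h) - (Num.floor (y0 - t * h))%:~R).
    by apply: measurable_funB => //; exact: (measurableT_comp (@measurable_floor R) mh).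
  exact: mf.
suff E0 : (\int[U01]_z `|leb n (xsection (@cons_row R n @^-1` P) z)| = 0)%E.
  by rewrite -[RHS]E0; apply: eq_integral => z _; rewrite gee0_abs.
apply/(ae_eq_integral_abs U01 measurableT).
  exact: measurable_fun_xsection.
exists N'; split => // z /= hz.
apply: contrapT => nN'; apply: hz => _.
have nN : leb n (xsection B (fr (y0 - t * z))) = 0%E.
  by apply: contrapT => h; apply: nN'; apply/eqP.
have := ih _ y' (measurable_xsection _ mB) nN.
congr (leb n _ = _); apply/seteqP; split => x; rewrite /xsection /= !inE /B /P /=; by rewrite fE.
Qed.

End TorusMeasureFacts.

(** * Primitives of curl-free measures *)

Lemma ae_integrable_eq (dT : measure_display) (T : measurableType dT) (R : realType)
    (mu : {measure set T -> \bar R}) (f g : T -> R) :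
  mu.-integrable setT (EFin \o f) -> measurable_fun setT g ->
  {ae mu, forall x, g x = f x} -> mu.-integrable setT (EFin \o g).
Proof.
move=> /integrableP[mf fi] mg gf; apply/integrableP; split; first exact/measurable_EFinP.
apply: le_lt_trans fi; rewrite le_eqVlt; apply/orP; left; apply/eqP.
apply: ae_eq_integral => //.
- by apply: measurableT_comp => //; exact/measurable_EFinP.
- exact: measurableT_comp.
- by apply: filterS gf => x /= -> _.
Qed.

Section ProductIntegral.
Context {d1 d2 : measure_display} {T1 : measurableType d1} {T2 : measurableType d2} {R : realType}.
Variables (m1 : {finite_measure set T1 -> \bar R}) (m2 : {finite_measure set T2 -> \bar R}).

Lemma bmeas_fst (f : T1 -> R) : bmeas f -> bmeas (fun z : T1 * T2 => f z.1).
Proof.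
move=> [mf [C fC]]; split; last by exists C => z; exact: fC.
exact: (measurableT_comp mf measurable_fst).
Qed.

Lemma bmeas_snd (g : T2 -> R) : bmeas g -> bmeas (fun z : T1 * T2 => g z.2).
Proof.
move=> [mf [C fC]]; split; last by exists C => z; exact: fC.
exact: (measurableT_comp mf measurable_snd).
Qed.

Lemma Rintegral_prod (f : T1 -> R) (g : T2 -> R) : bmeas f -> bmeas g ->
  \int[(m1 \x m2)%E]_z (f z.1 * g z.2) = (\int[m1]_x f x) * (\int[m2]_y g y).
Proof.
move=> bf bg; rewrite Rfubini1; last by apply: bmeasM; [exact: bmeas_fst|exact: bmeas_snd].
rewrite -RintegralZr//; last exact: bmeas_integrable.
by apply: eq_Rintegral => x _ /=; rewrite RintegralZl//; exact: bmeas_integrable.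
Qed.

End ProductIntegral.

Section PushedCharge.
Context {dT : measure_display} {T : measurableType dT}
  {dO : measure_display} {O : measurableType dO} {R : realType}.

Lemma pint_indic (th : {measure set O -> \bar R}) (X : O -> T) (Q : O -> R) (A : set T) :
  pint th X Q (\1_A) = \int[th]_(w in X @^-1` A) Q w.
Proof.
rewrite [RHS]Rintegral_mkcond; apply: eq_Rintegral => w _.
have -> : \1_A (X w) = (w \in X @^-1` A)%:R :> R.
  by rewrite indicE; congr (_%:R); apply/idP/idP => /set_mem h; exact/mem_set.
by rewrite patchE; case: ifP => _; rewrite ?mul1r ?mul0r.
Qed.

Lemma pint_charge (th : {measure set O -> \bar R}) (X : O -> T) (Q : O -> R) :
  measurable_fun setT X -> th.-integrable setT (EFin \o Q) ->
  exists nu : {charge set T -> \bar R},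
    forall A, measurable A -> nu A = (pint th X Q (\1_A))%:E.
Proof.
move=> mX iQ; have [m mE] := pushforward_charge_ex mX (induced_charge iQ).
exists m => A mA; rewrite mE /induced_charge pint_indic /Rintegral fineK//.
have mXA : measurable (X @^-1` A) by rewrite -[X in measurable X]setTI; exact: mX.
by apply: integrable_fin_num => //; exact: (integrableS measurableT mXA (@subsetT _ _) iQ).
Qed.

Lemma pint_density (th : {measure set O -> \bar R}) (X : O -> T) (Q : O -> R)
    (m : {sigma_finite_measure set T -> \bar R}) :
  measurable_fun setT X -> th.-integrable setT (EFin \o Q) ->
  (forall A, measurable A -> m A = 0%E -> pint th X Q (\1_A) = 0) ->
  exists v : T -> R, m.-integrable setT (EFin \o v) /\
    forall a, bmeas a -> pint th X Q a = pint m id v a.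
Proof.
move=> mX iQ ac; have [nu nuE] := pint_charge mX iQ.
have num : nu `<< m.
  apply/null_content_dominatesP => A mA A0.
  by rewrite nuE// ac.
pose v x := fine (Radon_Nikodym nu m x).
have vE x : (v x)%:E = Radon_Nikodym nu m x by rewrite fineK// Radon_Nikodym_fin_num.
have iv : m.-integrable setT (EFin \o v).
  have := Radon_Nikodym_integrable num; apply: eq_integrable => // x _ /=.
  by rewrite vE.
exists v; split => //; apply: bcf_indic_eq.
- exact: bcf_pint.
- by apply: bcf_pint => //; exact: measurable_id.
move=> A mA; apply: EFin_inj; transitivity (nu A); first by rewrite nuE.
rewrite (Radon_Nikodym_integral num mA).
have -> : pint m id v (\1_A) = \int[m]_(x in A) v x.
  rewrite [RHS]Rintegral_mkcond; apply: eq_Rintegral => x _.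
  by rewrite patchE indicE; case: ifP => _; rewrite ?mul1r ?mul0r.
rewrite /Rintegral fineK.
  by apply: eq_integral => x _; rewrite vE.
by apply: integrable_fin_num => //; apply: integrableS iv.
Qed.

End PushedCharge.

Section CubeCarried.
Context {R : realType} {d : nat}.
Local Notation leb := (torus_measure R d).
Implicit Types (mu : @vmeasure _ 'rV[R]_d R d).

Definition carried mu := forall i A, measurable A -> A `&` fund_cube = set0 -> mu i A = 0%E.

Lemma tvar_carried mu : carried mu -> tvar mu (~` fund_cube) = 0%E.
Proof.
move=> h; apply/eqP; rewrite eq_le tvar_ge0 andbT; apply: ge_ereal_sup.
move=> _ [m [P [mP tP PA ->]]]; rewrite big1// => k _.
rewrite (_ : vval mu (P k) = 0) ?enorm0//; apply/rowP => i; rewrite !mxE h//.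
by rewrite -subset0 => x [/PA].
Qed.

Lemma ae_tvar_cube mu : carried mu -> {ae tvar mu, forall x, fund_cube x}.
Proof.
move=> h; exists (~` fund_cube); split; [|exact: tvar_carried|by []].
by apply: measurableC; exact: measurable_fund_cube.
Qed.

Lemma pint_cube_carried (th : {measure set 'rV[R]_d -> \bar R}) (Q : 'rV[R]_d -> R) :
  measurable_fun setT Q -> {ae th, forall x, fund_cube x} -> cube_carried (pint th id Q).
Proof.
move=> mQ ae a b [ma _] [mb _] ab; apply: ae_Rintegral_eq.
- exact: measurable_funM.
- exact: measurable_funM.
by move: ae; apply: filterS => x cx; rewrite ab.
Qed.

End CubeCarried.

Section TrigGradient.
Context {R : realType} {d : nat}.
Local Notation leb := (torus_measure R d).

(* The definition of the distributional gradient tested on the characters only. *)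
Definition trig_gradient (v : 'rV[R]_d -> R) (mu : @vmeasure _ 'rV[R]_d R d) :=
  forall i (k : 'rV[int]_d) t, pint leb id v (fun x => 2 * pi * (k 0 i)%:~R * trig k (t + pi / 2) x) =
    - cint mu i (trig k t).

End TrigGradient.

Section Primitive.
Context {R : realType} {d : nat}.
Local Notation leb := (torus_measure R d).
Local Notation U01 := (uniform_prob (@ltr01 R)).
Variable mu : @vmeasure _ 'rV[R]_d R d.
Local Notation M i k t := (cint mu i (trig k t)).
Hypothesis curl : forall i j (k : 'rV[int]_d) t, (k 0 i)%:~R * M j k t = (k 0 j)%:~R * M i k t.
Hypothesis zero : forall i t, M i 0 t = 0.

Definition direction_prob : probability ('rV[R]_d * measurableTypeR R)%type R := (leb \x U01)%E.

Local Notation P := direction_prob.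

(* On the torus, [div N = delta_0 - 1] is solved by the vector field [N] that
   transports the Dirac mass along the segments [t -> - t h] to the uniform
   law of [h]; convolving it with [mu] gives a primitive of [mu]. *)
Let O := ('rV[R]_d * ('rV[R]_d * measurableTypeR R))%type.
Let X (w : O) : 'rV[R]_d := fracr (w.1 - w.2.2 *: fracr w.2.1).
Let Q (j : 'I_d) (w : O) : R := dir mu w.1 0 j * fracr w.2.1 0 j.
Let th := (tvar mu \x P)%E.

Let bfrac j : bmeas (fun p : 'rV[R]_d * measurableTypeR R => fracr p.1 0 j).
Proof.
apply: (bmeas_fst (f := fun h : 'rV[R]_d => fracr h 0 j)); split.
  by apply: measurable_rowP; exact: measurable_fracr.
exists 1 => h; have /andP[h0 h1] := fracr_cube h j.
by rewrite ger0_norm// ltW.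
Qed.

Let mX : measurable_fun setT X.
Proof.
apply: (measurableT_comp (@measurable_fracr R d)).
rewrite (_ : (fun w : O => _) = fun w : O => w.1 + (- w.2.2) *: fracr w.2.1); last first.
  by apply/funext => w; rewrite scaleNr.
apply: measurable_rowD; first exact: measurable_fst.
apply: measurable_rowZ.
  apply: (measurable_funN (f := fun w : O => w.2.2)).
  by apply: measurableT_comp; [exact: measurable_snd|exact: measurable_snd].
apply: (measurableT_comp (@measurable_fracr R d)).
by apply: measurableT_comp; [exact: measurable_fst|exact: measurable_snd].
Qed.

Let bQ j : bmeas (Q j).
Proof.
apply: bmeasM; first exact: (bmeas_fst (bmeas_dir_coord mu j)).
exact: (bmeas_snd (bfrac j)).
Qed.

Let iQ j : th.-integrable setT (EFin \o Q j).
Proof. exact: bmeas_integrable_prod. Qed.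

Let K j := pint th X (Q j).

(** For fixed [y] and t > 0 the preimage of a null set under h -> y - t h mod 1 is null, and the
    times t <= 0 are negligible. The convolution thus has a density. *)
Let K_ac j A : measurable A -> leb A = 0%E -> K j (\1_A) = 0.
Proof.
move=> mA A0; rewrite /K /pint.
have bA : bmeas (fun w : O => \1_A (X w) * Q j w).
  apply: bmeasM => //; split; first exact: (measurableT_comp (measurable_indic mA) mX).
  by exists 1 => w; rewrite indicE; case: (_ \in _); rewrite ?normr1 ?normr0.
rewrite (Rfubini1 _ _ bA).
transitivity (\int[tvar mu]_y (cst 0 y : R)); last by rewrite Rintegral_cst// mul0r.
apply: eq_Rintegral => y _.
have by_ := bmeas_section1 bA y.
rewrite (@Rfubini2 _ _ _ _ _ leb U01 _ by_).
transitivity (\int[U01]_y (cst 0 y : R)); last by rewrite Rintegral_cst// mul0r.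
apply: ae_Rintegral_eq => //; first exact: (@bmeas_fubini2 _ _ _ _ _ leb U01 _ by_).1.
exists `]-oo, 0]%classic; split => //.
  apply: (etrans (uniform_probE (measurable_itv _))).
  rewrite (_ : _ `&` _ = [set 0]) ?lebesgue_measure_set1//.
  apply/seteqP; split => x /=; rewrite !in_itv/=.
    by move=> [x0 /andP[x0' _]]; apply/le_anti; rewrite x0.
  by move=> ->; rewrite lexx ler01.
move=> t /= nt; rewrite in_itv/= leNgt; apply/negP => t0; apply: nt.
transitivity (\int[leb]_y (cst 0 y : R)); last by rewrite Rintegral_cst// mul0r.
apply: ae_Rintegral_eq => //; first exact: (bmeas_section2 by_ t).1.
have A0' : {ae leb, forall h, ~ A (fracr (y - t *: h))}.
  exists ((fun h => fracr (y - t *: h)) @^-1` A); split.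
  - rewrite -[X in measurable X]setTI.
    have mf : measurable_fun setT (fun h : 'rV[R]_d => fracr (y - t *: h)).
      apply: (measurableT_comp (@measurable_fracr R d)).
      rewrite (_ : (fun h => _) = fun h : 'rV[R]_d => y + (- t) *: h); last first.
        by apply/funext => w; rewrite scaleNr.
      by apply: measurable_rowD => //; apply: measurable_rowZ => //; exact: measurable_id.
    exact: mf.
  - exact: torus_null_frac.
  - by move=> h /= /contrapT.
apply: (@filterS2 _ _ _ _ _ _ _ A0' (@ae_fund_cube R d)) => h nA ch.
by rewrite /X/= (fracr_id ch) indicE memNset// mul0r.
Qed.

Let phase (k : 'rV[int]_d) (w : 'rV[R]_d * measurableTypeR R) : R :=
  2 * pi * dotz k (- (w.2 *: fracr w.1)).
Let C k j := \int[P]_w (cos (phase k w) * fracr w.1 0 j).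
Let S k j := \int[P]_w (sin (phase k w) * fracr w.1 0 j).

Let mphase k : measurable_fun setT (phase k).
Proof.
apply: measurable_funM => //; apply: (measurableT_comp (@measurable_dotz R d k)).
rewrite (_ : (fun w => _) = fun w : 'rV[R]_d * measurableTypeR R => (- w.2) *: fracr w.1); last first.
  by apply/funext => w; rewrite scaleNr.
apply: measurable_rowZ; first exact: measurable_funN measurable_snd.
exact: (measurableT_comp (@measurable_fracr R d) measurable_fst).
Qed.

Let bC k j : bmeas (fun w => cos (phase k w) * fracr w.1 0 j).
Proof.
apply: bmeasM (bfrac j); split; last by exists 1 => w; exact: cos_max.
exact: measurableT_comp (continuous_measurable_fun (@continuous_cos R)) (mphase k).
Qed.

Let bS k j : bmeas (fun w => sin (phase k w) * fracr w.1 0 j).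
Proof.
apply: bmeasM (bfrac j); split; last by exists 1 => w; exact: sin_max.
exact: measurableT_comp (continuous_measurable_fun (@continuous_sin R)) (mphase k).
Qed.

(** Convolution multiplies Fourier coefficients; [C] and [S] are the cosine and sine coefficients of
    the vector field. *)
Let K_trig j k eta : K j (trig k eta) = M j k eta * C k j + M j k (eta + pi / 2) * S k j.
Proof.
have bt e : bmeas (fun y => trig k e y * dir mu y 0 j).
  by apply: bmeasM; [exact: bmeas_trig|exact: bmeas_dir_coord].
rewrite /C /S /cint /pint -!(Rintegral_prod (tvar mu) P)//.
rewrite -RintegralD//.
- apply: eq_Rintegral => w _.
  rewrite /X periodic_fracr; last exact: trig_periodic.
  by rewrite trig_shift trig_rot /Q /phase; ring.
- by apply: (bmeas_integrable_prod (tvar mu) P); apply: bmeasM; [exact: (bmeas_fst (bt eta))|exact: (bmeas_snd (bC k j))].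
- by apply: (bmeas_integrable_prod (tvar mu) P); apply: bmeasM; [exact: (bmeas_fst (bt _))|exact: (bmeas_snd (bS k j))].
Qed.

Let sum_phase (g : R -> R) (k : 'rV[int]_d) w : \sum_j 2 * pi * (k 0 j)%:~R * (g (phase k w) * fracr w.1 0 j) =
  2 * pi * dotz k (fracr w.1) * g (phase k w).
Proof.
by rewrite /dotz mulr_sumr mulr_suml; apply: eq_bigr => j _; ring.
Qed.

Let phaseE (k : 'rV[int]_d) h t : phase k (h, t) = - (2 * pi * dotz k (fracr h)) * t + 0.
Proof. by rewrite /phase/= -scaleNr dotzZ; ring. Qed.

(** With [sum_S], the equation div N = delta_0 - 1 in Fourier coefficients. Along t -> - t h the
    integrand is a derivative in t, so only the end points remain: the Dirac mass at t = 0 and the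
    uniform law at t = 1. This is the part where the sine has zero mean. *)
Let sum_C (k : 'rV[int]_d) : \sum_j 2 * pi * (k 0 j)%:~R * C k j = 0.
Proof.
transitivity (\sum_j \int[P]_w (2 * pi * (k 0 j)%:~R * (cos (phase k w) * fracr w.1 0 j))).
  by apply: eq_bigr => j _; rewrite RintegralZl//; exact: bmeas_integrable.
rewrite -Rintegral_sum//; last by move=> j; apply: bmeas_integrable; exact: bmeasZ.
have bsum : bmeas (fun w => \sum_j 2 * pi * (k 0 j)%:~R * (cos (phase k w) * fracr w.1 0 j)).
  by apply: bmeas_sum => j; exact: bmeasZ.
rewrite (Rfubini1 leb U01 bsum).
transitivity (\int[leb]_x trig k (- (pi / 2)) x); last first.
  by rewrite Rintegral_trig cosN cos_pihalf mulr0.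
apply: eq_Rintegral => h _.
under eq_Rintegral do rewrite sum_phase/= phaseE.
rewrite RintegralZl//; last exact: (bmeas_integrable U01 (bmeas_cos_affine _ _)).
set s := 2 * pi * dotz k (fracr h).
have := Rintegral_cos_affine (- s) 0; rewrite addr0 sin0 subr0 sinN mulNr => /oppr_inj ->.
rewrite -[RHS](periodic_fracr h (trig_periodic k _)) /trig -/s.
by rewrite cosBpihalf.
Qed.

Let sum_S (k : 'rV[int]_d) : \sum_j 2 * pi * (k 0 j)%:~R * S k j = (k == 0)%:R - 1.
Proof.
transitivity (\sum_j \int[P]_w (2 * pi * (k 0 j)%:~R * (sin (phase k w) * fracr w.1 0 j))).
  by apply: eq_bigr => j _; rewrite RintegralZl//; exact: bmeas_integrable.
rewrite -Rintegral_sum//; last by move=> j; apply: bmeas_integrable; exact: bmeasZ.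
have bsum : bmeas (fun w => \sum_j 2 * pi * (k 0 j)%:~R * (sin (phase k w) * fracr w.1 0 j)).
  by apply: bmeas_sum => j; exact: bmeasZ.
rewrite (Rfubini1 leb U01 bsum).
transitivity (\int[leb]_x (trig k 0 x - 1)); last first.
  rewrite RintegralB//; [|exact: (bmeas_integrable leb (bmeas_trig _ _))|exact: (bmeas_integrable leb (bmeas_cst 1))].
  by rewrite Rintegral_trig cos0 mulr1 Rintegral_cst// torus_setT mulr1.
apply: eq_Rintegral => h _.
under eq_Rintegral do rewrite sum_phase/= phaseE.
rewrite RintegralZl//; last exact: (bmeas_integrable U01 (bmeas_sin_affine _ _)).
set s := 2 * pi * dotz k (fracr h).
have := Rintegral_sin_affine (- s) 0; rewrite addr0 cos0 cosN mulNr => e.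
rewrite -[trig _ _ _](periodic_fracr h (trig_periodic k _)) /trig -/s addr0.
by rewrite -(opprB 1) -e opprK.
Qed.

(** The curl condition exchanges k_i M_j for k_j M_i; the coefficient M_i then factors out of the
    sum and leaves the divergence of the field. At k = 0, where the divergence has zero mean, so has
    [mu]. *)
Let sum_K i (k : 'rV[int]_d) eta : 2 * pi * (k 0 i)%:~R * \sum_j K j (trig k eta) = - M i k (eta + pi / 2).
Proof.
transitivity (M i k eta * (\sum_j 2 * pi * (k 0 j)%:~R * C k j) +
    M i k (eta + pi / 2) * (\sum_j 2 * pi * (k 0 j)%:~R * S k j)).
  rewrite !mulr_sumr -big_split/=; apply: eq_bigr => j _; rewrite K_trig.
  transitivity (2 * pi * C k j * ((k 0 i)%:~R * M j k eta) +
     2 * pi * S k j * ((k 0 i)%:~R * M j k (eta + pi / 2))); first by ring.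
  by rewrite (curl i j k eta) (curl i j k (eta + pi / 2)); ring.
rewrite sum_C sum_S mulr0 add0r; have [->|k0] := eqVneq k 0; last by rewrite /= sub0r mulrN1.
by rewrite zero; ring.
Qed.

Theorem primitive_ex : exists v, L1torus v /\ trig_gradient v mu.
Proof.
have /boolp.choice[V VP] j : exists v : 'rV[R]_d -> R, leb.-integrable setT (EFin \o v) /\
    forall a, bmeas a -> K j a = pint leb id v a.
  by apply: pint_density => // A mA A0; exact: K_ac.
(* Composition with [fracr] makes [v] periodic and changes nothing on the cube. The sign comes from
   [sum_K] at phase t + pi / 2, where the right-hand side is - M i k (t + pi) = M i k t. *)
pose v x := - \sum_j V j (fracr x).
have iV : leb.-integrable setT (EFin \o (fun x => \sum_j V j x)).
  by apply: integrable_sumr => // j; exact: (VP j).1.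
have vE : {ae leb, forall x, v x = - \sum_j V j x}.
  by move: (@ae_fund_cube R d); apply: filterS => x cx; rewrite /v fracr_id.
have mv : measurable_fun setT v.
  apply: measurable_funN; apply: measurable_sum => j.
  apply: measurableT_comp (@measurable_fracr R d).
  by apply/measurable_EFinP; exact: measurable_int (VP j).1.
have iN : leb.-integrable setT (EFin \o (fun x => - \sum_j V j x)).
  by have := integrableN iV; apply: eq_integrable.
exists v; split; first split.
- by move=> k x; rewrite /v fracr_periodic.
- exact: ae_integrable_eq iN mv vE.
move=> i k t.
transitivity (pint leb id (fun x => - \sum_j V j x)
    (fun x => 2 * pi * (k 0 i)%:~R * trig k (t + pi / 2) x)).
  apply: ae_Rintegral_eq.
  - apply: measurable_funM => //; exact: (bmeasZ _ (bmeas_trig _ _)).1.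
  - apply: measurable_funM; first exact: (bmeasZ _ (bmeas_trig _ _)).1.
    by apply/measurable_EFinP; exact: measurable_int iN.
  by move: vE; apply: filterS => x ->.
have biN := bcf_pint (@measurable_id _ _ setT) iN.
rewrite (bcfZ biN); last exact: bmeas_trig.
have -> : pint leb id (fun x => - \sum_j V j x) (trig k (t + pi / 2)) = - \sum_j K j (trig k (t + pi / 2)).
  transitivity (\int[leb]_x (- 1 * \sum_j (trig k (t + pi / 2) x * V j x))).
    by apply: eq_Rintegral => x _; rewrite mulN1r -mulr_sumr mulrN.
  have iVj j := pint_integrable (@measurable_id _ _ setT) (VP j).1 (bmeas_trig k (t + pi / 2)).
  rewrite RintegralZl//; last by apply: integrable_sumr.
  rewrite mulN1r Rintegral_sum//; congr (- _); apply: eq_bigr => j _.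
  by rewrite (VP j).2//; exact: bmeas_trig.
rewrite mulrN sum_K opprK.
rewrite (_ : t + pi / 2 + pi / 2 = t + pi); last by field.
rewrite (bcf_trig_rot k t pi (bcf_cint mu i)) cospi sinpi mul0r addr0 mulN1r.
by [].
Qed.

End Primitive.

Section CinfFacts.
Context {R : realType} {d : nat}.
Local Notation leb := (torus_measure R d).
Implicit Types (phi : Cinf R d).

Lemma bmeas_periodic (f : 'rV[R]_d -> R) : periodic f -> continuous f -> bmeas f.
Proof.
move=> pf cf; split; first exact: (measurable_comp_continuous cf (@measurable_id _ _ setT)).
have [C hC] := continuous_bounded_box cf; exists C => x.
rewrite -(periodic_fracr x pf); apply: hC => i; have /andP[h1 h2] := fracr_cube x i.
by rewrite h1 ltW.
Qed.

Lemma periodic_partial phi s : periodic (partial (@ebase R d) s phi).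
Proof.
elim: s => [|i s ih]; first exact: Cinf_periodic.
move=> k x; pose g : 'rV[R]_d -> R^o := partial (@ebase R d) s phi.
change ('D_(ebase i) g (x + map_mx intr k) = 'D_(ebase i) g x).
have E : (fun h : R => h^-1 *: (g (h *: ebase i + (x + map_mx intr k)) - g (x + map_mx intr k))) =
         (fun h : R => h^-1 *: (g (h *: ebase i + x) - g x)).
  by apply/funext => h; rewrite addrA /g !ih.
by rewrite /derive E.
Qed.

Lemma Cinf_continuous phi : continuous (phi : 'rV[R]_d -> R).
Proof. exact: (Cinf_smooth phi [::]).1. Qed.

Lemma bmeas_Cinf phi : bmeas (phi : 'rV[R]_d -> R).
Proof. by apply: bmeas_periodic; [exact: Cinf_periodic|exact: Cinf_continuous]. Qed.

Lemma bmeas_derive phi i : bmeas (fun x => 'D_(ebase i) (phi : 'rV[R]_d -> R^o) x : R).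
Proof.
apply: bmeas_periodic; first exact: (periodic_partial phi [:: i]).
exact: (Cinf_smooth phi [:: i]).1.
Qed.

Lemma is_derive_line phi i x s : is_derive (s : R) 1 (fun t : R => phi (x + t *: ebase i) : R^o)
  ('D_(ebase i) (phi : 'rV[R]_d -> R^o) (x + s *: ebase i)).
Proof.
have df : derivable (phi : 'rV[R]_d -> R^o) (x + s *: ebase i) (ebase i).
  exact: (Cinf_smooth phi [::]).2.
pose g (t : R) : R^o := phi (x + t *: ebase i).
have E : (fun h : R => h^-1 *: ((phi : 'rV[R]_d -> R^o) (h *: ebase i + (x + s *: ebase i)) - phi (x + s *: ebase i))) =
         (fun h : R => h^-1 *: (g (h *: 1 + s) - g s)).
  apply/funext => h; rewrite /g; congr (_ *: (phi _ - _)).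
  by rewrite scalerDl [h *: 1]mulr1 addrCA.
by split; [rewrite /derivable -E|rewrite /derive -E].
Qed.

Lemma line_quotient_le phi i (C : R) x s :
  (forall y, `|'D_(ebase i) (phi : 'rV[R]_d -> R^o) y| <= C) ->
  0 < s -> `|s^-1 * (phi (x + s *: ebase i) - phi x)| <= C.
Proof.
move=> hC s0; pose g (t : R) : R := phi (x + t *: ebase i).
have [||c _ e] := @MVT _ g (fun t => 'D_(ebase i) (phi : 'rV[R]_d -> R^o) (x + t *: ebase i)) _ _ s0.
- by move=> t _; exact: is_derive_line.
- apply: continuous_subspaceT => t; apply: differentiable_continuous.
  by apply/derivable1_diffP; have [] := is_derive_line phi i x t.
rewrite /g scale0r addr0 subr0 in e.
by rewrite e mulrC mulfK// gt_eqF.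
Qed.

Lemma cvg_line_quotient phi i x :
  n.+1%:R * (phi (x + n.+1%:R^-1 *: ebase i) - phi x) @[n --> \oo] -->
  ('D_(ebase i) (phi : 'rV[R]_d -> R^o) x : R).
Proof.
have df : derivable (phi : 'rV[R]_d -> R^o) x (ebase i).
  exact: (Cinf_smooth phi [::]).2.
have h0 : (n.+1%:R^-1 : R) @[n --> \oo] --> 0^'.
  move=> A [e /= e0 eA]; have /cvgrPdist_lt/(_ e e0) := @cvg_harmonic R.
  apply: filterS => n; rewrite /harmonic/= => hn.
  by apply: (eA _ hn); rewrite invr_eq0 pnatr_eq0.
rewrite (_ : (fun n => _) = (fun h : R => h^-1 *: ((phi : 'rV[R]_d -> R^o) (h *: ebase i + x) - phi x))
    \o (fun n => n.+1%:R^-1)).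
  exact: (cvg_comp _ _ h0 df).
by apply/funext => n; rewrite [RHS]/= invrK [_ *: ebase i + x]addrC.
Qed.

End CinfFacts.

(** * From characters to smooth test functions *)

Section GradientTrig.
Context {R : realType} {d : nat}.
Local Notation leb := (torus_measure R d).
Local Notation U01 := (uniform_prob (@ltr01 R)).
Variables (v : 'rV[R]_d -> R) (mu : @vmeasure _ 'rV[R]_d R d).
Hypothesis hv : L1torus v.

Lemma bcf_L1 : bcf (pint leb id v).
Proof. by apply: bcf_pint; [exact: measurable_id|exact: hv.2]. Qed.

Lemma is_gradientE : is_gradient v mu <-> carried mu /\ forall (phi : Cinf R d) i,
  pint leb id v ('D_(ebase i) (phi : 'rV[R]_d -> R^o)) = - cint mu i phi.
Proof.
have e1 (phi : Cinf R d) i : (\int[leb]_x (v x * 'D_(ebase i) (phi : 'rV[R]_d -> R^o) x)%:E)%E =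
    (pint leb id v ('D_(ebase i) (phi : 'rV[R]_d -> R^o)))%:E.
  rewrite /pint /Rintegral fineK; last first.
    by apply: integrable_fin_num => //; exact: (pint_integrable (@measurable_id _ _ setT) hv.2 (bmeas_derive phi i)).
  by apply: eq_integral => x _; rewrite mulrC.
have e2 (phi : Cinf R d) i : (\int[tvar mu]_x (phi x * polar mu x 0 i)%:E)%E = (cint mu i phi)%:E.
  rewrite cint_polar; last exact: (bmeas_Cinf phi).1.
  rewrite /Rintegral fineK//; apply: integrable_fin_num => //.
  exact: (pint_integrable (@measurable_id _ _ setT) (polar_integrable mu i) (bmeas_Cinf phi)).
split=> [[h1 h2]|[h1 h2]]; split => // phi i.
  by apply: EFin_inj; rewrite -e1 h2 e2.
by rewrite e1 e2 h2.
Qed.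

Lemma gradient_trig : is_gradient v mu -> trig_gradient v mu.
Proof.
move=> /is_gradientE[_ h] i k t; have := h (trigC k t) i => <-.
congr pint; apply/funext => x.
by have dk := is_derive_trig k t i x; rewrite (@derive_val _ _ _ _ _ _ _ dk).
Qed.

Hypotheses (cmu : carried mu) (tg : trig_gradient v mu).

Let V k t := pint leb id v (trig k t).
Let O := ('rV[R]_d * measurableTypeR R)%type.
Let th := (tvar mu \x U01)%E.

Let mline (s : R) i : measurable_fun setT (fun x : 'rV[R]_d => fracr (x + s *: ebase i)).
Proof.
apply: (measurableT_comp (@measurable_fracr R d)).
by apply: measurable_rowD => //; exact: measurable_id.
Qed.

Let mseg (s : R) i : measurable_fun setT (fun w : O => fracr (w.1 + (w.2 * s) *: ebase i)).
Proof.
apply: (measurableT_comp (@measurable_fracr R d)).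
apply: measurable_rowD; first exact: measurable_fst.
by apply: measurable_rowZ => //; apply: measurable_funM => //; exact: measurable_snd.
Qed.

Let bdir i : bmeas (fun w : O => dir mu w.1 0 i).
Proof. exact: (bmeas_fst (bmeas_dir_coord mu i)). Qed.

Let idir i : th.-integrable setT (EFin \o (fun w : O => dir mu w.1 0 i)).
Proof. exact: (bmeas_integrable_prod (tvar mu) U01 (bdir i)). Qed.

(** The gradient identity integrated over a step [s] along the axis [i]. The test function [a]
    enters without any derivative, so this functional is continuous under bounded convergence and is
    determined by its values on characters. *)
Let defect (s : R) i (a : 'rV[R]_d -> R) : R :=
  (1 * (1 * pint leb (fun x => fracr (x + s *: ebase i)) v a + (- 1) * pint leb (@fracr R d) v a)) +
  s * pint th (fun w : O => fracr (w.1 + (w.2 * s) *: ebase i)) (fun w => dir mu w.1 0 i) a.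

Let bcf_defect s i : bcf (defect s i).
Proof.
apply: bcf_lin; last by apply: bcf_pint; [exact: mseg|exact: idir].
apply: bcf_lin; apply: bcf_pint; try exact: hv.2.
  exact: mline.
exact: measurable_fracr.
Qed.

Let defect_cube s i : cube_carried (defect s i).
Proof.
move=> a b _ _ ab; rewrite /defect /pint; congr (_ * (_ * _ + _ * _) + _ * _);
  by apply: eq_Rintegral => x _; rewrite ab//; exact: fracr_cube.
Qed.

Let VD k t u : V k (t + u) = cos u * V k t + sin u * V k (t + pi / 2).
Proof. exact: (bcf_trig_rot k t u bcf_L1). Qed.

Let cintV i k t : cint mu i (trig k t) = - (2 * pi * (k 0 i)%:~R * V k (t + pi / 2)).
Proof. by rewrite -[LHS]opprK -tg (bcfZ bcf_L1)//; exact: bmeas_trig. Qed.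

Let defect_trig s i k t : defect s i (trig k t) = 0.
Proof.
pose c : R := 2 * pi * (k 0 i)%:~R.
have shiftE u x : trig k t (fracr (x + u *: ebase i)) = trig k (t + u * c) x.
  rewrite periodic_fracr; last exact: trig_periodic.
  by rewrite trig_shift dotzZ dotz_base; congr (trig k _ _); rewrite /c; ring.
have e1 : pint leb (fun x => fracr (x + s *: ebase i)) v (trig k t) = V k (t + s * c).
  by apply: eq_Rintegral => x _; rewrite shiftE.
have e2 : pint leb (@fracr R d) v (trig k t) = V k t.
  by apply: eq_Rintegral => x _; rewrite periodic_fracr//; exact: trig_periodic.
have bt e : bmeas (fun y => trig k e y * dir mu y 0 i).
  by apply: bmeasM; [exact: bmeas_trig|exact: bmeas_dir_coord].
have bc := @bmeas_cos_affine R (s * c) 0; have bs := @bmeas_sin_affine R (s * c) 0.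
have e3 : pint th (fun w : O => fracr (w.1 + (w.2 * s) *: ebase i)) (fun w => dir mu w.1 0 i) (trig k t) =
    cint mu i (trig k t) * (\int[U01]_z cos (s * c * z + 0)) +
    cint mu i (trig k (t + pi / 2)) * (\int[U01]_z sin (s * c * z + 0)).
  rewrite /cint /pint -!(Rintegral_prod (tvar mu) U01)//.
  rewrite -RintegralD//.
  - apply: eq_Rintegral => w _; rewrite shiftE trig_rot.
    have -> : w.2 * s * c = s * c * w.2 + 0 by ring.
    by ring.
  - by apply: (bmeas_integrable_prod (tvar mu) U01); apply: bmeasM; [exact: (bmeas_fst (bt t))|exact: (bmeas_snd bc)].
  - by apply: (bmeas_integrable_prod (tvar mu) U01); apply: bmeasM; [exact: (bmeas_fst (bt _))|exact: (bmeas_snd bs)].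
rewrite /defect e1 e2 e3 !cintV -/c.
have h1 := Rintegral_cos_affine (s * c) 0; have h2 := Rintegral_sin_affine (s * c) 0.
rewrite addr0 sin0 subr0 in h1; rewrite addr0 cos0 in h2.
set A := \int[_]_z cos _ in h1 *; set B := \int[_]_z sin _ in h2 *.
rewrite (_ : t + pi / 2 + pi / 2 = t + pi); last by field.
rewrite (VD k t (s * c)) (VD k t pi) cospi sinpi.
transitivity ((cos (s * c) - 1 + s * c * B) * V k t + (sin (s * c) - s * c * A) * V k (t + pi / 2)).
  by ring.
by rewrite h1 h2; ring.
Qed.

(** The defect vanishes on characters, hence on [phi]; dividing it by the step 1 / (n + 1) and
    letting n tend to infinity recovers the derivative of [phi]. *)
Lemma trig_gradient_gradient : is_gradient v mu.
Proof.
apply/is_gradientE; split => // phi i.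
have d0 s : defect s i phi = 0.
  exact: (bcf_trig_eq0 (bcf_defect s i) (@defect_cube s i) (defect_trig s i) (bmeas_Cinf phi)).
pose s n : R := n.+1%:R^-1.
pose qn n (x : 'rV[R]_d) : R := n.+1%:R * (phi (x + s n *: ebase i) - phi x).
pose bn n (w : O) : R := phi (w.1 + (w.2 * s n) *: ebase i).
have pf x : phi (fracr x) = phi x by apply: periodic_fracr; exact: Cinf_periodic.
have [mphi [C0 hC0]] := bmeas_Cinf phi.
have [mD [C1 hC1]] := bmeas_derive phi i.
have s0 n : s n > 0 by rewrite invr_gt0.
have sn n : n.+1%:R * s n = 1 by rewrite mulfV// pnatr_eq0.
have mshift n : measurable_fun setT (fun x : 'rV[R]_d => phi (x + s n *: ebase i)).
  rewrite (_ : (fun x => _) = phi \o (fun x : 'rV[R]_d => fracr (x + s n *: ebase i))); last first.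
    by apply/funext => x /=; rewrite pf.
  exact: (measurableT_comp mphi (mline (s n) i)).
have bshift n : bmeas (fun x : 'rV[R]_d => phi (x + s n *: ebase i)) by split => //; exists C0.
have bqn n : bmeas (qn n) by apply: bmeasZ; apply: bmeasB => //; exact: bmeas_Cinf.
have E n : pint leb id v (qn n) = - pint th id (fun w => dir mu w.1 0 i) (bn n).
  have := congr1 (fun z => n.+1%:R * z) (d0 (s n)); rewrite mulr0 /defect.
  have -> : pint leb (fun x => fracr (x + s n *: ebase i)) v phi = pint leb id v (fun x => phi (x + s n *: ebase i)).
    by apply: eq_Rintegral => x _; rewrite pf.
  have -> : pint leb (@fracr R d) v phi = pint leb id v phi.
    by apply: eq_Rintegral => x _; rewrite pf.
  have -> : pint th (fun w : O => fracr (w.1 + (w.2 * s n) *: ebase i)) (fun w => dir mu w.1 0 i) phi =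
     pint th id (fun w => dir mu w.1 0 i) (bn n).
    by apply: eq_Rintegral => x _; rewrite pf.
  rewrite mul1r mul1r mulN1r -(bcfB bcf_L1)//; last exact: bmeas_Cinf.
  rewrite mulrDr -(bcfZ bcf_L1); last by apply: bmeasB => //; exact: bmeas_Cinf.
  by rewrite mulrA sn mul1r => /eqP; rewrite addr_eq0 => /eqP.
have l1 : pint leb id v (qn n) @[n --> \oo] --> pint leb id v ('D_(ebase i) (phi : 'rV[R]_d -> R^o)).
  apply: (bcf_cvg bcf_L1 (C := C1)) => [n|n x|x].
  - exact: (bqn n).1.
  - rewrite /qn -[n.+1%:R]invrK; exact: line_quotient_le.
  - exact: cvg_line_quotient.
have l2 : pint th id (fun w => dir mu w.1 0 i) (bn n) @[n --> \oo] --> pint th id (fun w => dir mu w.1 0 i) (fun w => phi w.1).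
  have bT := bcf_pint (@measurable_id _ O setT) (idir i).
  apply: (bcf_cvg bT (C := C0)) => [n|n x|w].
  - rewrite (_ : bn n = phi \o (fun w : O => fracr (w.1 + (w.2 * s n) *: ebase i))); last first.
      by apply/funext => x /=; rewrite pf.
    exact: (measurableT_comp mphi (mseg (s n) i)).
  - exact: hC0.
  - have hw : w.1 + (w.2 * s n) *: ebase i @[n --> \oo] --> w.1.
      apply: cvg_row => j; rewrite -[X in _ --> X]addr0 -(mul0r (ebase i 0 j)) -(mulr0 w.2).
      under eq_fun do rewrite mxE [X in _ + X]mxE.
      apply: cvgD; first exact: cvg_cst.
      apply: cvgM; last exact: cvg_cst.
      by apply: cvgM; [exact: cvg_cst|exact: cvg_harmonic].
    exact: (continuous_cvg _ (Cinf_continuous (x := w.1)) hw).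
have l3 : pint leb id v (qn n) @[n --> \oo] --> - pint th id (fun w => dir mu w.1 0 i) (fun w => phi w.1).
  by under eq_fun do rewrite E; exact: cvgN.
rewrite (cvg_unique _ l1 l3)//; congr (- _).
have b1 : bmeas (fun y => phi y * dir mu y 0 i).
  by apply: bmeasM; [exact: bmeas_Cinf|exact: bmeas_dir_coord].
transitivity (\int[th]_w (phi w.1 * dir mu w.1 0 i * cst 1 w.2)).
  by apply: eq_Rintegral => w _; rewrite mulr1.
rewrite (Rintegral_prod (tvar mu) U01 b1 (bmeas_cst 1)) Rintegral_cst//.
by rewrite uniform_setT !mulr1.
Qed.

End GradientTrig.

(** * Energy of a measure and existence of minimizers *)

Section ShiftedMeasure.
Context {R : realType} {d : nat}.
Local Notation leb := (torus_measure R d).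
Implicit Types (mu nu : @vmeasure _ 'rV[R]_d R d).

Lemma bcf_leb : bcf (fun a : 'rV[R]_d -> R => \int[leb]_x a x).
Proof.
have h : bcf (pint leb id (cst 1)).
  by apply: bcf_pint; [exact: measurable_id|exact: (bmeas_integrable leb (bmeas_cst 1))].
rewrite (_ : (fun a => _) = pint leb id (cst 1))//.
by apply/funext => a; apply: eq_Rintegral => x _; rewrite mulr1.
Qed.

Lemma Rintegral_leb_indic A : measurable A -> \int[leb]_x (\1_A x : R) = fine (leb A).
Proof. by move=> mA; exact: Rintegral_indic. Qed.

Lemma cint_shift p mu i a : bmeas a ->
  cint (shift_vmeasure p mu) i a = p 0 i * (\int[leb]_x a x) + cint mu i a.
Proof.
move=> ba; rewrite -[cint mu i a in RHS]mul1r.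
apply/esym; apply: (bcf_cint_eq (L := fun a => p 0 i * (\int[leb]_x a x) + 1 * cint mu i a)) => //.
  by apply: bcf_lin; [exact: bcf_leb|exact: bcf_cint].
move=> A mA; rewrite mul1r cint_indic// Rintegral_leb_indic//.
have -> : shift_vmeasure p mu i A = ((p 0 i)%:E * leb A + mu i A)%E by [].
rewrite fineD ?fineM//; try exact: fin_num_measure.
by rewrite fin_numM//; exact: fin_num_measure.
Qed.

(* The measures whose Fourier coefficients are curl-free and vanish at
   frequency 0, i.e., the derivatives of the BV functions on the torus. *)
Record gradient_like mu : Prop := GradientLike {
  gl_carried : carried mu;
  gl_curl : forall i j (k : 'rV[int]_d) t,
    (k 0 i)%:~R * cint mu j (trig k t) = (k 0 j)%:~R * cint mu i (trig k t);
  gl_zero : forall i t, cint mu i (trig 0 t) = 0 }.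

Lemma gradient_likeP mu : gradient_like mu <-> exists v, L1torus v /\ is_gradient v mu.
Proof.
split=> [[cmu curl zero]|[v [hv vmu]]].
  have [v [hv tv]] := primitive_ex curl zero.
  by exists v; split => //; exact: trig_gradient_gradient.
have tg := gradient_trig hv vmu.
have e i k t : cint mu i (trig k t) = - (2 * pi * (k 0 i)%:~R * pint leb id v (trig k (t + pi / 2))).
  by rewrite -[LHS]opprK -tg (bcfZ (bcf_L1 hv))//; exact: bmeas_trig.
split; first exact: vmu.1.
- by move=> i j k t; rewrite !e; ring.
- by move=> i t; rewrite e mxE mulr0 mul0r oppr0.
Qed.

Lemma carried_shift p mu : carried mu -> carried (shift_vmeasure p mu).
Proof.
move=> cmu i A mA AE; have -> : shift_vmeasure p mu i A = ((p 0 i)%:E * leb A + mu i A)%E by [].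
rewrite cmu// adde0 (_ : leb A = 0%E) ?mule0//.
apply: (@subset_measure0 _ _ _ leb _ (~` fund_cube)) => //.
- by apply: measurableC; exact: measurable_fund_cube.
- by move=> x Ax cx; have : set0 x by rewrite -AE.
- exact: torus_measure_cube.
Qed.

End ShiftedMeasure.

Section Energy.
Context {R : realType} {d : nat}.
Variables (F : 'rV[R]_d -> 'rV[R]_d -> R) (hF : admissible F).
Implicit Types (mu : @vmeasure _ 'rV[R]_d R d) (f : 'rV[R]_d -> R).

Definition energy f mu : R := \int[tvar mu]_x (F x (dir mu x) + f x).

Lemma bmeas_F_dir mu : bmeas (fun x => F x (dir mu x)).
Proof.
split; first exact: (measurable_comp_continuous2 (adm_continuous hF) (@measurable_id _ _ setT) (measurable_dir mu)).
have [c [c0 h]] := adm_bound hF; exists c^-1 => x.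
rewrite ger0_norm ?(adm_ge0 hF)//; have /andP[_ /le_trans->//] := h x (dir mu x).
by rewrite ler_piMr ?enorm_dir_le1// invr_ge0 ltW.
Qed.

Lemma cell_energyE f mu : bmeas f -> cell_energy F f mu = (energy f mu)%:E.
Proof.
move=> bf; have bFd := bmeas_F_dir mu; have bs := bmeasD bFd bf.
have iF := bmeas_integrable (tvar mu) bFd; have i_f := bmeas_integrable (tvar mu) bf.
have is_ := bmeas_integrable (tvar mu) bs.
rewrite /energy /Rintegral fineK; last exact: integrable_fin_num.
rewrite (_ : (fun x => _%:E) = (EFin \o (fun x => F x (dir mu x))) \+ (EFin \o f))%E//.
rewrite integralD//; congr (_ + _)%E.
apply: ae_eq_integral => //.
- apply/measurable_EFinP.
  apply: (measurable_comp_continuous2 (adm_continuous hF) (@measurable_id _ _ setT)).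
  by apply: measurable_row => i; exact: measurable_polar.
- by apply/measurable_EFinP; exact: bFd.1.
by move: (ae_dir mu); apply: filterS => x e _ /=; rewrite e.
Qed.

Lemma energy_add f g mu (s : R) : bmeas f -> bmeas g ->
  energy (fun x => f x + s * g x) mu = energy f mu + s * \int[tvar mu]_x g x.
Proof.
move=> bf bg; have bs := bmeasD (bmeas_F_dir mu) bf.
rewrite /energy -RintegralZl//; last exact: bmeas_integrable.
rewrite -RintegralD//; last by apply: bmeas_integrable; exact: bmeasZ.
  by apply: eq_Rintegral => x _; rewrite addrA.
exact: (bmeas_integrable (tvar mu) bs).
Qed.

Lemma cint_sum mu (b : 'I_d -> 'rV[R]_d -> R) : (forall i, bmeas (b i)) ->
  \sum_i cint mu i (b i) = \int[tvar mu]_x \sum_i b i x * dir mu x 0 i.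
Proof.
move=> bb; rewrite Rintegral_sum// => i; apply: bmeas_integrable.
by apply: bmeasM => //; exact: bmeas_dir_coord.
Qed.

Lemma energy_ge f mu (b : 'I_d -> 'rV[R]_d -> R) : bmeas f -> (forall x, 0 <= f x) ->
  (forall i, bmeas (b i)) ->
  (forall x (q : 'rV[R]_d), \sum_i b i x * q 0 i <= F x q + f x * enorm q) ->
  \sum_i cint mu i (b i) <= energy f mu.
Proof.
move=> bf f0 bb h; rewrite cint_sum// /energy; apply: le_Rintegral => //.
- apply: (bmeas_integrable (tvar mu)); apply: bmeas_sum => i.
  by apply: bmeasM => //; exact: bmeas_dir_coord.
- by apply: (bmeas_integrable (tvar mu)); apply: bmeasD => //; exact: bmeas_F_dir.
move=> x _; apply: (le_trans (h x (dir mu x))); rewrite lerD2l.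
by rewrite ler_piMr ?enorm_dir_le1.
Qed.

(** Together with [energy_ge], it exhibits the energy as a maximum of functionals that are linear in
    the measure. Both the lower semicontinuity and the minimality of the mean of two minimizers rest
    on this. The covector is a subgradient of F plus f times the direction. *)
Lemma energy_calibration f mu : bmeas f -> (forall x, 0 <= f x) ->
  exists b : 'I_d -> 'rV[R]_d -> R, [/\ forall i, bmeas (b i),
    forall x (q : 'rV[R]_d), \sum_i b i x * q 0 i <= F x q + f x * enorm q &
    energy f mu = \sum_i cint mu i (b i)].
Proof.
move=> bf f0; have [C hC] := adm_calibration hF.
have [a [ma aC aF aE]] := hC _ _ id (dir mu) (@measurable_id _ _ setT) (measurable_dir mu).
have bb i : bmeas (fun x => a x 0 i + f x * dir mu x 0 i).
  apply: bmeasD; last by apply: bmeasM => //; exact: bmeas_dir_coord.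
  by split; [exact: measurable_rowP|exists C => x; exact: aC].
exists (fun i x => a x 0 i + f x * dir mu x 0 i); split => //.
  move=> x q; under eq_bigr do rewrite mulrDl -mulrA.
  rewrite big_split/= -mulr_sumr; apply: lerD; first exact: aF.
  rewrite ler_wpM2l//; apply: (le_trans (dotv_le _ _)).
  by rewrite ler_piMl ?enorm_ge0 ?enorm_dir_le1.
rewrite cint_sum//; apply: ae_Rintegral_eq.
- exact: (bmeasD (bmeas_F_dir mu) bf).1.
- have := @bmeas_sum _ _ R _ (index_enum 'I_d) (fun i x => (a x 0 i + f x * dir mu x 0 i) * dir mu x 0 i).
  by move=> h; apply h => i; apply: bmeasM => //; exact: bmeas_dir_coord.
move: (ae_enorm_dir mu); apply: filterS => x e1.
under eq_bigr do rewrite mulrDl -mulrA.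
rewrite big_split/= -mulr_sumr -/(dotv (dir mu x) (dir mu x)) -/(dotv (a x) (dir mu x)).
by rewrite aE dotvv e1 expr1n mulr1.
Qed.

Definition mass mu : R := fine (tvar mu setT).

Lemma Rintegral_tvar_le mu g (e : R) : bmeas g -> (forall x, `|g x| <= e) ->
  `|\int[tvar mu]_x g x| <= e * mass mu.
Proof.
move=> bg h; have := @Rintegral_dist _ _ _ (tvar mu) g (cst 0) e bg (bmeas_cst 0).
rewrite Rintegral_cst// mul0r subr0; apply => w.
by rewrite subr0.
Qed.

Lemma energy_mass : exists c : R, 0 < c /\ forall f mu, bmeas f -> (forall x, 0 <= f x) ->
  c * mass mu <= energy f mu.
Proof.
have [c [c0 h]] := adm_bound hF; exists c; split => // f mu bf f0.
have -> : c * mass mu = \int[tvar mu]_x (c * enorm (dir mu x)).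
  rewrite -(Rintegral_cst (tvar mu) measurableT c); apply: ae_Rintegral_eq => //.
    by apply: measurable_funM => //; exact: (measurableT_comp (@measurable_enorm R d) (measurable_dir mu)).
  by move: (ae_enorm_dir mu); apply: filterS => x ->; rewrite mulr1.
apply: le_Rintegral => //.
- apply: bmeas_integrable; apply: bmeasZ; split.
    exact: (measurableT_comp (@measurable_enorm R d) (measurable_dir mu)).
  by exists 1 => x; rewrite ger0_norm ?enorm_ge0 ?enorm_dir_le1.
- by apply: (bmeas_integrable (tvar mu)); apply: bmeasD => //; exact: bmeas_F_dir.
by move=> x _; have /andP[h1 _] := h x (dir mu x); rewrite (le_trans h1)// lerDl.
Qed.

End Energy.

Section YoungLimit.
Context {R : realType}.
Local Notation U01 := (uniform_prob (@ltr01 R)).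

Lemma continuous_unpack d : continuous (fun z : 'rV[R]_(d + d) =>
  (lsubmx z, 4 *: rsubmx z - const_mx 1 : 'rV[R]_d)).
Proof.
move=> z; suff : (lsubmx y, 4 *: rsubmx y - const_mx 1 : 'rV[R]_d) @[y --> z] -->
  (lsubmx z, 4 *: rsubmx z - const_mx 1 : 'rV[R]_d) by [].
have FF := nbhs_filter z.
have h1 : (lsubmx y : 'rV[R]_d) @[y --> z] --> (lsubmx z : 'rV[R]_d).
  apply: (@cvg_row R d _ (nbhs z) FF) => i; under eq_fun do rewrite mxE; rewrite mxE.
  exact: coord_continuous.
have h2 : (4 *: rsubmx y - const_mx 1 : 'rV[R]_d) @[y --> z] --> (4 *: rsubmx z - const_mx 1 : 'rV[R]_d).
  apply: (@cvg_row R d _ (nbhs z) FF) => i; under eq_fun do rewrite !mxE; rewrite !mxE.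
  apply: cvgB; last exact: cvg_cst.
  by apply: cvgM; [exact: cvg_cst|exact: coord_continuous].
exact: (cvg_pair h1 h2).
Qed.

(** Position and direction are packed into one point of [0, 1[ ^ (2 d), a direction coordinate r
    being stored as (r + 1) / 4 so as to stay below 1. The limit lies in the closed cube, where 4 z
    - 1 ranges over [-1, 3]; hence the bound 3. *)
Lemma young_limit d (kappa : nat -> @vmeasure _ 'rV[R]_d R d) (K : R) (U : set_system nat) :
  (0 < d)%N -> (forall n, mass (kappa n) <= K) -> UltraFilter U ->
  exists (M : R) (X Q : R -> 'rV[R]_d), [/\ 0 <= M, measurable_fun setT X,
    measurable_fun setT Q, forall t i, `|Q t 0 i| <= 3 &
    forall Phi : 'rV[R]_d -> 'rV[R]_d -> R, continuous (fun z : 'rV[R]_d * 'rV[R]_d => Phi z.1 z.2) ->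
    \int[tvar (kappa n)]_x Phi (fracr x) (dir (kappa n) x) @[n --> U] -->
      M * \int[U01]_t Phi (X t) (Q t)].
Proof.
move=> d0 hK UF; case: d d0 kappa hK => // d' _ kappa hK.
pose D := d'.+1.
pose th n : {finite_measure set 'rV[R]_D -> \bar R} := tvar (kappa n).
pose u n (x : 'rV[R]_D) : 'rV[R]_(D + D) :=
  row_mx (fracr x) (4^-1 *: (dir (kappa n) x + const_mx 1)).
have mu n : measurable_fun setT (u n).
  apply: measurable_row => i; rewrite /u.
  under eq_fun do rewrite mxE; case: (fintype.split i) => j.
    by apply: measurable_rowP; exact: measurable_fracr.
  under eq_fun do rewrite !mxE.
  by apply: measurable_funM => //; apply: measurable_funD => //; exact: measurable_dir_coord.
have u01 n w i : 0 <= u n w 0 i < 1.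
  rewrite /u mxE; case: (fintype.split i) => j; first exact: fracr_cube.
  rewrite !mxE; have := dir_coord_le1 (kappa n) j w; rewrite ler_norml => /andP[h1 h2].
  by apply/andP; split; lra.
have [M [Z [M0 mZ bZ h]]] := @young_compactness _ _ R (d' + d'.+1)%N th K hK u mu u01 U UF.
pose X t : 'rV[R]_D := lsubmx (Z t : 'rV[R]_(D + D)).
pose Q t : 'rV[R]_D := 4 *: rsubmx (Z t : 'rV[R]_(D + D)) - const_mx 1.
exists M, X, Q; split => //.
- apply: measurable_row => i; rewrite /X; under eq_fun do rewrite mxE.
  exact: measurable_rowP.
- apply: measurable_row => i; rewrite /Q; under eq_fun do rewrite !mxE.
  by apply: measurable_funB => //; apply: measurable_funM => //; exact: measurable_rowP.
- move=> t i; rewrite !mxE ler_norml; have /andP[h1 h2] := bZ t (rshift D i).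
  by apply/andP; split; lra.
move=> Phi cPhi; pose f (z : 'rV[R]_(D + D)) : R := Phi (lsubmx z) (4 *: rsubmx z - const_mx 1).
have cf : continuous f.
  move=> z; apply: (@continuous_comp _ _ _ (fun z : 'rV[R]_(D + D) =>
    (lsubmx z, 4 *: rsubmx z - const_mx 1 : 'rV[R]_D)) (fun z => Phi z.1 z.2)).
    exact: (@continuous_unpack D z).
  exact: cPhi.
have := h f cf; rewrite /f.
under eq_fun do under eq_Rintegral do rewrite /u row_mxKl row_mxKr scalerA divff ?pnatr_eq0// scale1r addrK.
by [].
Qed.

End YoungLimit.

Section Existence.
Context {R : realType} {d : nat}.
Local Notation leb := (torus_measure R d).
Local Notation U01 := (uniform_prob (@ltr01 R)).
Variables (F : 'rV[R]_d -> 'rV[R]_d -> R) (hF : admissible F) (p : 'rV[R]_d).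
Implicit Types (mu : @vmeasure _ 'rV[R]_d R d) (f : 'rV[R]_d -> R).

Definition vzero : @vmeasure _ 'rV[R]_d R d := fun _ => czero.

Lemma cint_vzero i a : bmeas a -> cint vzero i a = 0.
Proof.
move=> ba; transitivity (0 * cint vzero i a + 0 * cint vzero i a); last by rewrite !mul0r addr0.
apply/esym; apply: (bcf_cint_eq (L := fun a => 0 * cint vzero i a + 0 * cint vzero i a)) => //.
  by apply: bcf_lin; exact: bcf_cint.
by move=> A mA; rewrite !mul0r addr0.
Qed.

Lemma gradient_like0 : gradient_like vzero.
Proof.
split=> // [i j k t|i t]; rewrite !cint_vzero ?mulr0//; exact: bmeas_trig.
Qed.

Definition cell_min f : R :=
  inf [set energy F f (shift_vmeasure p mu) | mu in gradient_like].

Lemma energy_ge0 f mu : (forall x, 0 <= f x) -> 0 <= energy F f mu.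
Proof.
by move=> f0; apply: Rintegral_ge0 => x _; rewrite addr_ge0 ?(adm_ge0 hF).
Qed.

Lemma cell_has_inf f : (forall x, 0 <= f x) ->
  has_inf [set energy F f (shift_vmeasure p mu) | mu in gradient_like].
Proof.
move=> f0; split; first by exists (energy F f (shift_vmeasure p vzero)), vzero => //; exact: gradient_like0.
by exists 0 => _ [mu _ <-]; exact: energy_ge0.
Qed.

Lemma cell_min_le f mu : (forall x, 0 <= f x) -> gradient_like mu ->
  cell_min f <= energy F f (shift_vmeasure p mu).
Proof.
by move=> f0 gmu; apply: ge_inf; [exact: (cell_has_inf f0).2|exists mu].
Qed.

Theorem cell_min_attained f : (0 < d)%N -> periodic f -> continuous f -> (forall x, 0 <= f x) ->
  exists mu, gradient_like mu /\ energy F f (shift_vmeasure p mu) = cell_min f.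
Proof.
move=> d0 pf cf f0; have bf := bmeas_periodic pf cf.
have /boolp.choice[nu nuP] (n : nat) : exists nu, gradient_like nu /\
    energy F f (shift_vmeasure p nu) < cell_min f + n.+1%:R^-1.
  have [|_ [nu gnu <-] h] := @inf_adherent R _ (n.+1%:R^-1) _ (cell_has_inf f0); first by rewrite invr_gt0.
  by exists nu.
pose kappa n := shift_vmeasure p (nu n).
have [c [c0 hc]] := energy_mass hF.
have hK n : mass (kappa n) <= (cell_min f + 1) / c.
  rewrite ler_pdivlMr// mulrC (le_trans (hc f _ bf f0))// (le_trans (ltW (nuP n).2))//.
  by rewrite lerD2l invf_le1// ler1n.
have [U [UF hU]] := @ultraFilterLemma nat \oo _.
have [M [X [Q [M0 mX mQ Q3 hlim]]]] := young_limit d0 hK UF.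
have mfX : measurable_fun setT (fun t => fracr (X t)).
  exact: (measurableT_comp (@measurable_fracr R d) mX).
have bQ i : bmeas (fun t => M * Q t 0 i).
  by apply: bmeasZ; split; [exact: measurable_rowP|exists 3].
have iQ i : U01.-integrable setT (EFin \o (fun t => M * Q t 0 i)) := bmeas_integrable U01 (bQ i).
(* The barycentre of the limit Young measure; it is the limit of the measures p + Dv of the
   minimizing sequence, tested on characters. *)
pose L i a := pint U01 (fun t => fracr (X t)) (fun t => M * Q t 0 i) a.
have bL i : bcf (L i) by exact: bcf_pint.
have /boolp.choice[kappa0 kE] i : exists k : {charge set 'rV[R]_d -> \bar R},
  forall A, measurable A -> k A = (L i (\1_A))%:E by exact: pint_charge.
have L_cint i a : bmeas a -> L i a = cint (kappa0 : vmeasure) i a.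
  by apply: bcf_cint_eq => // A mA; rewrite kE.
pose mu := shift_vmeasure (- p) kappa0.
have cE i a : bmeas a -> cint (shift_vmeasure p mu) i a = L i a.
  by move=> ba; rewrite !cint_shift// -L_cint// mxE; ring.
have bt k t : bmeas (@trig R d k t) := bmeas_trig k t.
have limK i k t : cint (kappa n) i (trig k t) @[n --> U] --> cint (shift_vmeasure p mu) i (trig k t).
  rewrite cE//; have := hlim (fun x q => trig k t x * q 0 i).
  have cPhi : continuous (fun z : 'rV[R]_d * 'rV[R]_d => trig k t z.1 * z.2 0 i).
    apply: continuous_mulr => z.
      apply: (@continuous_comp _ _ _ fst (trig k t : 'rV[R]_d -> R^o)); first exact: cvg_fst.
      exact: continuous_trig.
    apply: (@continuous_comp _ _ _ snd (fun q : 'rV[R]_d => q 0 i)); first exact: cvg_snd.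
    exact: coord_continuous.
  move=> /(_ cPhi).
  rewrite -RintegralZl//; last first.
    apply: bmeas_integrable; apply: bmeasM; last by split; [exact: measurable_rowP|exists 3].
    exact: (bmeas_comp mX (bmeas_trig k t)).
  rewrite (_ : \int[U01]_x _ = L i (trig k t)); last first.
    by apply: eq_Rintegral => s _; rewrite periodic_fracr; [ring|exact: trig_periodic].
  apply: cvg_trans; apply: near_eq_cvg; apply: nearW => n.
  by apply: eq_Rintegral => x _; rewrite periodic_fracr//; exact: trig_periodic.
have limN i k t : cint (nu n) i (trig k t) @[n --> U] --> cint mu i (trig k t).
  pose c' : R := p 0 i * \int[leb]_x trig k t x.
  have -> : cint mu i (trig k t) = cint (shift_vmeasure p mu) i (trig k t) - c'.
    by rewrite [X in X - _]cint_shift// /c'; ring.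
  have h : cint (kappa n) i (trig k t) - c' @[n --> U] --> cint (shift_vmeasure p mu) i (trig k t) - c'.
    by apply: cvgB; [exact: limK|exact: cvg_cst].
  move: h; apply: cvg_trans; apply: near_eq_cvg; apply: nearW => n /=.
  by rewrite /kappa [X in X - _]cint_shift// /c'; ring.
(* Curl-freeness and zero mean are linear equations in the Fourier coefficients, so they pass to the
   limit. *)
have gmu : gradient_like mu.
  split.
  - apply: carried_shift => i A mA AE; rewrite kE//; congr EFin.
    transitivity (\int[U01]_t (cst 0 t : R)); last by rewrite Rintegral_cst// mul0r.
    apply: eq_Rintegral => t _; rewrite indicE memNset ?mul0r// => At.
    by have : set0 (fracr (X t)) by rewrite -AE; split => //; exact: fracr_cube.
  - move=> i j k t.
    have hm l l' : (k 0 l)%:~R * cint (nu n) l' (trig k t) @[n --> U] --> (k 0 l)%:~R * cint mu l' (trig k t).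
      by apply: cvgM; [exact: cvg_cst|exact: limN].
    have h1 := hm i j; have h2 := hm j i.
    have e : (fun n => (k 0 i)%:~R * cint (nu n) j (trig k t)) = fun n => (k 0 j)%:~R * cint (nu n) i (trig k t).
      by apply/funext => n; exact: (gl_curl (nuP n).1).
    by rewrite e in h1; exact: (cvg_unique _ h1 h2).
  - move=> i t; have h1 := limN i 0 t.
    have h2 : cint (nu n) i (trig 0 t) @[n --> U] --> (0 : R).
      by under eq_fun do rewrite (gl_zero (nuP _).1); exact: cvg_cst.
    exact: (cvg_unique _ h1 h2).
exists mu; split => //; apply/le_anti; rewrite cell_min_le// andbT.
have [b [bb bF ->]] := energy_calibration hF (shift_vmeasure p mu) bf f0.
(* The energy density in homogeneous form: it is continuous in [q] on the whole space, and on unit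
   vectors it is the integrand of [energy]. The limit directions are only known to be bounded by
   3. *)
pose Phi (x q : 'rV[R]_d) := F x q + f x * enorm q.
have cPhi : continuous (fun z : 'rV[R]_d * 'rV[R]_d => Phi z.1 z.2).
  apply: continuous_addr; first exact: (adm_continuous hF).
  apply: continuous_mulr => z.
    by apply: (@continuous_comp _ _ _ fst f); [exact: cvg_fst|exact: cf].
  apply: (@continuous_comp _ _ _ snd (@enorm R d : 'rV[R]_d -> R)); first exact: cvg_snd.
  exact: continuous_enorm.
have PhiE x q : Phi (fracr x) q = Phi x q.
  by rewrite /Phi (periodic_fracr x (adm_periodic hF q)) (periodic_fracr x pf).
have bPhi : bmeas (fun t => Phi (X t) (Q t)).
  split; first exact: (measurable_comp_continuous2 cPhi mX mQ).
  have [C hC] := bf.2; have [c1 [c10 hc1]] := adm_bound hF.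
  exists ((c1^-1 + C) * (d%:R * 3)) => t.
  have e1 : enorm (Q t) <= d%:R * 3.
    rewrite (le_trans (enorm_le_norm _))// ler_wpM2l// norm_le_coord//.
  rewrite ger0_norm; last by rewrite addr_ge0 ?(adm_ge0 hF)// mulr_ge0 ?enorm_ge0.
  have /andP[_ h1] := hc1 (X t) (Q t).
  rewrite (le_trans (lerD h1 (_ : f (X t) * enorm (Q t) <= C * enorm (Q t))))//.
    by rewrite ler_wpM2r ?enorm_ge0// (le_trans (ler_norm _)).
  have C0 : 0 <= C by exact: le_trans (hC 0).
  by rewrite -mulrDl ler_wpM2l// addr_ge0// invr_ge0 ltW.
(* Jensen's inequality by calibration: the covector adapted to the barycentre is integrated against
   the Young measure and bounded pointwise by [Phi]. *)
apply: (@le_trans _ _ (M * \int[U01]_t Phi (X t) (Q t))).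
  under eq_bigr do rewrite cE//.
  rewrite /L /pint -Rintegral_sum//; last first.
    by move=> i; exact: (bmeas_integrable U01 (bmeasM (bmeas_comp mfX (bb i)) (bQ i))).
  rewrite -RintegralZl//; last exact: bmeas_integrable.
  apply: le_Rintegral => //.
  - apply: integrable_sumr => // i.
    exact: (bmeas_integrable U01 (bmeasM (bmeas_comp mfX (bb i)) (bQ i))).
  - by apply: (bmeas_integrable U01); exact: bmeasZ.
  move=> t _; rewrite -PhiE; apply: (@le_trans _ _ (M * \sum_i b i (fracr (X t)) * Q t 0 i)).
    by rewrite mulr_sumr; apply: ler_sum => i _; rewrite mulrCA.
  by rewrite ler_wpM2l//; exact: bF.
have h1 := hlim Phi cPhi.
have h2 : cell_min f + n.+1%:R^-1 @[n --> U] --> cell_min f.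
  suff h : cell_min f + n.+1%:R^-1 @[n --> \oo] --> cell_min f by move=> A /h; exact: hU.
  rewrite -[X in _ --> X]addr0; apply: cvgD; first exact: cvg_cst.
  exact: cvg_harmonic.
apply: (ler_cvg_to h1 h2); apply: nearW => n; apply: le_trans (ltW (nuP n).2).
rewrite le_eqVlt; apply/orP; left; apply/eqP; apply: ae_Rintegral_eq.
- apply: (measurable_comp_continuous2 cPhi); first exact: measurable_fracr.
  exact: measurable_dir.
- exact: (bmeasD (bmeas_F_dir hF (kappa n)) bf).1.
move: (ae_enorm_dir (kappa n)); apply: filterS => x e1.
by rewrite PhiE /Phi e1 mulr1.
Qed.

End Existence.

(** * Generic weights *)

Section CinfTopology.
Context {R : realType} {d : nat}.
Implicit Types (f h : Cinf R d).

Lemma near_Cinf f (e : R) : 0 < e ->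
  nbhs f [set h : Cinf R d | forall x, `|f x - h x| < e].
Proof.
move=> e0; have h1 : f' @[f' --> f] --> f by exact: cvg_id.
have /cvg_sup/(_ [::]) h2 := h1.
pose B : set {uniform 'rV[R]_d -> R^o} := [set h | forall x, `|f x - h x| < e].
have hB : nbhs (partial (@ebase R d) [::] f : {uniform 'rV[R]_d -> R^o}) B.
  apply/uniform_nbhs; exists [set xy | ball xy.1 e xy.2]; split.
    by rewrite -entourage_ballE; exists e.
  by move=> h /= hh x; exact: hh.
have := @initial_continuous _ _ (fun f : Cinf R d => partial (@ebase R d) [::] f : {uniform 'rV[R]_d -> R^o}) f _ hB.
by move=> hh; exact: (h2 (nbhs_filter f) _ hh).
Qed.

Lemma cvg_Cinf (F : set_system (Cinf R d)) f : Filter F ->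
  (forall s (e : R), 0 < e -> F [set h : Cinf R d | forall x,
    `|partial (@ebase R d) s f x - partial (@ebase R d) s h x| < e]) -> F --> f.
Proof.
move=> FF hF; apply/cvg_sup => s A /= [_ [[B Bop <-] Bf sBA]].
have : nbhs (partial (@ebase R d) s f : {uniform 'rV[R]_d -> R^o}) B by exact: open_nbhs_nbhs.
move=> /uniform_nbhs[E [/=]]; rewrite -entourage_ballE => -[e /= e0 eE] EB.
apply: filterS (hF s e e0) => h hh; apply: sBA; apply: EB => x _; apply: eE => /=.
exact: hh.
Qed.

(** The constant [a] will lift a weight away from zero, and [b] will move it along the segment on
    which second differences are telescoped. *)
Definition affine_trig f (k : 'rV[int]_d) (t a b : R) (x : 'rV[R]_d) : R^o := f x + (a + b * trig k t x).

Lemma partial_affine_trig f k t a b s : partial (@ebase R d) s (affine_trig f k t a b) =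
  fun x => partial (@ebase R d) s f x + ((s == [::])%:R * a + b * partial (@ebase R d) s (trig k t : 'rV[R]_d -> R^o) x).
Proof.
elim: s => [|i s ih]; first by apply/funext => x; rewrite /= mul1r.
rewrite [LHS]/= -/(partial _ _ _) ih; apply/funext => x.
pose P : 'rV[R]_d -> R^o := partial (@ebase R d) s f.
pose T : 'rV[R]_d -> R^o := partial (@ebase R d) s (trig k t : 'rV[R]_d -> R^o).
have dP : is_derive x (ebase i) P ('D_(ebase i) P x).
  by apply/derivableP; exact: (Cinf_smooth f s).2.
have dT : is_derive x (ebase i) T ('D_(ebase i) T x).
  by apply/derivableP; exact: (smooth_trig k t s).2.
have dc : is_derive x (ebase i) (cst ((s == [::])%:R * a : R^o) : 'rV[R]_d -> R^o) 0 by exact: is_derive_cst.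
have := is_deriveD dP (is_deriveD dc (is_deriveZ b dT)) => h.
rewrite -[LHS]/('D_(ebase i) (P + (cst ((s == [::])%:R * a : R^o) + b \*: T)) x).
by rewrite (@derive_val _ _ _ _ _ _ _ h) /GRing.scale/= mul0r.
Qed.

Lemma affine_trig_periodic f k t a b : periodic (affine_trig f k t a b).
Proof. by move=> l x; rewrite /affine_trig Cinf_periodic trig_periodic. Qed.

Lemma affine_trig_smooth f k t a b : smooth (affine_trig f k t a b).
Proof.
move=> s; rewrite partial_affine_trig.
have [c1 d1] := Cinf_smooth f s; have [c2 d2] := smooth_trig k t s; split.
  apply: continuous_addr => //; apply: continuous_addr; first exact: continuous_const.
  by apply: continuous_mulr => //; exact: continuous_const.
move=> i x; pose T : 'rV[R]_d -> R^o := partial (@ebase R d) s (trig k t : 'rV[R]_d -> R^o).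
apply: (@derivableD _ _ _ (partial (@ebase R d) s f)); first exact: d1.
apply: (@derivableD _ _ _ (cst ((s == [::])%:R * a : R^o)) (b \*: T)); first exact: derivable_cst.
by apply: derivableZ; exact: d2.
Qed.

Definition affC f k t a b : Cinf R d :=
  MkCinf (affine_trig_periodic f k t a b) (affine_trig_smooth f k t a b).

Lemma near_affC f k t (A : set (Cinf R d)) : nbhs f A ->
  exists2 e : R, 0 < e & forall a b, `|a| < e -> `|b| < e -> A (affC f k t a b).
Proof.
move=> fA; pose Phi (z : R * R) := affC f k t z.1 z.2.
have cPhi : Phi z @[z --> ((0, 0) : R * R)] --> f.
  apply: cvg_Cinf => s e e0.
  have [c [u hc]] := partial_trig k t s.
  pose e' := e / (1 + `|c|) / 2.
  have c1 : 0 < 1 + `|c| by rewrite ltr_pwDl.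
  have e'0 : 0 < e' by rewrite !divr_gt0.
  change (nbhs ((0, 0) : R * R) [set z | forall x,
    `|partial (@ebase R d) s f x - partial (@ebase R d) s (Phi z) x| < e]).
  apply/nbhs_ballP; exists e' => //= -[a b] [/= ha hb] x.
  rewrite partial_affine_trig hc opprD addrA subrr add0r normrN.
  move: ha hb; rewrite /ball/= !sub0r !normrN => ha hb.
  rewrite (le_lt_trans (ler_normD _ _))//.
  have h1 : `|(s == [::])%:R * a| <= `|a|.
    by rewrite normrM normr_nat ler_piMl//; case: (s == _).
  have h2 : `|b * (c * trig k u x)| <= `|b| * `|c|.
    by rewrite !normrM ler_wpM2l// ler_piMr// trig_le1.
  have h3 : `|b| * `|c| <= e' * `|c| by rewrite ler_wpM2r// ltW.
  have h4 : e' * (1 + `|c|) = e / 2 by rewrite /e'; field; rewrite gt_eqF.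
  rewrite mulrDr mulr1 in h4; lra.
have /cPhi/nbhs_ballP[e /= e0 he] := fA.
by exists e => // a b ha hb; apply: (he (a, b)); split => /=; rewrite /ball/= sub0r normrN.
Qed.

End CinfTopology.

(** Otherwise, on the grid of step t = a / N each increment of [h] is smaller than the previous one
    by at least t / m. Yet the first is at most t B and the last at least - t B, which is impossible
    once N - 1 > 2 B m. *)
Lemma second_difference_small (R : realType) (h : R -> R) (a B m : R) : 0 < a -> 0 < m ->
  (forall s, 0 <= s <= a -> h s <= h 0 + s * B) ->
  (forall s, 0 <= s <= a -> h (a - s) <= h a + s * B) ->
  exists s t, [/\ 0 < t, 0 <= s - t, s + t <= a &
    - (t / m) < h (s + t) + h (s - t) - 2 * h s].
Proof.
move=> a0 m0 h1 h2; apply/not_existsP => H.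
(* Large enough that N - 1 exceeds 2 B m. *)
pose N := (Num.truncn (`|2 * B * m|)).+3.
have N0 : (0 : R) < N%:R by [].
pose t := a / N%:R.
have t0 : 0 < t by exact: divr_gt0.
pose u j : R := h (j%:R * t).
have D j : (j.+2 <= N)%N -> u j.+2 - u j.+1 <= u j.+1 - u j - t / m.
  move=> jN; have Ht q := H (j.+1%:R * t) (ex_intro _ t q).
  rewrite leNgt; apply/negP => hlt; apply: Ht; split => //.
  - rewrite (_ : _ - t = j%:R * t); last by rewrite -(natr1 j); ring.
    by rewrite mulr_ge0// ltW.
  - rewrite (_ : _ + t = j.+2%:R * t); last by rewrite -(natr1 j.+1); ring.
    have -> : a = N%:R * t by rewrite /t mulrC divfK// gt_eqF.
    by rewrite ler_wpM2r ?ler_nat// ltW.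
  - rewrite (_ : _ + t = j.+2%:R * t); last by rewrite -(natr1 j.+1); ring.
    rewrite (_ : _ - t = j%:R * t); last by rewrite -(natr1 j); ring.
    move: hlt; rewrite /u; lra.
have S j : (j.+1 <= N)%N -> u j.+1 - u j <= u 1%N - u 0%N - j%:R * (t / m).
  elim: j => [|j ih] jN; first by rewrite mul0r subr0.
  have := D j jN; have := ih (ltnW jN); rewrite -natr1; nra.
have tN : N%:R * t = a by rewrite /t mulrC divfK// gt_eqF.
have t0' := ltW t0.
have ta : 0 <= t <= a by rewrite t0' -tN ler_peMl// ler1n.
have e0 := h1 t ta; have e1 := h2 t ta.
have N1 : N = N.-1.+1 by [].
have := S N.-1 (leqnn N); rewrite -N1 /u tN mul0r mul1r.
have -> : N.-1%:R * t = a - t by rewrite -tN N1 -natr1/=; ring.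
have tm : 0 < t / m by exact: divr_gt0.
have hB : 2 * B < N.-1%:R / m.
  rewrite ltr_pdivlMr// (le_lt_trans (ler_norm _))//.
  have /andP[_ hh] := truncn_itv (normr_ge0 (2 * B * m)).
  by rewrite (lt_le_trans hh)// ler_nat.
have : 2 * (t * B) < N.-1%:R * (t / m).
  rewrite mulrCA (_ : N.-1%:R * (t / m) = t * (N.-1%:R / m)); last by ring.
  by rewrite ltr_pM2l.
lra.
Qed.

Lemma second_difference_bound (R : realDomainType) (g1 g2 e t I1 I2 : R) :
  g1 <= e + t * I1 -> g2 <= e + (- t) * I2 -> g1 + g2 - 2 * e <= t * (I1 - I2).
Proof. by move=> h1 h2; lra. Qed.

Lemma second_difference_dist (R : realDomainType) (a b c a' b' c' e : R) :
  `|a - a'| <= e -> `|b - b'| <= e -> `|c - c'| <= e ->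
  `|a + b - 2 * c - (a' + b' - 2 * c')| <= 4 * e.
Proof.
rewrite !ler_norml => /andP[a1 a2] /andP[b1 b2] /andP[c1 c2].
by apply/andP; split; lra.
Qed.

(** * Continuity and second differences of the minimum value *)

Section CellMin.
Context {R : realType} {d : nat}.
Variables (F : 'rV[R]_d -> 'rV[R]_d -> R) (hF : admissible F) (p : 'rV[R]_d) (d0 : (0 < d)%N).
Implicit Types (mu : @vmeasure _ 'rV[R]_d R d) (f : 'rV[R]_d -> R).
Local Notation G := (cell_min F p).
Local Notation shift := (shift_vmeasure p).

Record weight f : Prop := Weight {
  weight_periodic : periodic f;
  weight_continuous : continuous f;
  weight_ge0 : forall x, 0 <= f x }.

Lemma bmeas_weight f : weight f -> bmeas f.
Proof. by move=> [pf cf _]; exact: bmeas_periodic. Qed.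

Lemma weight_add_trig f k t (s e : R) : periodic f -> continuous f ->
  (forall x, e <= f x) -> `|s| <= e -> weight (fun x => f x + s * trig k t x).
Proof.
move=> pf cf fe se; split.
- by move=> l x; rewrite pf trig_periodic.
- apply: continuous_addr => //; apply: continuous_mulr; first exact: continuous_const.
  exact: continuous_trig.
move=> x; have := fe x; have : `|s * trig k t x| <= `|s|.
  by rewrite normrM ler_piMr// trig_le1.
by rewrite ler_norml => /andP[h1 h2]; lra.
Qed.

Lemma cell_min_ex f : weight f -> exists mu, gradient_like mu /\ energy F f (shift mu) = G f.
Proof. by move=> [pf cf f0]; exact: cell_min_attained. Qed.

Lemma energyB f f' mu : bmeas f -> bmeas f' ->
  energy F f' mu = energy F f mu + \int[tvar mu]_x (f' x - f x).
Proof.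
move=> bf bf'; rewrite -[X in _ + X]mul1r -(energy_add hF)//; last exact: bmeasB.
by apply: eq_Rintegral => x _; rewrite mul1r; congr (_ + _); ring.
Qed.

(** A minimizer for one weight is a competitor for the other; the cost is the uniform distance times
    its mass, and by coercivity this mass is at most the minimum divided by [c]. *)
Lemma cell_min_close f (eta : R) : weight f -> 0 < eta -> exists2 e, 0 < e &
  forall f', weight f' -> (forall x, `|f x - f' x| <= e) -> `|G f - G f'| <= eta.
Proof.
move=> wf eta0; have [c [c0 hc]] := energy_mass hF.
have G0 g : weight g -> 0 <= G g.
  move=> wg; have [mu [_ <-]] := cell_min_ex wg.
  by apply: (energy_ge0 hF); exact: weight_ge0 wg.
have lip g g' e : weight g -> weight g' -> 0 <= e -> (forall x, `|g x - g' x| <= e) -> G g' <= G g + e * (G g / c).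
  move=> wg wg' e0 ge; have [mu [gmu <-]] := cell_min_ex wg.
  have bg := bmeas_weight wg; have bg' := bmeas_weight wg'.
  apply: (le_trans (cell_min_le hF p (weight_ge0 wg') gmu)).
  rewrite (energyB (shift mu) bg bg') lerD2l (le_trans (ler_norm _))//.
  apply: (le_trans (Rintegral_tvar_le (shift mu) (e := e) (bmeasB bg' bg) _)).
    by move=> x; rewrite distrC.
  by rewrite ler_wpM2l// ler_pdivlMr// mulrC; apply: hc => //; exact: weight_ge0 wg.
(* [A] bounds the mass of a minimizer for [f]; since e <= 1 gives G f' <= G f + A, [B] bounds that
   of a minimizer for f'. *)
pose A := G f / c; pose B := (G f + A) / c.
have A0 : 0 <= A by rewrite divr_ge0 ?G0// ltW.
have B0 : 0 <= B by rewrite divr_ge0 ?addr_ge0 ?G0// ltW.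
pose e := Num.min 1 (eta / (A + B + 1)).
have AB : 0 < A + B + 1 by lra.
have e0 : 0 < e by rewrite lt_min ltr01 divr_gt0.
have e1 : e <= 1 by rewrite ge_min lexx.
have e2 : e * (A + B + 1) <= eta by rewrite -ler_pdivlMr// ge_min lexx orbT.
exists e => // f' wf' ff'.
have h1 := lip _ _ _ wf wf' (ltW e0) ff'.
have h2 := lip _ _ _ wf' wf (ltW e0) (fun x => eq_ind_r (fun z => z <= e) (ff' x) (distrC _ _)).
have h3 : G f' <= G f + A by apply: (le_trans h1); rewrite lerD2l ler_piMl.
have h4 : G f' / c <= B by rewrite ler_pM2r ?invr_gt0.
have h5 : e * (G f' / c) <= e * B by rewrite ler_pM2l.
rewrite -/A in h1; rewrite !mulrDr mulr1 in e2.
have h6 : 0 <= e * A by rewrite mulr_ge0// ltW.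
have h7 : 0 <= e * B by rewrite mulr_ge0// ltW.
by rewrite ler_norml; apply/andP; split; lra.
Qed.

Definition second_difference f (g : 'rV[R]_d -> R) (t : R) : R :=
  G (fun x => f x + t * g x) + G (fun x => f x + (- t) * g x) - 2 * G f.

(** The first minimizer is used as competitor for f + t g and the second one for f - t g. *)
Lemma second_difference_le f g t mu1 mu2 : bmeas f -> bmeas g ->
  (forall x, 0 <= f x + t * g x) -> (forall x, 0 <= f x + (- t) * g x) ->
  gradient_like mu1 -> gradient_like mu2 ->
  energy F f (shift mu1) = G f -> energy F f (shift mu2) = G f ->
  second_difference f g t <=
    t * (\int[tvar (shift mu1)]_x g x - \int[tvar (shift mu2)]_x g x).
Proof.
move=> bf bg f1 f2 g1 g2 e1 e2.
have h1 := cell_min_le hF p f1 g1; have h2 := cell_min_le hF p f2 g2.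
rewrite (energy_add hF)// e1 in h1; rewrite (energy_add hF)// e2 in h2.
exact: second_difference_bound h1 h2.
Qed.

Lemma second_difference_close f k t s (e eta : R) : weight f -> 0 < e -> (forall x, `|s| + e <= f x) ->
  0 < eta -> exists2 e', 0 < e' & forall f', weight f' -> (forall x, `|f x - f' x| <= e') ->
    (forall x, `|s| <= f' x) /\
    `|second_difference f (trig k t) s - second_difference f' (trig k t) s| <= 4 * eta.
Proof.
move=> wf e0 fe eta0; have [pf cf _] := wf.
have fs x : `|s| <= f x by apply: le_trans (fe x); rewrite lerDl ltW.
have fs' x : `|- s| <= f x by rewrite normrN.
have w1 := weight_add_trig k t pf cf fs (lexx _).
have w2 := weight_add_trig k t pf cf fs' (lexx _).
have [e1 e10 h1] := cell_min_close w1 eta0.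
have [e2 e20 h2] := cell_min_close w2 eta0.
have [e3 e30 h3] := cell_min_close wf eta0.
exists (Num.min (Num.min e e1) (Num.min e2 e3)) => [|f' wf' ff'].
  by rewrite !lt_min e0 e10 e20.
have ff e' : Num.min (Num.min e e1) (Num.min e2 e3) <= e' -> forall x, `|f x - f' x| <= e'.
  by move=> h x; exact: le_trans h.
have f's x : `|s| <= f' x.
  have := ff e _ x; rewrite !ge_min lexx => /(_ isT); rewrite ler_norml => /andP[_].
  have := fe x; lra.
split => //; have [pf' cf' _] := wf'.
have w1' := weight_add_trig k t pf' cf' f's (lexx _).
have f's' x : `|- s| <= f' x by rewrite normrN.
have w2' := weight_add_trig k t pf' cf' f's' (lexx _).
have k1 := h1 _ w1' _; have k2 := h2 _ w2' _; have k3 := h3 _ wf' _.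
have /k1 : forall x, `|f x + s * trig k t x - (f' x + s * trig k t x)| <= e1.
  by move=> x; rewrite opprD addrACA subrr addr0; apply: ff; rewrite !ge_min lexx !orbT.
have /k2 : forall x, `|f x + (- s) * trig k t x - (f' x + (- s) * trig k t x)| <= e2.
  by move=> x; rewrite opprD addrACA subrr addr0; apply: ff; rewrite !ge_min lexx !orbT.
have /k3 : forall x, `|f x - f' x| <= e3.
  by apply: ff; rewrite !ge_min lexx !orbT.
by move=> q3 q2 q1; exact: second_difference_dist q1 q2 q3.
Qed.

(* Along the segment [f + s g] the function [G] is concave with a bounded
   derivative, so most of its second differences are small. *)
Lemma second_difference_large f k t (a m : R) : weight f -> 0 < a -> (forall x, a <= f x) -> 0 < m ->
  exists s u, [/\ 0 < u, 0 <= s - u, s + u <= a &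
    - (u / m) < second_difference (fun x => f x + s * trig k t x) (trig k t) u].
Proof.
move=> wf a0 fa m0; have [pf cf _] := wf.
pose h s := G (fun x => f x + s * trig k t x).
have wh s : 0 <= s <= a -> weight (fun x => f x + s * trig k t x).
  by move=> /andP[s0 sa]; apply: weight_add_trig pf cf fa _; rewrite ger0_norm.
have bt := @bmeas_trig R d k t.
(* The minimizer at [s] is a competitor at every other point of the segment; as characters are
   bounded by 1, its mass bounds the slope. *)
have step s : 0 <= s <= a -> exists B, forall s', 0 <= s' <= a -> h s' <= h s + `|s' - s| * B.
  move=> hs; have [mu [gmu e]] := cell_min_ex (wh s hs).
  exists (mass (shift mu)) => s'' hs''.
  apply: (le_trans (cell_min_le hF p (weight_ge0 (wh _ hs'')) gmu)).
  rewrite (energyB (shift mu) (bmeas_weight (wh _ hs)) (bmeas_weight (wh _ hs''))) e lerD2l.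
  rewrite (le_trans (ler_norm _))//; apply: Rintegral_tvar_le => [|x].
    exact: bmeasB (bmeas_weight (wh _ hs'')) (bmeas_weight (wh _ hs)).
  rewrite opprD addrACA subrr add0r -mulrBl normrM ler_piMr//; exact: trig_le1.
have a00 : 0 <= (0 : R) <= a by rewrite lexx ltW.
have aa : 0 <= a <= a by rewrite lexx ltW.
have [B1 hB1] := step 0 a00; have [B2 hB2] := step a aa.
have [||s [u [u0 su sa hu]]] := @second_difference_small R h a (Num.max B1 B2) m a0 m0.
- move=> s hs; have := hB1 s hs; move: (hs) => /andP[s0 _]; rewrite subr0 ger0_norm//.
  by move=> /le_trans; apply; rewrite lerD2l ler_wpM2l// le_max lexx.
- move=> s hs; have hs' : 0 <= a - s <= a by move: hs => /andP[h1 h2]; apply/andP; split; lra.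
  have := hB2 _ hs'; move: (hs) => /andP[s0 _].
  rewrite (_ : a - s - a = - s); last by ring.
  rewrite normrN ger0_norm// => /le_trans; apply.
  by rewrite lerD2l ler_wpM2l// le_max lexx orbT.
exists s, u; split => //; move: hu; rewrite /second_difference /h.
have -> : (fun x => f x + s * trig k t x + u * trig k t x) = fun x => f x + (s + u) * trig k t x.
  by apply/funext => x; ring.
have -> // : (fun x => f x + s * trig k t x + - u * trig k t x) = fun x => f x + (s - u) * trig k t x.
by apply/funext => x; ring.
Qed.

End CellMin.

(** * Uniqueness *)

(** Here A, B and C stand for the integrals of s_i^2, of the square of the i-th coordinate of
    another direction, and of their product, so A + B - 2 C is the integral of a squared difference.
    All these terms are nonnegative and their total is m + m - 2 m = 0. *)
Lemma sum_square_eq0 (R : realFieldType) n (A B1 B2 C1 C2 : 'I_n -> R) (m : R) :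
  \sum_i A i = m -> \sum_i B1 i = m -> \sum_i B2 i = m ->
  (forall i, C1 i + C2 i = 2 * A i) ->
  (forall i, 0 <= A i + B1 i - 2 * C1 i) -> (forall i, 0 <= A i + B2 i - 2 * C2 i) ->
  (forall i, A i + B1 i - 2 * C1 i = 0) /\ (forall i, A i + B2 i - 2 * C2 i = 0).
Proof.
move=> hA h1 h2 hC p1 p2.
have D0 : \sum_i ((A i + B1 i - 2 * C1 i) + (A i + B2 i - 2 * C2 i)) = 0.
  transitivity (\sum_i (B1 i + (B2 i + - (A i + A i)))).
    by apply: eq_bigr => i _; have := hC i; lra.
  by rewrite !big_split/= sumrN big_split/= hA h1 h2; ring.
have Di i : (A i + B1 i - 2 * C1 i) + (A i + B2 i - 2 * C2 i) = 0.
  have /eqP := D0; rewrite psumr_eq0 => [/allP/(_ i)|j _]; last by rewrite addr_ge0.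
  by rewrite mem_index_enum => /(_ isT)/eqP.
by split=> i; have := Di i; have := p1 i; have := p2 i; lra.
Qed.

Section Uniqueness.
Context {R : realType} {d : nat}.
Local Notation leb := (torus_measure R d).
Implicit Types (mu kappa : @vmeasure _ 'rV[R]_d R d).

Lemma bcf_tvar kappa : bcf (fun a : 'rV[R]_d -> R => \int[tvar kappa]_x a x).
Proof.
have h : bcf (pint (tvar kappa) id (cst 1)).
  by apply: bcf_pint; [exact: measurable_id|exact: (bmeas_integrable (tvar kappa) (bmeas_cst 1))].
rewrite (_ : (fun a => _) = pint (tvar kappa) id (cst 1))//.
by apply/funext => a; apply: eq_Rintegral => x _; rewrite mulr1.
Qed.

Lemma tvar_cube_carried kappa : carried kappa ->
  cube_carried (fun a : 'rV[R]_d -> R => \int[tvar kappa]_x a x).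
Proof.
move=> ck a b [ma _] [mb _] ab; apply: ae_Rintegral_eq => //.
by move: (ae_tvar_cube ck); apply: filterS => x cx; rewrite ab.
Qed.

Lemma tvar_trig_eq kappa1 kappa2 : carried kappa1 -> carried kappa2 ->
  (forall k (b : bool), let t := if b then pi / 2 else 0 in
    \int[tvar kappa1]_x trig k t x = \int[tvar kappa2]_x trig k t x) ->
  forall a, bmeas a -> \int[tvar kappa1]_x a x = \int[tvar kappa2]_x a x.
Proof.
move=> c1 c2 h; apply: (bcf_trig_eq (bcf_tvar kappa1) (bcf_tvar kappa2)
  (@tvar_cube_carried _ c1) (@tvar_cube_carried _ c2)) => k t.
rewrite -[t]add0r (bcf_trig_rot k 0 t (bcf_tvar kappa1)) (bcf_trig_rot k 0 t (bcf_tvar kappa2)).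
by have := h k false; have := h k true => /= h1 h2; rewrite add0r h1 h2.
Qed.

Lemma ae_eq0_Rintegral kappa (g : 'rV[R]_d -> R) : bmeas g -> (forall x, 0 <= g x) ->
  \int[tvar kappa]_x g x = 0 -> {ae tvar kappa, forall x, g x = 0}.
Proof.
move=> bg g0 ig; have := @ae_le0_integral _ _ _ (tvar kappa) g (bmeas_integrable (tvar kappa) bg).
case=> [A mA|N [mN N0 hN]]; last first.
  exists N; split => // x /= gx; apply: hN => /= gx0; apply: gx; apply/le_anti.
  by rewrite gx0 g0.
rewrite -ig [X in X <= _]Rintegral_mkcond; apply: le_Rintegral => //.
- apply: (eq_integrable measurableT (EFin \o (fun x => g x * \1_A x))).
    by move=> x _ /=; rewrite patchE indicE; case: ifP => _; rewrite ?mulr1 ?mulr0.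
  by apply: (bmeas_integrable (tvar kappa)); apply: bmeasM => //; exact: bmeas_indic.
- exact: (bmeas_integrable (tvar kappa) bg).
by move=> x _; rewrite patchE; case: ifP.
Qed.

Lemma int_dir_sqr kappa : \int[tvar kappa]_x (\sum_i dir kappa x 0 i ^+ 2) = \int[tvar kappa]_x (cst 1 x).
Proof.
apply: ae_Rintegral_eq => //.
  by apply: measurable_sum => i; apply: measurable_funX; exact: measurable_dir_coord.
by move: (ae_enorm_dir kappa); apply: filterS => x e; rewrite -enorm_sqr e expr1n.
Qed.

(* Strict convexity of the Euclidean ball: equal total variations force the
   densities of [kappa1] and [kappa2] to agree with that of their mean. *)
Lemma mean_cint_eq kappa kappa1 kappa2 :
  (forall i a, bmeas a -> 2 * cint kappa i a = cint kappa1 i a + cint kappa2 i a) ->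
  (forall a, bmeas a -> \int[tvar kappa]_x a x = \int[tvar kappa1]_x a x) ->
  (forall a, bmeas a -> \int[tvar kappa]_x a x = \int[tvar kappa2]_x a x) ->
  forall i a, bmeas a -> cint kappa1 i a = cint kappa2 i a.
Proof.
move=> hm h1 h2.
pose J a : R := \int[tvar kappa]_x a x.
have bJ : bcf J := bcf_tvar kappa.
pose s := dir kappa; pose s1 := dir kappa1; pose s2 := dir kappa2.
have bs i : bmeas (fun x => s x 0 i) := bmeas_dir_coord kappa i.
have bs1 i : bmeas (fun x => s1 x 0 i) := bmeas_dir_coord kappa1 i.
have bs2 i : bmeas (fun x => s2 x 0 i) := bmeas_dir_coord kappa2 i.
have c1E i a : bmeas a -> cint kappa1 i a = J (fun x => a x * s1 x 0 i).
  by move=> ba; rewrite /J h1//; exact: bmeasM.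
have c2E i a : bmeas a -> cint kappa2 i a = J (fun x => a x * s2 x 0 i).
  by move=> ba; rewrite /J h2//; exact: bmeasM.
have bsq (f g : 'I_d -> 'rV[R]_d -> R) : (forall i, bmeas (f i)) -> (forall i, bmeas (g i)) ->
    forall i, bmeas (fun x => (f i x - g i x) ^+ 2).
  by move=> bf bg i; have := bmeasM (bmeasB (bf i) (bg i)) (bmeasB (bf i) (bg i)).
have bsqr (f : 'I_d -> 'rV[R]_d -> R) : (forall i, bmeas (f i)) -> forall i, bmeas (fun x => f i x ^+ 2).
  by move=> bf i; have := bmeasM (bf i) (bf i).
have Jsq (f g : 'I_d -> 'rV[R]_d -> R) : (forall i, bmeas (f i)) -> (forall i, bmeas (g i)) -> forall i,
    J (fun x => (f i x - g i x) ^+ 2) = J (fun x => f i x ^+ 2) + J (fun x => g i x ^+ 2) - 2 * J (fun x => f i x * g i x).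
  move=> bf bg i; rewrite -(bcfD bJ)//; try exact: bsqr.
  rewrite -(bcfZ bJ); last exact: bmeasM.
  rewrite -(bcfB bJ); [|by apply: bmeasD; exact: bsqr|by apply: bmeasZ; exact: bmeasM].
  by congr J; apply/funext => x; ring.
have J1 : \sum_i J (fun x => s x 0 i ^+ 2) = J (cst 1).
  rewrite -(bcf_sum (index_enum 'I_d) bJ (bsqr _ bs)); exact: int_dir_sqr.
have J1' : \sum_i J (fun x => s1 x 0 i ^+ 2) = J (cst 1).
  have bsum : bmeas (fun x => \sum_i s1 x 0 i ^+ 2) := bmeas_sum (index_enum 'I_d) (bsqr _ bs1).
  rewrite -(bcf_sum (index_enum 'I_d) bJ (bsqr _ bs1)) /J (h1 _ bsum) (h1 _ (bmeas_cst 1)).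
  exact: int_dir_sqr.
have J1'' : \sum_i J (fun x => s2 x 0 i ^+ 2) = J (cst 1).
  have bsum : bmeas (fun x => \sum_i s2 x 0 i ^+ 2) := bmeas_sum (index_enum 'I_d) (bsqr _ bs2).
  rewrite -(bcf_sum (index_enum 'I_d) bJ (bsqr _ bs2)) /J (h2 _ bsum) (h2 _ (bmeas_cst 1)).
  exact: int_dir_sqr.
(* The mean identity is tested with the coordinate [i] of the direction of the mean itself. *)
have Jx i : J (fun x => s x 0 i * s1 x 0 i) + J (fun x => s x 0 i * s2 x 0 i) = 2 * J (fun x => s x 0 i ^+ 2).
  exact: (etrans (congr2 +%R (esym (c1E i _ (bs i))) (esym (c2E i _ (bs i)))) (esym (hm i _ (bs i)))).
have Jpos a : (forall x, 0 <= a x) -> 0 <= J a by move=> a0; exact: Rintegral_ge0.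
have Q1 i := Jsq (fun i x => s x 0 i) (fun i x => s1 x 0 i) bs bs1 i.
have Q2 i := Jsq (fun i x => s x 0 i) (fun i x => s2 x 0 i) bs bs2 i.
have [D10 D20] := sum_square_eq0 J1 J1' J1'' Jx
  (fun i => eq_ind _ (fun z => 0 <= z) (Jpos _ (fun x => sqr_ge0 _)) _ (Q1 i))
  (fun i => eq_ind _ (fun z => 0 <= z) (Jpos _ (fun x => sqr_ge0 _)) _ (Q2 i)).
have e1 i a : bmeas a -> J (fun x => a x * s x 0 i) = J (fun x => a x * s1 x 0 i).
  move=> ba; apply: ae_Rintegral_eq; [exact: (bmeasM ba (bs i)).1|exact: (bmeasM ba (bs1 i)).1|].
  move: (ae_eq0_Rintegral (bsq _ _ bs bs1 i) (fun x => sqr_ge0 _) (etrans (Q1 i) (D10 i))); apply: filterS => x /eqP.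
  by rewrite sqrf_eq0 subr_eq0 => /eqP ->.
have e2 i a : bmeas a -> J (fun x => a x * s x 0 i) = J (fun x => a x * s2 x 0 i).
  move=> ba; apply: ae_Rintegral_eq; [exact: (bmeasM ba (bs i)).1|exact: (bmeasM ba (bs2 i)).1|].
  move: (ae_eq0_Rintegral (bsq _ _ bs bs2 i) (fun x => sqr_ge0 _) (etrans (Q2 i) (D20 i))); apply: filterS => x /eqP.
  by rewrite sqrf_eq0 subr_eq0 => /eqP ->.
move=> i a ba.
exact: (etrans (c1E i a ba) (etrans (esym (e1 i a ba)) (etrans (e2 i a ba) (esym (c2E i a ba))))).
Qed.

(** At a nonzero frequency some k_i is nonzero, and the gradient determines the Fourier coefficient;
    frequency 0 is absorbed into the difference of the means, as [trig 0 0] is the constant 1. *)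
Lemma eq_gradient_cst (v w : 'rV[R]_d -> R) mu nu : L1torus v -> L1torus w ->
  trig_gradient v mu -> trig_gradient w nu ->
  (forall i k t, cint mu i (trig k t) = cint nu i (trig k t)) ->
  exists c : R, {ae leb, forall x, w x = v x + c}.
Proof.
move=> hv hw tv tw e; have bv := bcf_L1 hv; have bw := bcf_L1 hw.
pose c : R := pint leb id w (trig 0 0) - pint leb id v (trig 0 0).
pose g x : R := w x - v x - c.
have iwv : leb.-integrable setT (EFin \o (fun x => w x - v x)).
  by apply: integrableBr => //; [exact: hw.2|exact: hv.2].
have ig : leb.-integrable setT (EFin \o g).
  by apply: integrableBr => //; exact: (bmeas_integrable leb (bmeas_cst c)).
have bg := bcf_pint (@measurable_id _ _ setT) ig.
have gE a : bmeas a -> pint leb id g a = pint leb id w a - pint leb id v a - c * \int[leb]_x a x.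
  move=> ba; have iw := pint_integrable (@measurable_id _ _ setT) hw.2 ba.
  have iv := pint_integrable (@measurable_id _ _ setT) hv.2 ba.
  rewrite /pint -RintegralB// -RintegralZl//; last exact: bmeas_integrable.
  rewrite -RintegralB//.
  - by apply: eq_Rintegral => x _; rewrite /g /=; ring.
  - exact: integrableBr.
  - by apply: (bmeas_integrable leb); exact: bmeasZ.
have g0 a : bmeas a -> pint leb id g a = 0.
  apply: (bcf_trig_eq0 bg).
    apply: pint_cube_carried; last exact: ae_fund_cube.
    by apply/measurable_EFinP; exact: measurable_int ig.
  move=> k t; rewrite gE ?Rintegral_trig; last exact: bmeas_trig.
  have [->|k0] := eqVneq k 0.
    have L0 (L : ('rV[R]_d -> R) -> R) : bcf L -> L (trig 0 t) = cos t * L (trig 0 0).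
      move=> bL; rewrite -(bcfZ bL); last exact: bmeas_trig.
      by congr L; apply/funext => x; rewrite !trig0 cos0 mulr1.
    by rewrite (L0 _ bv) (L0 _ bw) /c/= mul1r; ring.
  rewrite mul0r mulr0 subr0.
  have [i ki] : exists i, k 0 i != 0.
    apply/existsP; rewrite -negb_forall; apply: contra k0 => /forallP h.
    by apply/eqP/rowP => i; rewrite mxE; exact/eqP.
  have := tv i k (t - pi / 2); have := tw i k (t - pi / 2).
  rewrite !subrK -e => <-; rewrite (bcfZ bv) ?(bcfZ bw); try exact: bmeas_trig.
  move=> /mulfI h; rewrite h ?subrr//.
  by rewrite !mulf_neq0 ?pnatr_eq0 ?intr_eq0// gt_eqF// pi_gt0.
have gA A : measurable A -> \int[leb]_(x in A) g x = 0.
  move=> mA; rewrite -[RHS](g0 _ (bmeas_indic mA)) [LHS]Rintegral_mkcond.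
  by apply: eq_Rintegral => x _; rewrite patchE indicE; case: ifP => _; rewrite ?mul1r ?mul0r.
have h1 : {ae leb, forall x, g x <= 0}.
  by apply: ae_le0_integral => // A mA; rewrite gA.
have h2 : {ae leb, forall x, - g x <= 0}.
  have iNg : leb.-integrable setT (EFin \o (fun x => - g x)).
    by have := integrableN ig; apply: eq_integrable.
  apply: ae_le0_integral => // A mA.
  rewrite (_ : \int[leb]_(x in A) - g x = - 1 * \int[leb]_(x in A) g x); first by rewrite gA// mulr0.
  rewrite -RintegralZl//; last exact: integrableS ig.
  by apply: eq_Rintegral => x _; rewrite mulN1r.
exists c; apply: (@filterS2 _ _ _ _ _ _ _ h1 h2) => x.
by rewrite oppr_le0 => h3 h4; have := le_anti (introT andP (conj h3 h4)); rewrite /g; lra.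
Qed.

End Uniqueness.

Lemma mean_proportional (R : fieldType) (a b x1 x2 y1 y2 : R) :
  a * x1 = b * y1 -> a * x2 = b * y2 ->
  a * (2^-1 * x1 + 2^-1 * x2) = b * (2^-1 * y1 + 2^-1 * y2).
Proof. by move=> h1 h2; rewrite !mulrDr !(mulrCA _ 2^-1) h1 h2. Qed.

Lemma mean_translate (R : realFieldType) (c x x1 x2 v v1 v2 : R) :
  x = c + v -> v = 2^-1 * v1 + 2^-1 * v2 -> x1 = c + v1 -> x2 = c + v2 ->
  x = 2^-1 * x1 + 2^-1 * x2.
Proof. by move=> -> -> -> ->; field. Qed.

Lemma translate_inj (R : zmodType) (c x1 x2 v1 v2 : R) :
  x1 = c + v1 -> x2 = c + v2 -> x1 = x2 -> v1 = v2.
Proof. by move=> -> -> /addrI. Qed.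

Lemma gap_close (R : realFieldType) (a b c : R) :
  `|a - b| <= 4 * ((a + c) / 8) -> - c < a -> - c < b.
Proof. by rewrite ler_norml => /andP[h1 h2] h3; lra. Qed.

Lemma mean_double (R : realFieldType) (x x1 x2 : R) :
  x = 2^-1 * x1 + 2^-1 * x2 -> 2 * x = x1 + x2.
Proof. by move=> ->; field. Qed.

Lemma archimedean_le (R : archiRealFieldType) (a b : R) :
  (forall m : nat, exists s, 0 < s /\ - (s / m.+1%:R) < s * (a - b)) -> b <= a.
Proof.
move=> h; rewrite leNgt; apply/negP => ab.
have [s [s0]] := h (Num.truncn ((b - a)^-1)).
rewrite -(opprB b) mulrN ltrN2 ltr_pM2l//; apply/negP; rewrite -leNgt.
have ba : 0 < b - a by rewrite subr_gt0.
have ba' : 0 <= (b - a)^-1 by rewrite invr_ge0 ltW.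
have /andP[_ /ltW hm] := truncn_itv ba'.
by rewrite -[leRHS]invrK lef_pV2// ?posrE ?invr_gt0.
Qed.

Lemma mean_sum_le (R : realFieldType) n (x1 x2 : 'I_n -> R) (s g : R) :
  s = \sum_i (2^-1 * x1 i + 2^-1 * x2 i) -> \sum_i x1 i <= g -> \sum_i x2 i <= g -> s <= g.
Proof. by move=> ->; rewrite big_split/= -!mulr_sumr; lra. Qed.

Section Average.
Context {R : realType} {d : nat}.
Local Notation leb := (torus_measure R d).
Implicit Types (mu : @vmeasure _ 'rV[R]_d R d).

Definition vmean mu1 mu2 : @vmeasure _ 'rV[R]_d R d :=
  fun i => cadd (cscale 2^-1 (mu1 i)) (cscale 2^-1 (mu2 i)).

Lemma cint_vmean mu1 mu2 i a : bmeas a ->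
  cint (vmean mu1 mu2) i a = 2^-1 * cint mu1 i a + 2^-1 * cint mu2 i a.
Proof.
move=> ba; apply/esym.
apply: (bcf_cint_eq (L := fun a => 2^-1 * cint mu1 i a + 2^-1 * cint mu2 i a)) => //.
  by apply: bcf_lin; exact: bcf_cint.
move=> A mA; rewrite !cint_indic//.
have -> : vmean mu1 mu2 i A = (2^-1%:E * mu1 i A + 2^-1%:E * mu2 i A)%E by [].
by rewrite fineD ?fineM// ?fin_numM//; exact: fin_num_measure.
Qed.

Lemma cint_shift_vmean p mu1 mu2 i a : bmeas a ->
  cint (shift_vmeasure p (vmean mu1 mu2)) i a =
  2^-1 * cint (shift_vmeasure p mu1) i a + 2^-1 * cint (shift_vmeasure p mu2) i a.
Proof.
move=> ba; exact: (mean_translate (cint_shift p _ i ba) (cint_vmean mu1 mu2 i ba)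
  (cint_shift p _ i ba) (cint_shift p _ i ba)).
Qed.

Lemma gradient_like_vmean mu1 mu2 : gradient_like mu1 -> gradient_like mu2 ->
  gradient_like (vmean mu1 mu2).
Proof.
move=> [c1 k1 z1] [c2 k2 z2]; split.
- move=> i A mA AE.
  have -> : vmean mu1 mu2 i A = (2^-1%:E * mu1 i A + 2^-1%:E * mu2 i A)%E by [].
  by rewrite c1// c2// mule0 adde0.
- move=> i j k t; rewrite !cint_vmean; try exact: bmeas_trig.
  exact: mean_proportional (k1 i j k t) (k2 i j k t).
- by move=> i t; rewrite cint_vmean ?z1 ?z2 ?mulr0 ?addr0//; exact: bmeas_trig.
Qed.

End Average.

(** * The residual set of weights *)

Section Generic.
Context {R : realType} {d : nat}.
Local Notation leb := (torus_measure R d).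
Variables (F : 'rV[R]_d -> 'rV[R]_d -> R) (hF : admissible F) (p : 'rV[R]_d) (d0 : (0 < d)%N).
Local Notation G := (cell_min F p).
Local Notation shift := (shift_vmeasure p).
Local Notation E := (set_type (nonneg_Cinf R d)).
Implicit Types (f : E).

Lemma weight_nonneg f : weight (val f : Cinf R d).
Proof.
split; [exact: Cinf_periodic|exact: Cinf_continuous|].
exact: (set_mem (valP f)).
Qed.

(** Near differentiability of G along a character, at some scale [s]. The margin [e] keeps both
    perturbations nonnegative for all nearby weights, which makes the condition open. *)
Definition flat k t (m : nat) : set E := [set f | exists s e : R, [/\ 0 < s, 0 < e,
  forall x, s + e <= (val f : Cinf R d) x &
  - (s / m.+1%:R) < second_difference F p (val f : Cinf R d) (trig k t) s]].

Lemma open_flat k t m : open (flat k t m).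
Proof.
rewrite openE => f [s [e [s0 e0 fe hs]]].
pose gap := second_difference F p (val f : Cinf R d) (trig k t) s + s / m.+1%:R.
have gap0 : 0 < gap by rewrite /gap -(opprK (s / _)) subr_gt0.
(* [second_difference_close] loses four times this amount, that is, half of the gap. *)
have g8 : 0 < gap / 8 by exact: divr_gt0.
have fe' x : `|s| + e <= (val f : Cinf R d) x by rewrite gtr0_norm.
have [e' e'0 he'] := second_difference_close hF p d0 k t (weight_nonneg f) e0 fe' g8.
have e1 : 0 < Num.min e' (e / 2) by rewrite lt_min e'0 divr_gt0.
have := @initial_continuous _ _ (set_val : E -> Cinf R d) f _ (near_Cinf (val f) e1).
change (nbhs f [set f' : E | forall x, `|(val f : Cinf R d) x - (val f' : Cinf R d) x| < Num.min e' (e / 2)] ->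
  nbhs f (flat k t m)).
apply: filterS => f' /= hf'.
have hf'1 x : `|(val f : Cinf R d) x - (val f' : Cinf R d) x| <= e'.
  by rewrite (le_trans (ltW (hf' x)))// ge_min lexx.
have hf'2 x : `|(val f : Cinf R d) x - (val f' : Cinf R d) x| <= e / 2.
  by rewrite (le_trans (ltW (hf' x)))// ge_min lexx orbT.
have [_ hd] := he' _ (weight_nonneg f') hf'1.
exists s, (e / 2); split => //; first exact: divr_gt0.
  by move=> x; have := hf'2 x; have := fe x; rewrite ler_norml => h1 /andP[h2 h3]; lra.
exact: gap_close hd hs.
Qed.

(** The given weight is raised by a small constant and then moved along the character to a point
    with a small second difference. *)
Lemma dense_flat k t m : dense (flat k t m).
Proof.
move=> O [f0 Of0] [A oA AO].
have Af0 : nbhs (val f0 : Cinf R d) A.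
  by apply: open_nbhs_nbhs; split => //; move: Of0; rewrite -AO.
have [e e0 he] := near_affC k t Af0.
(* The lift uses [al], while the segment has length al / 2 only: from s + u <= al / 2 the new weight
   is at least al - s >= u + al / 2, which leaves the margin al / 2 above [u]. *)
pose al := e / 2; have al0 : 0 < al by exact: divr_gt0.
have al2 : 0 < al / 2 by exact: divr_gt0.
have [pf cf f00] := weight_nonneg f0.
pose f1 x : R := (val f0 : Cinf R d) x + al.
have wf1 : weight f1.
  split; first by move=> l x; rewrite /f1 pf.
  - by apply: continuous_addr => //; exact: continuous_const.
  - by move=> x; rewrite /f1 addr_ge0// ltW.
have f1a x : al / 2 <= f1 x by rewrite /f1; have := f00 x; lra.
have m0 : (0 : R) < m.+1%:R by rewrite ltr0n.
have [s [u [u0 su sa hu]]] := second_difference_large hF p d0 k t wf1 al2 f1a m0.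
pose f2 := affC (val f0 : Cinf R d) k t al s.
have f2E : (f2 : 'rV[R]_d -> R) = fun x => f1 x + s * trig k t x.
  by apply/funext => x; rewrite /f2/= /affine_trig /f1 addrA.
have f2ge x : u + al / 2 <= f2 x.
  rewrite f2E /f1; have := trig_le1 k t x; have := f00 x; rewrite ler_norml => h0 /andP[h1 h2].
  have s0 : 0 <= s by lra.
  nra.
have f2n : nonneg_Cinf R d f2 by move=> x; have := f2ge x; lra.
pose f3 : E := exist _ f2 (mem_set f2n).
exists f3; split.
  rewrite -AO; apply: he; first by rewrite /al gtr0_norm//; lra.
  have ale : al = e / 2 by [].
  by rewrite ger0_norm; lra.
by exists u, (al / 2); split => //; rewrite -[val f3]/f2 f2E.
Qed.

(** By [trig_rot] the phases 0 and pi / 2 represent all others. Integers that code no triple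
    contribute the whole space, which is open and dense. *)
Definition generic_family (n : nat) : set E :=
  if choice.unpickle n is Some (k, b, m) then flat k (if (b : bool) then pi / 2 else 0) m else setT.

Lemma residual_generic : residual (\bigcap_n generic_family n).
Proof.
exists generic_family; split => // n; rewrite /generic_family.
case: (choice.unpickle n) => [[[k b] m]|].
  by split; [exact: open_flat|exact: dense_flat].
split; first exact: openT.
by move=> O [x Ox] _; exists x.
Qed.

(** The second difference is squeezed between - s / (m + 1) and s times the difference of the two
    integrals; [s] depends on [m] but cancels. Exchanging the minimizers gives the reverse
    inequality. *)
Lemma flat_tvar_le k t f mu1 mu2 : (forall m, flat k t m f) ->
  gradient_like mu1 -> gradient_like mu2 ->
  energy F (val f : Cinf R d) (shift mu1) = G (val f : Cinf R d) ->
  energy F (val f : Cinf R d) (shift mu2) = G (val f : Cinf R d) ->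
  \int[tvar (shift mu2)]_x trig k t x <= \int[tvar (shift mu1)]_x trig k t x.
Proof.
move=> hf g1 g2 e1 e2.
apply: archimedean_le => m; have [s [e [s0 e0 fe hs]]] := hf m.
have [pf cf f0] := weight_nonneg f.
have fs x : s <= (val f : Cinf R d) x by apply: le_trans (fe x); rewrite lerDl ltW.
have w1 := weight_add_trig k t pf cf fs (eq_ind_r (fun z => z <= s) (lexx s) (gtr0_norm s0)).
have w2 := weight_add_trig k t pf cf fs (eq_ind_r (fun z => z <= s) (lexx s) (etrans (normrN s) (gtr0_norm s0))).
exists s; split; first exact: s0.
exact: (lt_le_trans hs (second_difference_le hF (bmeas_weight (weight_nonneg f)) (bmeas_trig k t)
  (weight_ge0 w1) (weight_ge0 w2) g1 g2 e1 e2)).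
Qed.

(** The calibration of the mean is linear and bounds the energies of both minimizers from below, so
    the energy of the mean is at most the mean of their energies. *)
Lemma vmean_minimizer (f : 'rV[R]_d -> R) mu1 mu2 : weight f ->
  gradient_like mu1 -> gradient_like mu2 ->
  energy F f (shift mu1) = G f -> energy F f (shift mu2) = G f ->
  energy F f (shift (vmean mu1 mu2)) = G f.
Proof.
move=> wf g1 g2 e1 e2; have bf := bmeas_weight wf; have f0 := weight_ge0 wf.
apply/le_anti; rewrite (cell_min_le hF p f0 (gradient_like_vmean g1 g2)) andbT.
have [b [bb hb ->]] := energy_calibration hF (shift (vmean mu1 mu2)) bf f0.
have h1 := energy_ge hF (shift mu1) bf f0 bb hb; rewrite e1 in h1.
have h2 := energy_ge hF (shift mu2) bf f0 bb hb; rewrite e2 in h2.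
have e : \sum_i cint (shift (vmean mu1 mu2)) i (b i) =
    \sum_i (2^-1 * cint (shift mu1) i (b i) + 2^-1 * cint (shift mu2) i (b i)).
  by apply: eq_bigr => i _; exact: cint_shift_vmean.
exact: mean_sum_le e h1 h2.
Qed.

Lemma generic_cint_unique f mu1 mu2 : (\bigcap_n generic_family n) f ->
  gradient_like mu1 -> gradient_like mu2 ->
  energy F (val f : Cinf R d) (shift mu1) = G (val f : Cinf R d) ->
  energy F (val f : Cinf R d) (shift mu2) = G (val f : Cinf R d) ->
  forall i a, bmeas a -> cint mu1 i a = cint mu2 i a.
Proof.
move=> gf g1 g2 e1 e2.
have hflat k (b : bool) m : flat k (if b then pi / 2 else 0) m f.
  have := gf (choice.pickle (k, b, m)) I; rewrite /generic_family choice.pickleK.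
  by [].
have g3 := gradient_like_vmean g1 g2.
have e3 := vmean_minimizer (weight_nonneg f) g1 g2 e1 e2.
(* This is applied to the mean, a third minimizer, against each of the two given ones: the three
   total variations coincide, as strict convexity requires. *)
have same nu1 nu2 : gradient_like nu1 -> gradient_like nu2 ->
    energy F (val f : Cinf R d) (shift nu1) = G (val f : Cinf R d) ->
    energy F (val f : Cinf R d) (shift nu2) = G (val f : Cinf R d) ->
    forall a, bmeas a -> \int[tvar (shift nu1)]_x a x = \int[tvar (shift nu2)]_x a x.
  move=> n1 n2 en1 en2; apply: tvar_trig_eq.
  - exact: carried_shift (gl_carried n1).
  - exact: carried_shift (gl_carried n2).
  move=> k b /=; apply/le_anti/andP; split.
    exact: flat_tvar_le (hflat k b) n2 n1 en2 en1.
  exact: flat_tvar_le (hflat k b) n1 n2 en1 en2.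
have hmean i a : bmeas a -> 2 * cint (shift (vmean mu1 mu2)) i a = cint (shift mu1) i a + cint (shift mu2) i a.
  by move=> ba; exact: mean_double (cint_shift_vmean p mu1 mu2 i ba).
have := mean_cint_eq hmean (same _ _ g3 g1 e3 e1) (same _ _ g3 g2 e3 e2).
move=> h i a ba.
exact: (translate_inj (cint_shift p mu1 i ba) (cint_shift p mu2 i ba) (h i a ba)).
Qed.

Lemma is_minimizer_energy (f : 'rV[R]_d -> R) v : weight f ->
  is_minimizer F f p v <-> L1torus v /\ exists mu, [/\ is_gradient v mu, gradient_like mu &
    energy F f (shift mu) = G f].
Proof.
move=> wf; have bf := bmeas_weight wf; split.
  move=> [hv [mu vmu hmin]]; split => //; exists mu.
  have gmu : gradient_like mu by apply/gradient_likeP; exists v.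
  split => //; apply/le_anti; rewrite (cell_min_le hF p (weight_ge0 wf) gmu) andbT.
  have [nu [gnu <-]] := cell_min_ex hF p d0 wf.
  have /gradient_likeP[w [hw wnu]] := gnu.
  by have := hmin w nu hw wnu; rewrite !(cell_energyE hF)// lee_fin.
move=> [hv [mu [vmu gmu e]]]; split; first exact: hv.
exists mu; first exact: vmu.
move=> w nu hw wnu; have gnu : gradient_like nu by apply/gradient_likeP; exists w.
rewrite (cell_energyE hF (shift mu) bf) (cell_energyE hF (shift nu) bf) lee_fin e.
exact: (cell_min_le hF p (weight_ge0 wf) gnu).
Qed.

End Generic.

Theorem theoremB1 (R : realType) (d : nat) (hd : (2 <= d)%N)
    (F : 'rV[R]_d -> 'rV[R]_d -> R) (hF : admissible F)
    (p : 'rV[R]_d) (hp : rational_vector p) :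
  exists O : set (set_type (nonneg_Cinf R d)), residual O /\
    forall f : set_type (nonneg_Cinf R d), O f ->
      (exists v, is_minimizer F (val f) p v) /\
      (forall v w, is_minimizer F (val f) p v -> is_minimizer F (val f) p w ->
        exists c : R, {ae torus_measure R d, forall x, w x = v x + c}).
Proof.
have d0 : (0 < d)%N by exact: leq_trans hd.
exists (\bigcap_n generic_family F p n); split; first exact: residual_generic.
move=> f gf; have wf := weight_nonneg f; split.
  have [mu [gmu e]] := cell_min_ex hF p d0 wf.
  have /gradient_likeP[v [hv vmu]] := gmu.
  by exists v; apply/(is_minimizer_energy hF p d0 _ wf); split => //; exists mu.
move=> v w /(is_minimizer_energy hF p d0 _ wf)[hv [mu [vmu gmu emu]]].
move=> /(is_minimizer_energy hF p d0 _ wf)[hw [nu [wnu gnu enu]]].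
apply: (eq_gradient_cst hv hw (gradient_trig hv vmu) (gradient_trig hw wnu)) => i k t.
have h := generic_cint_unique hF gf gmu gnu emu enu; exact: h (bmeas_trig k t).
Qed.
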